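(* Let $p$ be an odd prime and $G=A_n$ the alternating group. If $n>\max\{6,p+1\}$ then $G$ has no ${\rm Syl}_p$-regular character. If $n=p+1>4$ and $(n,p)\ne(6,3)$ then every ${\rm Syl}_p$-regular character of $G$ is irreducible.
   Context: A character $\chi$ of a finite group $G$ with Sylow $p$-subgroup $S$ is ${\rm Syl}_p$-regular if $\chi(u)=0$ for all $1\ne u\in S$ and $\chi(1)=|S|$. *)

(* Defs.v *)
From HB Require Import structures.
From mathcomp Require Import all_boot all_order all_algebra all_fingroup all_solvable all_field all_character.
Set Implicit Arguments. Unset Strict Implicit. Unset Printing Implicit Defensive.
Import GRing.Theory Num.Theory.
Local Open Scope ring_scope.

Definition syl_regular (gT : finGroupType) (G : {group gT}) (S : {set gT})
  (chi : 'CF(G)) : Prop :=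
  [/\ chi \is a character, chi 1%g = #|S|%:R &
      forall u, u \in S -> u != 1%g -> chi u = 0].

(* Main.v *)
Require Import Defs.
From HB Require Import structures.
From mathcomp Require Import all_boot all_order all_algebra all_fingroup all_solvable all_field all_character.
From mathcomp Require Import zify ring.
Set Implicit Arguments. Unset Strict Implicit. Unset Printing Implicit Defensive.
Import Order.TTheory GRing.Theory Num.Theory GroupScope.
Local Open Scope ring_scope.

(** Every irreducible character of Alt(n), n >= 6, other than 1 has degree at least n - 1: the
    constituents of the restriction to the group generated by two disjoint 3-cycles show that a
    character without product constituents is built from 1 and the character of degree n - 1.
    Since a regular character has degree p for p < n < 2p, this settles n = p + 1 and n < 2p.
    For larger n, averaging over a Sylow subgroup of the alternating group of some of the points,
    or over the base group of a wreath product of C_p with Sym(k), produces regular characters on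
    fewer points, until n = 2p, n = p^2, or n = 7 with p = 3.  When p = 3 the character table of
    Sym(7) suffices.  When p > 3, restrict to a direct product of copies of Alt(p): regularity
    says that, for each tuple of characters of C_p, the multiplicities of the tensor products
    containing it add up to a constant m in {1, p}.  Permuting the blocks gives each tensor product
    an orbit of the same multiplicity, and tensor products with several factors other than 1 and
    the one of degree p - 1 have too large orbits; but such factors must occur, because the
    two disjoint 3-cycles can be moved into a single block. *)

(** The p-part of (kp)! is p ^ (k + v) with v the exponent of p in k!, so on k blocks of p points a
    regular character has degree m p^k with m = p^v: this is 1 for k = 2 and p for k = p. The
    averagings stay regular only where these exponents add up without carries, which is why the
    reductions stop at 2p and p^2. The obstacle in the block argument is that only even permutations
    act. Since p is odd, exchanging two blocks is odd and must be corrected inside a block by an odd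
    permutation, which twists one factor; the correction is harmless at the characters 1 and degree
    p - 1, which extend to the symmetric group. For p >= 7 every other character of Alt(p) contains
    all nontrivial characters of the p-cycle, one of them at least twice; a tensor product with c
    such factors then weighs at least 2^c, against the bound m. For p = 5 all multiplicities are at
    most one and a block is too small for two disjoint 3-cycles. There the tensor products are
    counted exhaustively up to symmetry, and the survivors, which contain the square of the
    character of degree 5, are excluded separately. *)

(* Characters are functions on the ambient type, considered up to equality on G: this avoids
   transporting class functions between groups. *)
Definition charon (gT : finGroupType) (G : {group gT}) (f : gT -> algC) : Prop :=
  exists2 phi : 'CF(G), phi \is a character & {in G, f =1 phi}.

Definition dotf (gT : finGroupType) (G : {group gT}) (f g : gT -> algC) : algC :=
  #|G|%:R^-1 * \sum_(x in G) f x * (g x)^*.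

Lemma dotfC (gT : finGroupType) (G : {group gT}) (f g : gT -> algC) :
  (dotf G f g)^* = dotf G g f.
Proof.
rewrite /dotf rmorphM fmorphV rmorph_nat rmorph_sum; congr (_ * _).
by apply: eq_bigr => x _; rewrite rmorphM /= conjCK mulrC.
Qed.

Lemma avg_const (gT : finGroupType) (G : {group gT}) (c : algC) :
  #|G|%:R^-1 * \sum_(x in G) c = c.
Proof.
rewrite sumr_const -[c *+ _]mulr_natr mulrCA mulVf ?mulr1 //.
by rewrite pnatr_eq0 -lt0n cardG_gt0.
Qed.

(** * Characters as functions: closure properties, slices and averages *)

Section Charon.

Variables (gT : finGroupType) (G : {group gT}).
Implicit Types f g : gT -> algC.

Lemma charon_char (phi : 'CF(G)) : phi \is a character -> charon G phi.
Proof. by exists phi. Qed.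

Lemma charon_irr i : charon G 'chi[G]_i.
Proof. by apply: charon_char; exact: irr_char. Qed.

Lemma charon_ext f g : {in G, f =1 g} -> charon G f -> charon G g.
Proof. by move=> fg [phi Nphi fE]; exists phi => // x Gx; rewrite -fg // fE. Qed.

Lemma charon_res (H : {group gT}) f : H \subset G -> charon G f -> charon H f.
Proof.
move=> sHG [phi Nphi fE]; exists ('Res[H] phi); first exact: cfRes_char.
by move=> x Hx; rewrite cfResE // fE // (subsetP sHG).
Qed.

Lemma dotfE (phi psi : 'CF(G)) : dotf G phi psi = '[phi, psi].
Proof. by rewrite cfdotE. Qed.

Lemma eq_dotf f f' g g' : {in G, f =1 f'} -> {in G, g =1 g'} -> dotf G f g = dotf G f' g'.
Proof.
by move=> ff gg; congr (_ * _); apply: eq_bigr => x Gx; rewrite ff // gg.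
Qed.

Lemma charon_nat f g : charon G f -> charon G g -> dotf G f g \in Num.nat.
Proof.
move=> [phi Nphi fE] [psi Npsi gE]; rewrite (eq_dotf fE gE) dotfE.
exact: Cnat_cfdot_char.
Qed.

Lemma charon1_nat f : charon G f -> f 1%g \in Num.nat.
Proof. by case=> phi Nphi fE; rewrite fE // Cnat_char1. Qed.

Lemma charonJ f x y : charon G f -> x \in G -> y \in G -> f (x ^ y)%g = f x.
Proof. by case=> phi Nphi fE Gx Gy; rewrite !fE ?groupJ // cfunJ. Qed.

Lemma charonV f x : charon G f -> x \in G -> f x^-1%g = (f x)^*.
Proof. by case=> phi Nphi fE Gx; rewrite !fE ?groupV // char_inv. Qed.

Lemma charonM f g : charon G f -> charon G g -> charon G (fun x => f x * g x).
Proof.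
move=> [phi Nphi fE] [psi Npsi gE]; exists (phi * psi); first exact: rpredM.
by move=> x Gx; rewrite cfunE fE // gE.
Qed.

Lemma charon_rep n (rG : mx_representation algC G n) : charon G (fun x => \tr (rG x)).
Proof.
exists (cfRepr rG); first exact: cfRepr_char.
by move=> x Gx; rewrite cfunE Gx.
Qed.

Lemma charon_repP f : charon G f ->
  exists n, exists rG : mx_representation algC G n, {in G, forall x, f x = \tr (rG x)}.
Proof.
case=> phi /char_reprP[[n rG] /= ->] fE; exists n, rG => x Gx.
by rewrite fE // cfunE Gx.
Qed.

Lemma charon_lin (l : gT -> algC) : l 1%g = 1 ->
  {in G &, forall x y, l (x * y)%g = l x * l y} -> charon G l.
Proof.
move=> l1 lM; have rP : mx_repr G (fun x => (l x)%:M : 'M_1).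
  by split=> [|x y Gx Gy]; rewrite ?l1 // lM // scalar_mxM.
apply: charon_ext (charon_rep (MxRepresentation rP)) => x Gx.
by rewrite /= mxtrace_scalar.
Qed.

Lemma charon_1 : charon G (fun=> 1).
Proof. by apply: charon_lin => // x y _ _; rewrite mulr1. Qed.

Lemma charon_prod (I : finType) (F : I -> gT -> algC) :
  (forall i, charon G (F i)) -> charon G (fun x => \prod_i F i x).
Proof.
move=> NF; elim: (index_enum I) => [|i r IHr].
  by apply: charon_ext charon_1 => x _; rewrite big_nil.
by apply: charon_ext (charonM (NF i) IHr) => x _; rewrite big_cons.
Qed.

Lemma charon_dec f : charon G f -> exists n : Iirr G -> nat,
  (forall i, (n i)%:R = dotf G f 'chi_i) /\
  {in G, forall x, f x = \sum_i (n i)%:R * 'chi_i x}.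
Proof.
case=> phi Nphi fE; exists (fun i => Num.truncn '[phi, 'chi_i]).
have nE i : (Num.truncn '[phi, 'chi_i])%:R = '[phi, 'chi_i].
  by rewrite truncnK // Cnat_cfdot_char_irr.
split=> [i|x Gx]; first by rewrite nE (eq_dotf fE (fun _ _ => erefl _)) dotfE.
rewrite fE // {1}[phi]cfun_sum_cfdot sum_cfunE.
by apply: eq_bigr => i _; rewrite cfunE nE.
Qed.

(** Recognises a class function as a character from its multiplicities alone. Slices, permutation
    characters and induced characters are obtained in this way without building a representation. *)
Lemma charon_of_dot f :
  {in G &, forall x y, f (x ^ y)%g = f x} ->
  (forall i, dotf G f 'chi[G]_i \in Num.nat) -> charon G f.
Proof.
move=> fJ fN.
have fP : is_class_fun <<G>> [ffun x => if x \in G then f x else 0].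
  rewrite genGid; apply: intro_class_fun => [x y Gx Gy | x /negbTE-> //].
  by rewrite memJ_norm ?(subsetP (normG G)) // Gx fJ.
pose phi := Cfun 0 fP.
have phiE : {in G, f =1 phi} by move=> x Gx; rewrite cfunE Gx.
exists phi => //; rewrite [phi]cfun_sum_cfdot.
apply: rpred_sum => i _; rewrite rpredZ_nat ?irr_char //.
by rewrite -dotfE -(eq_dotf phiE (fun _ _ => erefl _)).
Qed.

Lemma charon_ker f : charon G f ->
  exists K : {group gT}, [/\ K <| G, {in G, forall x, (x \in K) = (f x == f 1%g)} &
    {in K & G, forall x y, f (x * y)%g = f y}].
Proof.
case=> phi Nphi fE; exists [group of cfker phi]; split; first exact: cfker_normal.
  by move=> x Gx; rewrite (_ : (x \in _) = (x \in cfker phi)) // cfkerEchar // inE Gx !fE.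
move=> x y Kx Gy; have Gx : x \in G by apply: (subsetP (cfker_sub phi)).
by rewrite !fE ?groupM // cfkerMl.
Qed.

End Charon.

Lemma charon_morph (gT : finGroupType) (G : {group gT}) (hT : finGroupType) (H : {group hT}) (h : hT -> gT) (f : gT -> algC) :
  {in H &, {morph h : x y / x * y}%g} -> {in H, forall x, h x \in G} ->
  charon G f -> charon H (fun x => f (h x)).
Proof.
move=> hM hG /charon_repP[n [rG fE]].
have rP : mx_repr H (fun x => rG (h x)).
  split=> [|x y Hx Hy]; last by rewrite hM // repr_mxM ?hG.
  have -> : h 1%g = 1%g by apply: (mulgI (h 1%g)); rewrite -hM ?group1 // !mulg1.
  exact: repr_mx1.
apply: charon_ext (charon_rep (MxRepresentation rP)) => x Hx.
by rewrite fE ?hG.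
Qed.

(* e = CB with BC = 1, so B rG(x) C is a representation on the image of e. *)
Lemma charon_idem (gT : finGroupType) (G M : {group gT}) n (rG : mx_representation algC G n) (e : 'M_n) :
  M \subset G -> e *m e = e -> {in M, forall x, e *m rG x = rG x *m e} ->
  charon M (fun x => \tr (rG x *m e)).
Proof.
move=> sMG ee eM; set B := row_base e; set C := col_base e.
have CB : C *m B = e by exact: mulmx_base.
have BC : B *m C = 1%:M.
  have /row_freeP[B' BB'] : row_free B := row_base_free e.
  have /row_fullP[C' CC'] : row_full C := col_base_full e.
  move: (B) (C) CB BB' CC' => {}B {}C CB BB' CC'.
  rewrite -[B *m C]mul1mx -CC' -[LHS]mulmx1 -BB'.
  have -> : C' *m C *m (B *m C) *m (B *m B') = C' *m (C *m B *m (C *m B)) *m B'.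
    by rewrite !mulmxA.
  have -> : C *m B *m (C *m B) = C *m B by rewrite [C *m B]CB.
  by rewrite -!mulmxA BB' mulmx1.
move: (B) (C) CB BC => {}B {}C CB BC.
have rP : mx_repr M (fun x => B *m rG x *m C).
  split=> [|x y Mx My]; first by rewrite repr_mx1 mulmx1.
  have -> : B *m rG x *m C *m (B *m rG y *m C) = B *m (rG x *m (C *m B) *m rG y) *m C.
    by rewrite !mulmxA.
  have Be : B *m e = B by rewrite -[RHS]mul1mx -BC -mulmxA CB.
  by rewrite CB -eM // repr_mxM ?(subsetP sMG) // !mulmxA Be.
apply: charon_ext (charon_rep (MxRepresentation rP)) => x Mx /=.
by rewrite -mulmxA mxtrace_mulC -mulmxA CB.
Qed.

Section Slices.

Variables (aT bT : finGroupType) (A : {group aT}) (B : {group bT}).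

Lemma charon_fst (f : aT -> algC) :
  charon A f -> charon [group of setX A B] (fun u => f u.1).
Proof.
by apply: charon_morph => [u v|u]; rewrite !inE //; case/andP.
Qed.

Lemma charon_snd (g : bT -> algC) :
  charon B g -> charon [group of setX A B] (fun u => g u.2).
Proof.
by apply: charon_morph => [u v|u]; rewrite !inE //; case/andP.
Qed.

(** The slice is the character of [A] on the [g]-part of the restriction to [B]. Its product with an
    irreducible character of [A] equals the product of [F] with a product character of the direct
    product, hence is a natural number. *)
Lemma charon_slice (F : aT * bT -> algC) (g : bT -> algC) :
  charon [group of setX A B] F -> charon B g ->
  charon A (fun x => dotf B (fun y => F (x, y)) g).
Proof.
move=> NF Ng; apply: charon_of_dot => [x y Ax Ay|i].
  congr (_ * _); apply: eq_bigr => b Bb; congr (_ * _).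
  have -> : (x ^ y, b)%g = ((x, b) ^ (y, 1))%g :> aT * bT.
    by rewrite [RHS](_ : _ = (x ^ y, b ^ 1)%g) // conjg1.
  by rewrite (charonJ NF) // !inE ?Ax ?Ay //=.
have := charon_nat NF (charonM (charon_fst (charon_irr i)) (charon_snd Ng)).
rewrite /dotf cardsX natrM invfM -mulrA.
rewrite [X in _ -> _ * X \in _](eq_bigr (fun x => #|B|%:R^-1 * \sum_(y in B) F (x, y) * ('chi_i x * g y)^*)).
  move=> /= E; suff <- : #|B|%:R^-1 * \sum_(i0 in setX A B) F i0 * ('chi_i i0.1 * g i0.2)^* =
    \sum_(x in A) #|B|%:R^-1 * \sum_(y in B) F (x, y) * ('chi_i x * g y)^* by [].
  rewrite -mulr_sumr; congr (_ * _); rewrite pair_big /=.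
  by apply: eq_big => [[x y]|[x y] _] //=; rewrite !inE.
move=> x Ax; rewrite -mulrA mulr_suml; congr (_ * _).
by apply: eq_bigr => y By; rewrite rmorphM -mulrA; congr (_ * _); rewrite mulrC.
Qed.

End Slices.

(** The average of the matrices of [Q] is the projection onto the vectors fixed by [Q]. It commutes
    with [M] because [M] normalises [Q], so the average is the character of [M] on these fixed
    vectors. *)
Lemma charon_avg (gT : finGroupType) (G Q M : {group gT}) (f : gT -> algC) :
  Q \subset G -> M \subset G -> M \subset 'N(Q) -> charon G f ->
  charon M (fun x => #|Q|%:R^-1 * \sum_(q in Q) f (x * q)%g).
Proof.
move=> sQG sMG nQM /charon_repP[n [rG fE]].
pose e : 'M_n := #|Q|%:R^-1 *: \sum_(q in Q) rG q.
have Q0 : #|Q|%:R != 0 :> algC by rewrite pnatr_eq0 -lt0n cardG_gt0.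
have eQ q : q \in Q -> rG q *m e = e.
  move=> Qq; rewrite -scalemxAr mulmx_sumr; congr (_ *: _).
  rewrite [RHS](reindex_inj (mulgI q)) /=; apply: eq_big => [r|r Qr].
    by rewrite groupMl.
  by rewrite repr_mxM // (subsetP sQG).
have ee : e *m e = e.
  rewrite {1}/e -scalemxAl mulmx_suml (eq_bigr (fun=> e)) //.
  by rewrite sumr_const -scaler_nat scalerA mulVf // scale1r.
have eM : {in M, forall x, e *m rG x = rG x *m e}.
  move=> x Mx; have Gx := subsetP sMG x Mx; rewrite -scalemxAl -scalemxAr; congr (_ *: _).
  rewrite mulmx_suml mulmx_sumr (reindex_inj (conjg_inj x^-1%g)) /=.
  apply: eq_big => [q|q]; first by rewrite memJ_norm // groupV (subsetP nQM).
  rewrite memJ_norm ?groupV ?(subsetP nQM) // => Qq; have Gq := subsetP sQG q Qq.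
  by rewrite -!repr_mxM ?groupJ ?groupV // conjgE invgK !mulgA mulgKV.
apply: charon_ext (charon_idem sMG ee eM) => x Mx.
rewrite -scalemxAr mxtraceZ mulmx_sumr raddf_sum; congr (_ * _).
apply: eq_bigr => q Qq; have [Gx Gq] := (subsetP sMG x Mx, subsetP sQG q Qq).
by rewrite fE ?groupM // repr_mxM.
Qed.

(** * Even permutations supported on a set *)

Section AltOn.

Variable T : finType.
Implicit Types (S A B : {set T}) (s t : seq T) (g h : {perm T}) (a b c d x y : T).

Lemma altS_group_set S : group_set [set g : {perm T} | perm_on S g & ~~ odd_perm g].
Proof.
apply/group_setP; split=> [|g h]; rewrite !inE ?perm_on1 ?odd_perm1 //.
case/andP=> Sg eg /andP[Sh eh].
by rewrite perm_onM // odd_permM (negPf eg) (negPf eh).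
Qed.

Definition altS S : {group {perm T}} := Group (altS_group_set S).

Lemma altSE S g : (g \in altS S) = perm_on S g && ~~ odd_perm g.
Proof. by rewrite inE. Qed.

Arguments altS : simpl never.
Opaque altS.

Lemma altST : altS setT = 'Alt_T :> {set _}.
Proof.
apply/setP=> g; rewrite altSE Alt_even; case: (odd_perm g); rewrite ?andbF ?andbT //.
by apply/subsetP=> x; rewrite inE.
Qed.

Lemma perm_onS A B g : A \subset B -> perm_on A g -> perm_on B g.
Proof. by move=> sAB Ag; apply: subset_trans sAB. Qed.

Lemma altSS A B : A \subset B -> altS A \subset altS B.
Proof.
by move=> sAB; apply/subsetP=> g; rewrite !altSE => /andP[/(perm_onS sAB)-> ->].
Qed.

Lemma perm_on_tperm S a b : a \in S -> b \in S -> perm_on S (tperm a b).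
Proof.
move=> Sa Sb; apply/subsetP=> x; rewrite inE.
by case: tpermP => [->|->|] //; rewrite eqxx.
Qed.

Lemma altS_fix S g x : g \in altS S -> x \notin S -> g x = x.
Proof. by rewrite altSE => /andP[Sg _] /(out_perm Sg). Qed.

Lemma altS_stable S g x : g \in altS S -> (g x \in S) = (x \in S).
Proof. by rewrite altSE => /andP[Sg _]; rewrite perm_closed. Qed.

Lemma altS_commute A B g h : [disjoint A & B] -> g \in altS A -> h \in altS B ->
  (g * h = h * g)%g.
Proof.
move=> dAB Ag Bh; apply/permP=> x; rewrite !permM.
have [Ax|nAx] := boolP (x \in A).
  by rewrite !(altS_fix Bh) ?(altS_stable _ Ag) ?(disjointFr dAB) ?(altS_stable x Ag).
rewrite (altS_fix Ag nAx) [RHS](altS_fix Ag) //.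
have [Bx|nBx] := boolP (x \in B); last by rewrite (altS_fix Bh).
by rewrite (disjointFl dAB) // (altS_stable x Bh).
Qed.

Lemma pick_out S s : (size s < #|S|)%N -> exists2 x, x \in S & x \notin s.
Proof.
move=> lt; have : ~~ (S \subset [set x in s]).
  apply: contraL lt => /subset_leq_card le; rewrite -leqNgt (leq_trans le) //.
  by rewrite cardsE card_size.
by case/subsetPn=> x Sx; rewrite inE => ?; exists x.
Qed.

Lemma perm_to S s t : uniq s -> uniq t -> size s = size t ->
  {subset s <= S} -> {subset t <= S} -> exists2 g, perm_on S g & map g s = t.
Proof.
elim: s t => [|a s IHs] [|b t] //=; first by exists 1%g; rewrite ?perm_on1.
move=> /andP[nas us] /andP[nbt ut] [est] sS tS.
have [x sx|x tx|g Sg gst] := IHs t us ut est.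
- by apply: sS; rewrite inE sx orbT.
- by apply: tS; rewrite inE tx orbT.
have ngat : g a \notin t by rewrite -gst mem_map //; exact: perm_inj.
exists (g * tperm (g a) b)%g.
  apply: perm_onM => //; apply: perm_on_tperm; last by rewrite tS ?mem_head.
  by rewrite perm_closed // sS ?mem_head.
rewrite permM tpermL; congr (_ :: _); rewrite -[RHS]gst.
apply/eq_in_map => x sx; rewrite permM tpermD //.
  by rewrite (inj_eq perm_inj); apply: contraNneq nas => ->.
by apply: contraNneq nbt => ->; rewrite -gst map_f.
Qed.

(** The two spare points of [S] outside [t] provide a transposition that corrects the parity without
    disturbing the images. *)
Lemma alt_to S s t : uniq s -> uniq t -> size s = size t ->
  {subset s <= S} -> {subset t <= S} -> ((size s).+2 <= #|S|)%N ->
  exists2 g, g \in altS S & map g s = t.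
Proof.
move=> us ut est sS tS lt; have [g Sg gst] := perm_to us ut est sS tS.
have [og|eg] := boolP (odd_perm g); last by exists g; rewrite ?altSE ?Sg.
have [x Sx ntx] := @pick_out S t ltac:(by rewrite -est ltnW).
have [y Sy] := @pick_out S (x :: t) ltac:(by rewrite /= -est).
rewrite inE negb_or eq_sym => /andP[xy nty].
exists (g * tperm x y)%g.
  by rewrite altSE perm_onM ?perm_on_tperm // odd_permM og odd_tperm xy.
rewrite -[RHS]gst; apply/eq_in_map => z sz; rewrite permM tpermD //.
  by apply: contraNneq ntx => ->; rewrite -gst map_f.
by apply: contraNneq nty => ->; rewrite -gst map_f.
Qed.

Definition cyc3 a b c : {perm T} := (tperm a b * tperm a c)%g.

Definition dtr a b c d : {perm T} := (tperm a b * tperm c d)%g.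

Lemma cyc3J a b c g : ((cyc3 a b c) ^ g = cyc3 (g a) (g b) (g c))%g.
Proof. by rewrite conjMg !tpermJ. Qed.

Lemma dtrJ a b c d g : ((dtr a b c d) ^ g = dtr (g a) (g b) (g c) (g d))%g.
Proof. by rewrite conjMg !tpermJ. Qed.

Lemma uniq3 a b c : uniq [:: a; b; c] -> [/\ a != b, a != c & b != c].
Proof. by rewrite /= !inE negb_or -!andbA => /and4P[-> -> ->]. Qed.

Lemma cyc3_1 a b c : uniq [:: a; b; c] -> cyc3 a b c a = b.
Proof. by case/uniq3=> ab ac bc; rewrite permM tpermL tpermD // eq_sym. Qed.

Lemma cyc3_2 a b c : uniq [:: a; b; c] -> cyc3 a b c b = c.
Proof. by case/uniq3=> ab ac bc; rewrite permM tpermR tpermL. Qed.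

Lemma cyc3_3 a b c : uniq [:: a; b; c] -> cyc3 a b c c = a.
Proof. by case/uniq3=> ab ac bc; rewrite permM (tpermD ac bc) tpermR. Qed.

Lemma cyc3_D a b c x : x \notin [:: a; b; c] -> cyc3 a b c x = x.
Proof.
by rewrite !inE !negb_or => /and3P[xa xb xc]; rewrite permM !tpermD // eq_sym.
Qed.

Lemma cyc3_rot a b c : uniq [:: a; b; c] -> cyc3 b c a = cyc3 a b c.
Proof.
move=> u; have u' : uniq [:: b; c; a] by rewrite -(rot_uniq 1) in u.
apply/permP=> x; have [|nx] := boolP (x \in [:: a; b; c]); last first.
  rewrite !cyc3_D //; apply: contra nx; rewrite !inE; do !case/orP; move=> ->; rewrite ?orbT //.
by rewrite !inE => /or3P[] /eqP->; rewrite ?(cyc3_1 u, cyc3_2 u, cyc3_3 u, cyc3_1 u', cyc3_2 u', cyc3_3 u').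
Qed.

Lemma cyc3V a b c : uniq [:: a; b; c] -> ((cyc3 a b c)^-1 = cyc3 a c b)%g.
Proof.
by move=> u; rewrite invMg !tpermV.
Qed.

Lemma cyc3_sq a b c : uniq [:: a; b; c] -> (cyc3 a b c * cyc3 a b c = cyc3 a c b)%g.
Proof.
move=> u; have u' : uniq [:: a; c; b].
  by rewrite -(rot_uniq 1) -rev_uniq.
apply/permP=> x; have [|nx] := boolP (x \in [:: a; b; c]); last first.
  by rewrite permM !cyc3_D //; move: nx; rewrite !inE !negb_or => /and3P[-> -> ->].
rewrite permM !inE => /or3P[] /eqP->;
  by rewrite ?(cyc3_1 u, cyc3_2 u, cyc3_3 u) ?(cyc3_1 u, cyc3_2 u, cyc3_3 u, cyc3_1 u', cyc3_2 u', cyc3_3 u').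
Qed.

Lemma cyc3_alt S a b c : uniq [:: a; b; c] -> {subset [:: a; b; c] <= S} ->
  cyc3 a b c \in altS S.
Proof.
case/uniq3=> ab ac bc sS; rewrite altSE perm_onM ?perm_on_tperm ?sS ?inE ?eqxx ?orbT //.
by rewrite odd_permM !odd_tperm ab ac.
Qed.

Lemma cyc3_neq1 a b c : uniq [:: a; b; c] -> cyc3 a b c != 1%g.
Proof.
move=> u; have [ab _ _] := uniq3 u.
by apply: contraNneq ab => /permP/(_ a); rewrite cyc3_1 // perm1 => ->.
Qed.

Lemma dtr_alt S a b c d : uniq [:: a; b; c; d] -> {subset [:: a; b; c; d] <= S} ->
  dtr a b c d \in altS S.
Proof.
rewrite /= !inE !negb_or -!andbA => /and4P[ab _ _ /and4P[_ _ cd _]] sS.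
rewrite perm_onM ?perm_on_tperm ?sS ?inE ?eqxx ?orbT //.
by rewrite odd_permM !odd_tperm ab cd.
Qed.

(** Induction on the number of moved points. With b = g(a) and a third moved point c, multiplying by
    the 3-cycle (b a c) makes a fixed and moves no new point; c exists because an even permutation
    cannot move only a and b. *)
Lemma altS_gen S (H : {group {perm T}}) :
  (forall a b c, uniq [:: a; b; c] -> {subset [:: a; b; c] <= S} -> cyc3 a b c \in H) ->
  altS S \subset H.
Proof.
move=> cH; apply/subsetP=> g; have [n] := ubnP #|[set x | g x != x]|.
elim: n g => // n IHn g lt Sg.
have [/eqP E|[a]] := set_0Vmem [set x | g x != x].
  suff -> : g = 1%g by rewrite group1.
  apply/permP=> x; rewrite perm1; apply/eqP; apply/negPn.
  by have := in_set0 x; rewrite -(eqP E) inE => ->.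
rewrite inE => ga; pose b := g a; have ab : a != b by rewrite eq_sym.
have mS x : g x != x -> x \in S by apply: contraNT => /(altS_fix Sg)->.
have gb : g b != b by rewrite (inj_eq perm_inj).
have [c gc] : exists2 c, g c != c & c \notin [:: a; b].
  have [/exists_inP[c gc nc]|] := boolP [exists (c | g c != c), c \notin [:: a; b]].
    by exists c.
  rewrite negb_exists_in => /forall_inP fc.
  have : odd_perm (g * tperm a b) = ~~ odd_perm g by rewrite odd_permM odd_tperm ab addbT.
  have -> : (g * tperm a b = 1)%g.
    apply/permP=> x; rewrite permM perm1.
    have [xab|nx] := boolP (x \in [:: a; b]); last first.
      have /eqP-> : g x == x by apply: contraNT nx => /fc; rewrite negbK.
      by move: nx; rewrite !inE negb_or => /andP[??]; rewrite tpermD // eq_sym.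
    move: xab; rewrite !inE => /orP[] /eqP->; first by rewrite tpermR.
    have : g b \in [:: a; b] by apply: contraTT isT => /negPf h; have := fc (g b); rewrite (inj_eq perm_inj) => /(_ gb); rewrite h.
    by rewrite !inE (negPf gb) orbF => /eqP->; rewrite tpermL.
  by move: Sg; rewrite altSE odd_perm1 => /andP[_ /negPf->].
rewrite !inE negb_or => /andP[ca cb].
have u : uniq [:: b; a; c] by rewrite /= !inE negb_or eq_sym ab /= ![_ == c]eq_sym ca cb.
have sS : {subset [:: b; a; c] <= S}.
  by move=> x; rewrite !inE => /or3P[] /eqP->; apply: mS.
have Hc := cH _ _ _ u sS; have Sc := cyc3_alt u sS.
rewrite -(groupMr _ Hc); apply: IHn; last by rewrite groupM.
rewrite ltnS in lt; apply: leq_trans lt; apply: proper_card; apply/properP; split.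
  apply/subsetP=> x; rewrite !inE; apply: contraNneq => gx; rewrite permM gx cyc3_D //.
  by rewrite !inE !negb_or; apply/and3P; split; apply: contraNneq gb => xE;
     [|move: ga|move: gc]; rewrite -xE gx eqxx.
by exists a; rewrite !inE // permM cyc3_1 // eqxx.
Qed.

Lemma card_altS S : (1 < #|S|)%N -> (2 * #|altS S| = #|S|`!)%N.
Proof.
case/card_gt1P=> a [b] [Sa Sb ab]; rewrite -card_perm.
rewrite -(cardID (mem (altS S)) (perm_on S)) mul2n -addnn.
have -> : #|[predI perm_on S & mem (altS S)]| = #|altS S|.
  by apply: eq_card => g; rewrite !inE /= andbA andbb.
congr (_ + _)%N; rewrite -(card_rcoset (altS S) (tperm a b)).
apply: eq_card => g; rewrite mem_rcoset tpermV !inE /=.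
rewrite odd_permM odd_tperm ab addbT negbK.
have -> : perm_on S (g * tperm a b)%g = perm_on S g.
  apply/idP/idP => Sg; last by rewrite perm_onM // perm_on_tperm.
  by rewrite -[g]mulg1 -(tperm2 a b) mulgA perm_onM // perm_on_tperm.
rewrite (_ : (g \in perm_on S) = perm_on S g) //.
by case: (perm_on S g); case: (odd_perm g).
Qed.

End AltOn.

(** * Slices along two commuting subgroups, and copies of Alt(4) *)

Section Pairs.

Variables (gT aT bT : finGroupType) (G : {group gT}) (A : {group aT}) (B : {group bT}).
Variables (h1 : aT -> gT) (h2 : bT -> gT).
Hypothesis h1M : {in A &, {morph h1 : x y / x * y}%g}.
Hypothesis h2M : {in B &, {morph h2 : x y / x * y}%g}.
Hypothesis h12 : {in A & B, forall x y, h1 x * h2 y = h2 y * h1 x}%g.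
Hypothesis h1G : {in A, forall x, h1 x \in G}.
Hypothesis h2G : {in B, forall x, h2 x \in G}.

Lemma charon_pair f : charon G f ->
  charon [group of setX A B] (fun u => f (h1 u.1 * h2 u.2)%g).
Proof.
apply: charon_morph => [[x y] [x' y']|[x y]]; rewrite !inE /=; last first.
  by case/andP=> Ax By; rewrite groupM ?h1G ?h2G.
case/andP=> Ax By /andP[Ax' By'].
by rewrite h1M // h2M // -!mulgA; congr (_ * _)%g; rewrite !mulgA h12.
Qed.

Lemma charon_pair_slice f g : charon G f -> charon B g ->
  charon A (fun x => dotf B (fun y => f (h1 x * h2 y)%g) g).
Proof. by move=> /charon_pair Nf Ng; apply: charon_slice Nf Ng. Qed.

End Pairs.

(** The cyclic group is taken to be the ordinals under addition, so that both its characters and its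
    maps into a permutation group are given by powers. *)
Lemma charon_root n (z : algC) : z ^+ n.+1 = 1 ->
  charon [set: 'I_n.+1]%G (fun i => z ^+ i).
Proof.
move=> z1; apply: charon_lin => // i j _ _.
by rewrite -exprD /= -[RHS](expr_mod _ z1).
Qed.

Lemma expg_ordM (gT : finGroupType) n (c : gT) : (c ^+ n.+1 = 1)%g ->
  {in [set: 'I_n.+1] &, {morph (fun i : 'I_n.+1 => c ^+ i) : x y / x * y}}%g.
Proof. by move=> c1 i j _ _; rewrite -expgD /= -[RHS](expg_mod _ c1). Qed.

(* A copy of the alternating group of degree four: the multiplicity of its
   linear character sending c to z is a twelfth of this sum. *)
Lemma charon_A4_ge0 (gT : finGroupType) (G : {group gT}) f (t k c : gT) (z : algC) :
  charon G f -> t \in G -> c \in G -> t != 1%g -> (t * t = 1)%g ->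
  (t * k = k * t)%g -> (t ^ c = k)%g -> (k ^ c = t * k)%g -> (c ^+ 3 = 1)%g ->
  z ^+ 3 = 1 -> 0 <= f 1%g + 3%:R * f t + 4%:R * (f c * z^*) + 4%:R * (f c^-1%g * (z ^+ 2)^*).
Proof.
move=> Nf Gt Gc nt tt tk tc kc c3 z3.
have Gk : k \in G by rewrite -tc groupJ.
have nk : k != 1%g by rewrite -tc -(inj_eq (conjg_inj c^-1%g)) conjgK conj1g.
have kk : (k * k = 1)%g by rewrite -tc -conjMg tt conj1g.
have ntk : t != k.
  by apply: contraNneq nk => E; rewrite -(inj_eq (conjg_inj c)) kc E kk conj1g.
have [tkt tkk] : (t * k != t)%g /\ (t * k != k)%g.
  by rewrite -{2}(mulg1 t) -{3}(mul1g k) (inj_eq (mulgI t)) (inj_eq (mulIg k)).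
have tk1 : (t * k != 1)%g.
  by apply: contraNneq ntk => E; rewrite -[k]mul1g -tt -mulgA E mulg1.
pose Q := [set 1%g; t; k; (t * k)%g].
have Qg : group_set Q.
  apply/group_setP; split=> [|x y]; rewrite !inE ?eqxx //.
  have e1 : (k * (t * k) = t)%g by rewrite tk mulgA kk mul1g.
  have e2 : (t * k * t = k)%g by rewrite -mulgA -tk mulgA tt mul1g.
  have e3 : (t * k * (t * k) = 1)%g by rewrite -mulgA e1 tt.
  rewrite -!orbA => /or4P[] /eqP-> /or4P[] /eqP->;
    by rewrite ?mul1g ?mulg1 ?tt ?kk ?e1 ?e2 ?e3 -?tk ?(mulgA t t) ?(mulgA k k) -?(mulgA t k k) ?tt ?kk ?mul1g ?mulg1 ?eqxx ?orbT.
have sQG : Group Qg \subset G.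
  by apply/subsetP=> x; rewrite !inE -!orbA => /or4P[] /eqP->; rewrite ?group1 ?groupM.
have nQ : <[c]>%G \subset 'N(Group Qg).
  rewrite cycle_subG inE; apply/subsetP=> x /imsetP[y]; rewrite !inE -!orbA.
  case/or4P=> /eqP-> ->; rewrite ?conj1g ?conjMg ?tc ?kc ?eqxx ?orbT //.
  by rewrite tk mulgA kk mul1g eqxx ?orbT.
have sumQ (F : gT -> algC) : \sum_(q in Group Qg) F q = F 1%g + F t + F k + F (t * k)%g.
  rewrite (eq_bigl [in [:: 1; t; k; t * k]%g]) => [|x]; last by rewrite !inE -!orbA.
  rewrite -big_uniq /=; last first.
    by rewrite !inE !negb_or ![(1 == _)%g]eq_sym nt nk tk1 ntk ![_ == (t * k)%g]eq_sym tkt tkk.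
  by rewrite !big_cons big_nil addr0 !addrA.
have scG : <[c]>%G \subset G by rewrite cycle_subG.
have Nf0 := charon_avg sQG scG nQ Nf.
have := charon_morph (expg_ordM c3) _ Nf0.
move=> /(_ (fun i _ => mem_cycle c i)) /charon_nat /(_ (charon_root z3)) /natr_ge0.
have card4 : #|Group Qg| = 4%N.
  apply/eqP; rewrite -(eqr_nat algC) -sumr_const sumQ; apply/eqP; ring.
rewrite /dotf cardsT card_ord (eq_bigl predT); last by move=> i; rewrite inE.
rewrite !big_ord_recl big_ord0 /= card4 !sumQ addr0.
rewrite /bump /= expg0 expg1 !mul1g expr0 expr1 rmorph1 mulr1.
have cx x : x \in G -> f (c ^ x)%g = f c by move=> Gx; apply: charonJ Nf Gc Gx.
have c'x x : x \in G -> f (c^-1 ^ x)%g = f c^-1%g.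
  by move=> Gx; apply: charonJ Nf _ Gx; rewrite groupV.
have cc : (c ^+ 2 = c^-1)%g by apply: (mulIg c); rewrite -expgSr c3 mulVg.
have invJ (x y : gT) : (x * x = 1 -> y ^ x = y * (x ^ y * x))%g.
  move=> xx; rewrite conjgE [(x ^ y)%g]conjgE; have -> : (x^-1 = x)%g.
    by apply: (mulIg x); rewrite mulVg xx.
  by rewrite !mulgA mulgV mul1g.
have tkc : ((t * k) ^ c = t)%g by rewrite conjMg tc kc tk mulgA kk mul1g.
have kc' : (k ^ c^-1 = t)%g by rewrite -tc conjgK.
have tkc' : ((t * k) ^ c^-1 = k)%g by rewrite -kc conjgK.
have tc' : (t ^ c^-1 = t * k)%g by rewrite -{1}tkc conjgK.
have e2 : (t * k * t = k)%g by rewrite -mulgA -tk mulgA tt mul1g.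
have e3 : (t * k * (t * k) = 1)%g by rewrite mulgA e2 kk.
have Gtk : (t * k)%g \in G by rewrite groupM.
have E1 : f (c * t)%g = f c by rewrite -(cx k) // invJ // kc -mulgA kk mulg1.
have E2 : f (c * k)%g = f c by rewrite -(cx (t * k)%g) // invJ // tkc (mulgA t t) tt mul1g.
have E3 : f (c * (t * k))%g = f c by rewrite -(cx t) // invJ // tc tk.
have E4 : f (c^-1 * t)%g = f c^-1%g.
  by rewrite -(c'x (t * k)%g) // invJ // tkc' tk (mulgA k k) kk mul1g.
have E5 : f (c^-1 * k)%g = f c^-1%g by rewrite -(c'x t) // invJ // tc' e2.
have E6 : f (c^-1 * (t * k))%g = f c^-1%g by rewrite -(c'x k) // invJ // kc'.
have fk : f k = f t by rewrite -tc (charonJ Nf).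
have ftk : f (t * k)%g = f t by rewrite -kc (charonJ Nf) // fk.
rewrite (_ : (c ^+ (1 + 1))%g = c^-1)%g // (_ : z ^+ (1 + 1) = z ^+ 2) // !mulg1 E1 E2 E3 E4 E5 E6 fk ftk.
set s := (X in 0 <= X -> _) => s0.
rewrite (_ : _ + _ = 12%:R * s); first by rewrite mulr_ge0 ?ler0n.
by rewrite /s; move: (z^*) ((z ^+ 2)^*) => y y'; field.
Qed.

(** * Values on 3-cycles and on products of two transpositions *)

Section Constants.

Variables (T : finType) (S : {set T}) (f : {perm T} -> algC).
Hypothesis Nf : charon (altS S) f.
Implicit Types a b c d : T.

Lemma const_cyc3 a b c a' b' c' : (5 <= #|S|)%N ->
  uniq [:: a; b; c] -> uniq [:: a'; b'; c'] ->
  {subset [:: a; b; c] <= S} -> {subset [:: a'; b'; c'] <= S} ->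
  f (cyc3 a b c) = f (cyc3 a' b' c').
Proof.
move=> S5 u u' sS sS'; have [g Sg [<- <- <-]] := alt_to u u' erefl sS sS' S5.
by rewrite -cyc3J (charonJ Nf) // cyc3_alt.
Qed.

(** Four points suffice: an odd permutation carrying one quadruple to the other is preceded by
    [tperm a b], which is odd and centralises [dtr a b c d]. *)
Lemma const_dtr a b c d a' b' c' d' :
  uniq [:: a; b; c; d] -> uniq [:: a'; b'; c'; d'] ->
  {subset [:: a; b; c; d] <= S} -> {subset [:: a'; b'; c'; d'] <= S} ->
  f (dtr a b c d) = f (dtr a' b' c' d').
Proof.
move=> u u' sS sS'; have [g Sg gE] := perm_to u u' erefl sS sS'.
have Sd := dtr_alt u sS; have [og|eg] := boolP (odd_perm g); last first.
  by case: gE => <- <- <- <-; rewrite -dtrJ (charonJ Nf) // altSE Sg.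
have ab : a != b by move: u => /=; rewrite !inE negb_or; case/andP=> /andP[].
have Sab : perm_on S (tperm a b) by rewrite perm_on_tperm ?sS // !inE eqxx ?orbT.
have <- : (dtr a b c d ^ (tperm a b * g))%g = dtr a' b' c' d'.
  move: u; rewrite /= !inE !negb_or -!andbA => /and5P[_ ac ad bc /and3P[bd _ _]].
  rewrite conjgM dtrJ tpermL tpermR !tpermD //; case: gE => <- <- <- <-.
  by rewrite dtrJ /dtr (tpermC (g b)).
by rewrite (charonJ Nf) // altSE perm_onM // odd_permM og odd_tperm ab.
Qed.

(* An odd permutation carrying one pair of cycles to the other is corrected by
   exchanging the two cycles, an odd permutation commuting with their product. *)
Lemma const_cyc33 a b c d e k a' b' c' d' e' k' :
  uniq [:: a; b; c; d; e; k] -> uniq [:: a'; b'; c'; d'; e'; k'] ->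
  {subset [:: a; b; c; d; e; k] <= S} -> {subset [:: a'; b'; c'; d'; e'; k'] <= S} ->
  f (cyc3 a b c * cyc3 d e k)%g = f (cyc3 a' b' c' * cyc3 d' e' k')%g.
Proof.
move=> u u' sS sS'; have [g Sg gE] := perm_to u u' erefl sS sS'.
have := u : uniq ([:: a; b; c] ++ [:: d; e; k]).
rewrite cat_uniq => /and3P[u1 dis u2].
have s1 : {subset [:: a; b; c] <= S}.
  by move=> x xs; apply: sS; rewrite -[_ :: _]/([:: a; b; c] ++ _) mem_cat xs.
have s2 : {subset [:: d; e; k] <= S}.
  by move=> x xs; apply: sS; rewrite -[_ :: _]/([:: a; b; c] ++ _) mem_cat xs orbT.
have Sd : (cyc3 a b c * cyc3 d e k)%g \in altS S by rewrite groupM ?cyc3_alt.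
have [og|eg] := boolP (odd_perm g); last first.
  by case: gE => <- <- <- <- <- <-; rewrite -!cyc3J -conjMg (charonJ Nf) // altSE Sg.
pose h := (tperm a d * tperm b e * tperm c k)%g.
move: (u); rewrite /= !inE !negb_or -!andbA => /and5P[ab ac ad ae /and5P[ak bc bd be]].
case/and5P=> bk cd ce ck /and4P[de dk ek _].
have hE : map h [:: a; b; c; d; e; k] = [:: d; e; k; a; b; c].
  have n2 (x y : T) : x != y -> ((x == y) = false) * ((y == x) = false).
    by move=> /negPf E; split; rewrite // eq_sym E.
  have q := (n2 _ _ ab, n2 _ _ ac, n2 _ _ ad, n2 _ _ ae, n2 _ _ ak, n2 _ _ bc, n2 _ _ bd,
    n2 _ _ be, n2 _ _ bk, n2 _ _ cd, n2 _ _ ce, n2 _ _ ck, n2 _ _ de, n2 _ _ dk, n2 _ _ ek).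
  have ha : h a = d by rewrite !permM tpermL !tpermD ?q.
  have hb : h b = e by rewrite !permM (tpermD (z := b)) ?q // tpermL tpermD ?q.
  have hc : h c = k by rewrite !permM 2?(tpermD (z := c)) ?q // tpermL.
  have hd : h d = a by rewrite !permM tpermR !tpermD ?q.
  have he : h e = b by rewrite !permM (tpermD (z := e)) ?q // tpermR tpermD ?q.
  have hk : h k = c by rewrite !permM 2?(tpermD (z := k)) ?q // tpermR.
  by rewrite /= ha hb hc hd he hk.
have Sh : perm_on S h.
  by rewrite !perm_onM ?perm_on_tperm ?sS // !inE eqxx ?orbT.
have oh : odd_perm h by rewrite !odd_permM !odd_tperm ad be ck.
have com : commute (cyc3 a b c) (cyc3 d e k).
  apply: (altS_commute (A := [set x in [:: a; b; c]]) (B := [set x in [:: d; e; k]])).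
  - rewrite disjoint_sym disjoints_subset; apply/subsetP=> x; rewrite !inE => xs.
    by apply: contra dis => xs'; apply/hasP; exists x; rewrite !inE.
  - by apply: cyc3_alt => // x; rewrite !inE.
  - by apply: cyc3_alt => // x; rewrite !inE.
have <- : ((cyc3 a b c * cyc3 d e k) ^ (h * g))%g = (cyc3 a' b' c' * cyc3 d' e' k')%g.
  case: gE => <- <- <- <- <- <-; rewrite conjgM (conjMg _ _ h) 2!(cyc3J _ _ _ h).
  by case: hE => -> -> -> -> -> ->; rewrite -com (conjMg _ _ g) 2!(cyc3J _ _ _ g).
by rewrite (charonJ Nf) // altSE perm_onM // odd_permM og oh.
Qed.

Lemma const_cyc3V a b c : (5 <= #|S|)%N -> uniq [:: a; b; c] ->
  {subset [:: a; b; c] <= S} -> f (cyc3 a b c)^-1%g = f (cyc3 a b c).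
Proof.
move=> S5 u sS; rewrite cyc3V //; apply: const_cyc3 => //.
  by rewrite -(rot_uniq 1) -rev_uniq.
by move=> x; rewrite !inE => /or3P[] /eqP->; rewrite sS // !inE eqxx ?orbT.
Qed.

End Constants.

Lemma omega_exists : {w : algC | w ^+ 3 = 1 /\ 1 + w + w ^+ 2 = 0}.
Proof.
have [w wP] := @C_prim_root_exists 3 isT; exists w; have w3 := prim_expr_order wP.
split=> //; have : (w - 1) * (1 + w + w ^+ 2) = 0.
  by transitivity (w ^+ 3 - 1); [ring | rewrite w3 subrr].
move/eqP; rewrite mulf_eq0 => /orP[|/eqP->] //; rewrite subr_eq0 => /eqP w1.
by have := prim_order_dvd wP 1; rewrite w1 expr1n eqxx.
Qed.

Lemma cyc3_exp3 (T : finType) (a b c : T) : uniq [:: a; b; c] -> (cyc3 a b c ^+ 3 = 1)%g.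
Proof. by move=> u; rewrite expgS expgS expg1 cyc3_sq // -(cyc3V u) mulgV. Qed.

Section CycleSlice.

Variables (T : finType) (S : {set T}) (f : {perm T} -> algC) (a b c : T).
Hypotheses (Nf : charon (altS S) f) (u : uniq [:: a; b; c]).
Hypothesis sS : {subset [:: a; b; c] <= S}.
Let S' := S :\: [set x in [:: a; b; c]].
Let s := cyc3 a b c.

(** The slice at the linear character of the group generated by [s] that sends [s] to z, as a
    character of the even permutations of the remaining points. The second power of [s] is its
    inverse, hence the factor from [z ^+ 2]. *)
Definition cslice (z : algC) (g : {perm T}) : algC :=
  3%:R^-1 * (f g + f (g * s)%g * z^* + f (g * s^-1)%g * (z ^+ 2)^*).

Lemma cslice_char z : z ^+ 3 = 1 -> charon (altS S') (cslice z).
Proof.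
move=> z3; have := charon_pair_slice (A := altS S') (h1 := id) _ (expg_ordM (cyc3_exp3 u)) _ _ _ Nf (charon_root z3).
have Ss : s \in altS S by exact: cyc3_alt.
have dS : [disjoint S' & [set x in [:: a; b; c]]].
  by rewrite disjoint_sym disjoints_subset; apply/subsetP=> x; rewrite !inE => ->.
have Bs : s \in altS [set x in [:: a; b; c]].
  by apply: cyc3_alt => // x; rewrite !inE.
case=> //.
- by move=> g i Sg _; rewrite (altS_commute dS) // groupX.
- by move=> g; apply: (subsetP (altSS (subsetDl _ _))).
- by move=> i _; rewrite groupX.
move=> phi Nphi phiE; exists phi => // g Sg; rewrite -phiE //.
rewrite /dotf cardsT card_ord (eq_bigl predT); last by move=> i; rewrite inE.
rewrite !big_ord_recl big_ord0 /= rmorph1 mulr1 addr0 mulg1 expr1 expg1 addrA.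
rewrite (_ : (s ^+ (bump 0 1)) = s^-1)%g // expgS expg1.
by rewrite /s cyc3_sq // -cyc3V.
Qed.

Lemma cslice1E g : f (g * s^-1)%g = f (g * s)%g ->
  cslice 1 g = 3%:R^-1 * (f g + 2%:R * f (g * s)%g).
Proof. by move=> E; rewrite /cslice E expr1n rmorph1; field. Qed.

Lemma csliceE w g : 1 + w + w ^+ 2 = 0 -> f (g * s^-1)%g = f (g * s)%g ->
  cslice w g = 3%:R^-1 * (f g - f (g * s)%g).
Proof.
move=> w0 E; rewrite /cslice E -addrA -mulrDr -rmorphD.
have -> : w + w ^+ 2 = -1 by apply/eqP; rewrite -subr_eq0 opprK addrC addrA w0.
by rewrite rmorphN rmorph1 mulrN1.
Qed.

End CycleSlice.

Section Kernels.

Variables (T : finType) (S : {set T}) (f : {perm T} -> algC).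
Hypothesis Nf : charon (altS S) f.
Implicit Types a b c d : T.

(** The kernel is normal and contains one 3-cycle, hence all of them, and these generate. When the
    permutation carrying one triple to another is odd, preceding it by [tperm a b] yields the
    inverse of the target, which serves as well. *)
Lemma cyc3_trivial a b c : uniq [:: a; b; c] -> {subset [:: a; b; c] <= S} ->
  f (cyc3 a b c) = f 1%g -> {in altS S, forall g, f g = f 1%g}.
Proof.
move=> u sS fc g Sg; have [K [nK KE _]] := charon_ker Nf.
have sc := cyc3_alt u sS.
have Kc : cyc3 a b c \in K by rewrite KE // fc.
suff /subsetP sK : altS S \subset K by apply/eqP; rewrite -KE // sK.
apply: altS_gen => a' b' c' u' sS'; have [h Sh hE] := perm_to u u' erefl sS sS'.
have KJ x : x \in altS S -> (cyc3 a b c ^ x)%g \in K.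
  by move=> Sx; rewrite memJ_norm // (subsetP (normal_norm nK)).
have [oh|eh] := boolP (odd_perm h); last first.
  by case: hE => <- <- <-; rewrite -cyc3J KJ // altSE Sh.
have [ab ac bc] := uniq3 u.
have : (cyc3 a b c ^ (tperm a b * h))%g \in K.
  apply: KJ; rewrite altSE perm_onM ?perm_on_tperm ?sS ?inE ?eqxx ?orbT //.
  by rewrite odd_permM oh odd_tperm ab.
rewrite conjgM cyc3J tpermL tpermR tpermD // -groupV cyc3J cyc3V.
  by case: hE => -> -> ->; rewrite cyc3_rot.
by rewrite -/(map h [:: b; a; c]) map_inj_uniq /= ?inE; [rewrite negb_or eq_sym ab bc ac | exact: perm_inj].
Qed.

(** With a fifth point e, the product of (a b)(c d) and (a e)(c d) is a 3-cycle, and both factors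
    lie in the kernel. *)
Lemma dtr_trivial a b c d : (5 <= #|S|)%N -> uniq [:: a; b; c; d] ->
  {subset [:: a; b; c; d] <= S} -> f (dtr a b c d) = f 1%g ->
  {in altS S, forall g, f g = f 1%g}.
Proof.
move=> S5 u sS ft; have [K [nK KE fK]] := charon_ker Nf.
have [e Se ne] := @pick_out T S [:: a; b; c; d] S5.
move: (u) ne; rewrite /= !inE !negb_or -!andbA.
case/and5P=> ab ac ad bc /and3P[bd cd _] /and4P[ea eb ec ed].
have u1 : uniq [:: a; e; c; d] by rewrite /= !inE !negb_or (eq_sym a) ea ac ad ec ed cd.
have sS1 : {subset [:: a; e; c; d] <= S}.
  by move=> x; rewrite !inE => /or4P[] /eqP-> //; rewrite sS // !inE eqxx ?orbT.
have u3 : uniq [:: a; b; e] by rewrite /= !inE negb_or ab (eq_sym a) ea (eq_sym b) eb.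
have sS3 : {subset [:: a; b; e] <= S}.
  by move=> x; rewrite !inE => /or3P[] /eqP-> //; rewrite sS // !inE eqxx ?orbT.
apply: (cyc3_trivial u3 sS3).
have -> : cyc3 a b e = (dtr a b c d * dtr a e c d)%g.
  rewrite /dtr (_ : tperm a e * tperm c d = tperm c d * tperm a e)%g.
    by rewrite -mulgA (mulgA (tperm c d)) tperm2 mul1g.
  by rewrite -[RHS](mulKVg (tperm a e)) -conjgE tpermJ !tpermD // eq_sym.
have [S1 S2] := (dtr_alt u sS, dtr_alt u1 sS1).
have Kt : dtr a b c d \in K by rewrite KE // ft.
by rewrite fK // (const_dtr Nf u1 u sS1 sS).
Qed.

End Kernels.

Section DoubleTranspositions.

Variable T : finType.
Implicit Types a b c d : T.

Lemma uniq4_rot a b c d : uniq [:: a; b; c; d] -> uniq [:: b; c; a; d].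
Proof.
have p : perm_eq (seq.rot 1 [:: a; b; c] ++ [:: d]) ([:: a; b; c] ++ [:: d]).
  by rewrite perm_cat2r perm_rot.
by move=> u; rewrite -[uniq _]/(uniq (seq.rot 1 [:: a; b; c] ++ [:: d])) (perm_uniq p).
Qed.

Lemma dtrE a b c d : uniq [:: a; b; c; d] ->
  [/\ dtr a b c d a = b, dtr a b c d b = a, dtr a b c d c = d & dtr a b c d d = c].
Proof.
rewrite /= !inE !negb_or -!andbA => /and5P[ab ac ad bc /and3P[bd cd _]].
have n2 (x y : T) : x != y -> ((x == y) = false) * ((y == x) = false).
  by move=> /negPf E; split; rewrite // eq_sym E.
have q := (n2 _ _ ab, n2 _ _ ac, n2 _ _ ad, n2 _ _ bc, n2 _ _ bd, n2 _ _ cd).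
split; rewrite permM.
- by rewrite tpermL tpermD ?q.
- by rewrite tpermR tpermD ?q.
- by rewrite (tpermD (z := c)) ?q // tpermL.
- by rewrite (tpermD (z := d)) ?q // tpermR.
Qed.

Lemma dtr_out a b c d x : x \notin [:: a; b; c; d] -> dtr a b c d x = x.
Proof.
by rewrite !inE !negb_or => /and4P[xa xb xc xd]; rewrite permM !tpermD // eq_sym.
Qed.

Lemma dtr_mul a b c d : uniq [:: a; b; c; d] ->
  (dtr a b c d * dtr b c a d = dtr c a b d)%g.
Proof.
move=> u; have [a1 a2 a3 a4] := dtrE u; have u' := uniq4_rot u.
have [b1 b2 b3 b4] := dtrE u'; have [c1 c2 c3 c4] := dtrE (uniq4_rot u').
apply/permP=> x; rewrite permM; have [|nx] := boolP (x \in [:: a; b; c; d]); last first.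
  by rewrite !dtr_out //; move: nx; rewrite !inE !negb_or => /and4P[-> -> -> ->].
by rewrite !inE => /or4P[] /eqP->; rewrite ?(a1, a2, a3, a4) ?(b1, b2, b3, b4) ?(c1, c2, c3, c4).
Qed.

Lemma dtr2 a b c d : uniq [:: a; b; c; d] -> (dtr a b c d * dtr a b c d = 1)%g.
Proof.
move=> u; have [a1 a2 a3 a4] := dtrE u.
apply/permP=> x; rewrite permM perm1; have [|nx] := boolP (x \in [:: a; b; c; d]); last first.
  by rewrite !dtr_out.
by rewrite !inE => /or4P[] /eqP->; rewrite ?(a1, a2, a3, a4).
Qed.

Lemma dtr_neq1 a b c d : uniq [:: a; b; c; d] -> dtr a b c d != 1%g.
Proof.
move=> u; have [ab _ _ _] := dtrE u; apply: contraTneq u => E.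
by move: ab; rewrite E perm1 => ->; rewrite /= !inE eqxx.
Qed.

(** The right-hand side is twelve times the multiplicity of the trivial character of the alternating
    group on a, b, c, d. *)
Lemma dtr_cyc a b c d (S : {set T}) f : charon (altS S) f -> uniq [:: a; b; c; d] ->
  {subset [:: a; b; c; d] <= S} ->
  0 <= f 1%g + 3%:R * f (dtr a b c d) + 4%:R * f (cyc3 a b c) + 4%:R * f (cyc3 a b c)^-1%g.
Proof.
move=> Nf u sS; have u3 : uniq [:: a; b; c].
  by have := u : uniq ([:: a; b; c] ++ [:: d]); rewrite cat_uniq => /andP[].
have sS3 : {subset [:: a; b; c] <= S}.
  by move=> x xs; apply: sS; rewrite -[_ :: _]/([:: a; b; c] ++ [:: d]) mem_cat xs.
have nd : d \notin [:: a; b; c].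
  by move: u; rewrite -(rot_uniq 3) => /andP[].
have u' := uniq4_rot u.
suff: 0 <= f 1%g + 3%:R * f (dtr a b c d) + 4%:R * (f (cyc3 a b c) * 1^*) + 4%:R * (f (cyc3 a b c)^-1%g * (1 ^+ 2)^*).
  by rewrite expr1n rmorph1 !mulr1.
apply: (charon_A4_ge0 (k := dtr b c a d) Nf (dtr_alt u sS) (cyc3_alt u3 sS3) (dtr_neq1 u) (dtr2 u)).
- apply: invg_inj; rewrite dtr_mul // [RHS]invMg.
  have dV (x y z t : T) : uniq [:: x; y; z; t] -> ((dtr x y z t)^-1 = dtr x y z t)%g.
    by move=> v; apply: (mulIg (dtr x y z t)); rewrite mulVg dtr2.
  by rewrite !dV ?dtr_mul //; exact: uniq4_rot.
- by rewrite dtrJ cyc3_1 // cyc3_2 // cyc3_3 // cyc3_D.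
- by rewrite dtrJ cyc3_1 // cyc3_2 // cyc3_3 // cyc3_D // dtr_mul.
- exact: cyc3_exp3.
- exact: expr1n.
Qed.

End DoubleTranspositions.

Lemma charon_norm (gT : finGroupType) (G : {group gT}) f x :
  charon G f -> x \in G -> `|f x| <= f 1%g.
Proof. by case=> phi Nphi fE Gx; rewrite !fE // char1_ge_norm. Qed.

Lemma charon_ge1 (gT : finGroupType) (G : {group gT}) f x :
  charon G f -> x \in G -> f 1%g <= f x -> f x = f 1%g.
Proof.
move=> Nf Gx le; have f0 : 0 <= f 1%g by rewrite natr_ge0 // (charon1_nat Nf).
have fx0 := le_trans f0 le; apply/eqP; rewrite eq_le le andbT.
by rewrite -[f x]ger0_norm // (charon_norm Nf).
Qed.

(** * Restriction to two disjoint 3-cycles *)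

Section Sextuple.

Variables (T : finType) (S : {set T}) (f : {perm T} -> algC) (a b c d e k : T).
Hypothesis Nf : charon (altS S) f.
Hypothesis u6 : uniq [:: a; b; c; d; e; k].
Hypothesis sS6 : {subset [:: a; b; c; d; e; k] <= S}.

Let s := cyc3 a b c.
Let s' := cyc3 d e k.
Let S' := S :\: [set x in [:: a; b; c]].

Lemma sext_facts : [/\ uniq [:: a; b; c], uniq [:: d; e; k],
  {subset [:: a; b; c] <= S}, {subset [:: d; e; k] <= S'} & (6 <= #|S|)%N].
Proof.
have := u6 : uniq ([:: a; b; c] ++ [:: d; e; k]); rewrite cat_uniq => /and3P[u1 dis u2].
split=> //.
- by move=> x xs; apply: sS6; rewrite -[_ :: _]/([:: a; b; c] ++ _) mem_cat xs.
- move=> x xs; rewrite inE (@sS6 x) ?andbT; last first.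
    by rewrite -[_ :: _]/([:: a; b; c] ++ _) mem_cat xs orbT.
  by rewrite inE; apply: contra dis => xs'; apply/hasP; exists x.
- by rewrite cardE; apply: (uniq_leq_size u6) => x /sS6; rewrite mem_enum.
Qed.

Lemma sext_inv : [/\ f s^-1%g = f s, f s' = f s, f s'^-1%g = f s,
  f (s' * s)%g = f (s * s')%g & [/\ f (s' * s^-1)%g = f (s * s')%g,
  f (s'^-1 * s)%g = f (s * s')%g & f (s'^-1 * s^-1)%g = f (s * s')%g]].
Proof.
have [u1 u2 s1 s2 S6] := sext_facts.
have s2' : {subset [:: d; e; k] <= S} by move=> x /s2; rewrite inE => /andP[].
have S5 : (5 <= #|S|)%N by exact: leq_trans S6.
have C : commute s s'.
  apply: (altS_commute (A := [set x in [:: a; b; c]]) (B := S')).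
  - by rewrite /S' disjoints_subset; apply/subsetP=> x; rewrite !inE => ->.
  - by apply: cyc3_alt => // x; rewrite !inE.
  - exact: cyc3_alt.
have up : perm_eq [:: a; c; b] [:: a; b; c].
  by rewrite perm_cons; apply/permPl/(perm_catC [:: c] [:: b]).
have up' : perm_eq [:: d; k; e] [:: d; e; k].
  by rewrite perm_cons; apply/permPl/(perm_catC [:: k] [:: e]).
have inv x y z x' y' z' : perm_eq [:: x; y; z] [:: a; b; c] ->
    perm_eq [:: x'; y'; z'] [:: d; e; k] ->
    f (cyc3 x y z * cyc3 x' y' z')%g = f (s * s')%g.
  move=> p p'; have pp : perm_eq ([:: x; y; z] ++ [:: x'; y'; z']) ([:: a; b; c] ++ [:: d; e; k]).
    exact: perm_cat.
  apply: (const_cyc33 Nf) => //.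
    by rewrite -[uniq _]/(uniq ([:: x; y; z] ++ [:: x'; y'; z'])) (perm_uniq pp).
  by move=> t; rewrite -[_ \in _]/(t \in [:: x; y; z] ++ [:: x'; y'; z']) (perm_mem pp) => /sS6.
have S's := altSS (subsetDl S [set x in [:: a; b; c]]).
have Cs' : commute s^-1 s' by apply: commute_sym; apply: commuteV; exact: commute_sym.
have Cs2 : commute s s'^-1 by exact: commuteV.
have Cs3 : commute s^-1 s'^-1 by exact: commuteV.
split; [exact: (const_cyc3V Nf) | exact: (const_cyc3 Nf) | | by rewrite -C | split].
- by rewrite (const_cyc3V Nf) //; exact: (const_cyc3 Nf).
- by rewrite -Cs' /s cyc3V // inv.
- by rewrite -Cs2 /s' cyc3V // inv.
- have -> : (s'^-1 * s^-1 = cyc3 a c b * cyc3 d k e)%g.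
    by rewrite -Cs3 /s /s' (cyc3V u1) (cyc3V u2).
  exact: inv.
Qed.

(** By the symmetries of [sext_inv] the nine linear characters of the group generated by [s] and
    [s'] occur with only three multiplicities: x for the trivial one, y for the four that are
    trivial on exactly one factor, z for the four products of nontrivial characters. The nontrivial
    cube roots of unity sum to -1, which gives the values. *)
Lemma data6 : exists x y z : nat, [/\ f 1%g = (x + 4 * y + 4 * z)%:R,
  f s = (x + y)%:R - 2%:R * z%:R & f (s * s')%g = (x + z)%:R - 2%:R * y%:R].
Proof.
have [u1 u2 s1 s2 S6] := sext_facts; have [e1 e2 e3 e4 [e5 e6 e7]] := sext_inv.
have [w [w3 w0]] := omega_exists.
have i1 : f (1 * s^-1)%g = f (1 * s)%g by rewrite !mul1g.
have i2 : f (s' * s^-1)%g = f (s' * s)%g by rewrite e4 e5.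
have i3 : f (s'^-1 * s^-1)%g = f (s'^-1 * s)%g by rewrite e6 e7.
have N1 := cslice_char Nf u1 s1 (expr1n _ 3); have Nw := cslice_char Nf u1 s1 w3.
have [U0 U1 U2] : [/\ cslice f a b c 1 1%g = 3%:R^-1 * (f 1%g + 2%:R * f s),
    cslice f a b c 1 s' = 3%:R^-1 * (f s + 2%:R * f (s * s')%g) &
    cslice f a b c 1 s'^-1 = 3%:R^-1 * (f s + 2%:R * f (s * s')%g)].
  by split; rewrite cslice1E ?mul1g -/s ?e1 ?e2 ?e3 ?e4 ?e5 ?e6 ?e7.
have [V0 V1 V2] : [/\ cslice f a b c w 1%g = 3%:R^-1 * (f 1%g - f s),
    cslice f a b c w s' = 3%:R^-1 * (f s - f (s * s')%g) &
    cslice f a b c w s'^-1 = 3%:R^-1 * (f s - f (s * s')%g)].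
  by split; rewrite csliceE ?mul1g -/s ?e1 ?e2 ?e3 ?e4 ?e5 ?e6 ?e7.
have := charon1_nat (cslice_char N1 u2 s2 (expr1n _ 3)).
rewrite cslice1E !mul1g -/s' ?U0 ?U1 ?U2 // => /natrP[x Ex].
have := charon1_nat (cslice_char Nw u2 s2 (expr1n _ 3)).
rewrite cslice1E !mul1g -/s' ?V0 ?V1 ?V2 // => /natrP[y Ey].
have := charon1_nat (cslice_char Nw u2 s2 w3).
rewrite csliceE ?mul1g -/s' ?V0 ?V1 ?V2 // => /natrP[z Ez].
by exists x, y, z; split; rewrite !natrD ?natrM -Ex -Ey -Ez; field.
Qed.

(** The two expressions are 9z and 9y in the notation of [data6]. If y = 0, a product t of two
    transpositions on d, e, k and a seventh point l acts trivially on every slice along [s]; then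
    f(t) = f(1), so f is trivial and z = 0. *)
Lemma y_pos : (7 <= #|S|)%N -> f 1%g - 2%:R * f s + f (s * s')%g != 0 ->
  f 1%g + f s - 2%:R * f (s * s')%g != 0.
Proof.
move=> S7 z0; apply: contraNneq z0 => y0.
have [u1 u2 s1 s2 S6] := sext_facts; have [e1 e2 e3 e4 [e5 e6 e7]] := sext_inv.
have [w [w3 w0]] := omega_exists.
have N1 := cslice_char Nf u1 s1 (expr1n _ 3); have Nw := cslice_char Nf u1 s1 w3.
have [l Sl nl] := @pick_out T S [:: a; b; c; d; e; k] S7.
have nl1 : l \notin [:: a; b; c] by apply: contra nl; rewrite !inE => /or3P[] ->; rewrite ?orbT.
have nl2 : l \notin [:: d; e; k] by apply: contra nl; rewrite !inE => /or3P[] ->; rewrite ?orbT.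
have ut : uniq [:: d; e; k; l].
  by rewrite -(rot_uniq 3) -[uniq _]/((l \notin [:: d; e; k]) && uniq [:: d; e; k]) nl2.
have st : {subset [:: d; e; k; l] <= S'}.
  move=> x; rewrite -[_ :: _]/([:: d; e; k] ++ [:: l]) mem_cat => /orP[/s2 //|].
  by rewrite mem_seq1 => /eqP->; rewrite !inE Sl andbT; move: nl1; rewrite !inE.
set t := dtr d e k l.
have St : t \in altS S' by exact: dtr_alt.
have sub := subsetP (altSS (subsetDl S [set x in [:: a; b; c]])).
have S's : s' \in altS S' by exact: cyc3_alt.
(* Conjugation by (a b)(d e) fixes [t] and inverts [s]. *)
have it : f (t * s^-1)%g = f (t * s)%g.
  have uh : uniq [:: a; b; d; e] := mask_uniq u6 [:: true; true; false; true; true; false].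
  have sh : {subset [:: a; b; d; e] <= S}.
    by move=> x; rewrite !inE => /or4P[] /eqP->; rewrite sS6 // !inE eqxx ?orbT.
  have Sh := dtr_alt uh sh; have [ha hb hd he] := dtrE uh.
  rewrite -[LHS](charonJ Nf _ Sh); last by rewrite groupM ?groupV ?cyc3_alt //; exact: sub.
  have n2 (x y : T) : x != y -> ((x == y) = false) * ((y == x) = false).
    by move=> /negPf E; split; rewrite // eq_sym E.
  move: nl u6; rewrite /= !inE !negb_or -!andbA => /and5P[la lb lc ld /andP[le lk]].
  case/and5P=> ab ac ad ae /and5P[ak bc bd be] /and5P[bk cd ce ck] /and4P[de dk ek _].
  have q := (n2 _ _ ab, n2 _ _ ac, n2 _ _ ad, n2 _ _ ae, n2 _ _ ak, n2 _ _ bc, n2 _ _ bd,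
    n2 _ _ be, n2 _ _ bk, n2 _ _ cd, n2 _ _ ce, n2 _ _ ck, n2 _ _ de, n2 _ _ dk, n2 _ _ ek).
  have q' := (n2 _ _ la, n2 _ _ lb, n2 _ _ lc, n2 _ _ ld, n2 _ _ le, n2 _ _ lk).
  congr f; rewrite conjMg; congr (_ * _)%g.
    by rewrite dtrJ hd he !dtr_out ?inE ?q ?q' // /t /dtr (tpermC e).
  by rewrite cyc3V // cyc3J ha hb dtr_out ?inE ?q // cyc3_rot.
have i1 : f (1 * s^-1)%g = f (1 * s)%g by rewrite !mul1g.
have i2 : f (s' * s^-1)%g = f (s' * s)%g by rewrite e4 e5.
have i3 : f (s'^-1 * s^-1)%g = f (s'^-1 * s)%g by rewrite e6 e7.
have := cyc3_trivial N1 u2 s2 _ St.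
rewrite !cslice1E // -/s' mul1g e2 e4 -/s => /(_ _)/(mulfI _) H1.
have E0 : f t + 2%:R * f (t * s)%g = f 1%g + 2%:R * f s.
  apply: H1; first by rewrite invr_eq0 pnatr_eq0.
  congr (_ * _); apply/eqP; rewrite -subr_eq0; apply/eqP.
  by rewrite -[RHS]oppr0 -y0; ring.
(* On the nontrivial slice y = 0 leaves [s'] without fixed vectors, so its value there is minus half
   the degree. The inequality for Alt(4) then pushes the value at [t] up to the degree. *)
have := dtr_cyc Nw ut st; rewrite !csliceE // mul1g -/s' -/t e2 e3 e4 e6 => le.
have := charon_ge1 Nw St; rewrite !csliceE // mul1g.
have -> : (3%:R^-1 * (f 1%g - f s) <= 3%:R^-1 * (f t - f (t * s)%g)) = true.
  rewrite -subr_ge0; rewrite -(pmulr_rge0 _ (ltr0n algC 3)).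
  suff -> : 3%:R * (3%:R^-1 * (f t - f (t * s)%g) - 3%:R^-1 * (f 1%g - f s)) =
    3%:R^-1 * (f 1%g - f s) + 3%:R * (3%:R^-1 * (f t - f (t * s)%g)) +
    4%:R * (3%:R^-1 * (f s - f (s * s')%g)) + 4%:R * (3%:R^-1 * (f s - f (s * s')%g)) +
    4%:R / 3%:R * (- (f 1%g + f s - 2%:R * f (s * s')%g)).
    by rewrite y0 oppr0 mulr0 addr0.
  by field.
move/(_ isT)/(mulfI _); rewrite invr_eq0 pnatr_eq0 => /(_ isT) E1.
have sS : {subset [:: d; e; k; l] <= S} by move=> x /st; rewrite inE => /andP[].
have S5 : (5 <= #|S|)%N by exact: leq_trans S7.
have ft : f t = f 1%g.
  have -> : f t = 3%:R^-1 * (f t + 2%:R * f (t * s)%g + 2%:R * (f t - f (t * s)%g)) by field.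
  by rewrite E0 E1; field.
have triv := dtr_trivial Nf S5 ut sS ft.
have Ss : s \in altS S by exact: cyc3_alt.
have Ss' : s' \in altS S by exact: sub.
by have Sss := groupM Ss Ss'; rewrite (triv s Ss) (triv _ Sss) addrAC mulr_natl -mulr2n subrr.
Qed.

(** Since z > 0 the degree is at least 4, and equality means x = y = 0 and z = 1. Then f(s) = -2,
    and the inequality for Alt(4) forces a product of two transpositions into the kernel. *)
Lemma star_deg5 : f 1%g - 2%:R * f s + f (s * s')%g != 0 -> 5%:R <= f 1%g.
Proof.
move=> z0; have [u1 u2 s1 s2 S6] := sext_facts.
have [x [y [z [E1 E2 E3]]]] := data6.
have z1 : z != 0%N.
  by apply: contraNneq z0 => zE; rewrite E1 E2 E3 zE !natrD !natrM; apply/eqP; ring.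
rewrite E1 ler_nat; have [//|lt] := leqP 5 (x + 4 * y + 4 * z).
have [x0 y0 z1'] : [/\ x = 0, y = 0 & z = 1]%N by split; lia.
have ut : uniq [:: a; b; c; d] := mask_uniq u6 [:: true; true; true; true].
have st : {subset [:: a; b; c; d] <= S}.
  by move=> t; rewrite !inE => /or4P[] /eqP->; rewrite sS6 // !inE eqxx ?orbT.
have := dtr_cyc Nf ut st; have [-> _ _ _ _] := sext_inv; rewrite E2 -/s.
have St := dtr_alt ut st; have := charon_ge1 Nf St.
set t := dtr a b c d; rewrite E1 x0 y0 z1' => H le.
have /H E : (0 + 4 * 0 + 4 * 1)%:R <= f t.
  rewrite -subr_ge0 -(pmulr_rge0 _ (ltr0n algC 3)); apply: le_trans le _.
  by rewrite le_eqVlt; apply/orP; left; apply/eqP; ring.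
have S5 : (5 <= #|S|)%N by exact: leq_trans S6.
have triv := dtr_trivial Nf S5 ut st ltac:(by rewrite E1 x0 y0 z1' -E).
case/eqP: z0.
have Ss : s \in altS S by exact: cyc3_alt.
have Ss' : s' \in altS S.
  by apply: (subsetP (altSS (subsetDl S [set x in [:: a; b; c]]))); exact: cyc3_alt.
by have Sss := groupM Ss Ss'; rewrite (triv s Ss) (triv _ Sss) addrAC mulr_natl -mulr2n subrr.
Qed.

(** Both y and z are positive, so the degree is at least 4y + 4z. *)
Lemma star_deg8 : (7 <= #|S|)%N -> f 1%g - 2%:R * f s + f (s * s')%g != 0 -> 8%:R <= f 1%g.
Proof.
move=> S7 z0; have y0 := y_pos S7 z0; have [x [y [z [E1 E2 E3]]]] := data6.
have z1 : z != 0%N.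
  by apply: contraNneq z0 => zE; rewrite E1 E2 E3 zE !natrD !natrM; apply/eqP; ring.
have y1 : y != 0%N.
  by apply: contraNneq y0 => yE; rewrite E1 E2 E3 yE !natrD !natrM; apply/eqP; ring.
by rewrite E1 ler_nat; lia.
Qed.

End Sextuple.

(** * Characters without product constituents: a vector fixed by a point stabiliser *)

Lemma idem_trace n (e : 'M[algC]_n) : e *m e = e -> \tr e = (\rank e)%:R.
Proof.
move=> ee; have [B [C [CB BC]]] : exists B : 'M_(\rank e, n), exists C : 'M_(n, \rank e),
    C *m B = e /\ B *m C = 1%:M.
  exists (row_base e), (col_base e); split; first exact: mulmx_base.
  have /row_freeP[B' BB'] : row_free (row_base e) := row_base_free e.
  have /row_fullP[C' CC'] : row_full (col_base e) := col_base_full e.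
  have := mulmx_base e; move: (row_base e) (col_base e) BB' CC' => B C BB' CC' CB.
  rewrite -[B *m C]mul1mx -CC' -[LHS]mulmx1 -BB'.
  have -> : C' *m C *m (B *m C) *m (B *m B') = C' *m (C *m B *m (C *m B)) *m B'.
    by rewrite !mulmxA.
  have -> : C *m B *m (C *m B) = C *m B by rewrite [C *m B]CB.
  by rewrite -!mulmxA BB' mulmx1.
by rewrite -{1}CB mxtrace_mulC BC mxtrace1.
Qed.

Lemma idem_trace0 n (e : 'M[algC]_n) : e *m e = e -> \tr e = 0 -> e = 0.
Proof. by move/idem_trace=> -> /eqP; rewrite pnatr_eq0 mxrank_eq0 => /eqP. Qed.

(** The multiplicity is the trace of the projection onto the vectors fixed by [H]. An idempotent of
    trace zero vanishes, but this one fixes v. *)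
Lemma fixed_vec_dot (gT : finGroupType) (G H : {group gT}) n
    (rG : mx_representation algC G n) (v : 'rV_n) :
  H \subset G -> v != 0 -> {in H, forall h, v *m rG h = v} ->
  dotf H (fun x => \tr (rG x)) (fun=> 1) != 0.
Proof.
move=> sHG v0 vH; pose e : 'M_n := #|H|%:R^-1 *: \sum_(h in H) rG h.
have H0 : #|H|%:R != 0 :> algC by rewrite pnatr_eq0 -lt0n cardG_gt0.
have eH h : h \in H -> rG h *m e = e.
  move=> Hh; rewrite -scalemxAr mulmx_sumr; congr (_ *: _).
  rewrite [RHS](reindex_inj (mulgI h)) /=; apply: eq_big => [r|r Hr].
    by rewrite groupMl.
  by rewrite repr_mxM // (subsetP sHG).
have ee : e *m e = e.
  rewrite {1}/e -scalemxAl mulmx_suml (eq_bigr (fun=> e)) //.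
  by rewrite sumr_const -scaler_nat scalerA mulVf // scale1r.
have ve : v *m e = v.
  rewrite -scalemxAr mulmx_sumr (eq_bigr (fun=> v)) //.
  by rewrite sumr_const -scaler_nat scalerA mulVf // scale1r.
have -> : dotf H (fun x => \tr (rG x)) (fun=> 1) = \tr e.
  rewrite mxtraceZ raddf_sum /dotf; congr (_ * _).
  by apply: eq_bigr => h _; rewrite rmorph1 mulr1.
apply: contraNneq v0 => /(idem_trace0 ee) e0.
by rewrite -ve e0 mulmx0.
Qed.

Section FixedVector.

Variables (T : finType) (S : {set T}) (n : nat).
Variable rG : mx_representation algC (altS S) n.
Variables (a b c d e k : T).
Let f (g : {perm T}) := \tr (rG g).
Hypothesis u6 : uniq [:: a; b; c; d; e; k].
Hypothesis sS6 : {subset [:: a; b; c; d; e; k] <= S}.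
Hypothesis z0 : f 1%g - 2%:R * f (cyc3 a b c) + f (cyc3 a b c * cyc3 d e k)%g = 0.
Hypothesis ntf : f (cyc3 a b c) != f 1%g.

Let Nf : charon (altS S) f.
Proof. exact: charon_rep. Qed.

(** Let Q and Q' project onto the nontrivial parts of the two 3-cycles. They commute, and the trace
    of their product is 4/9 of the expression in [z0], so the product is a zero idempotent. Each
    factor 1 - g absorbs its projection. *)
Lemma kill3 a1 b1 c1 d1 e1 k1 : uniq [:: a1; b1; c1; d1; e1; k1] ->
  {subset [:: a1; b1; c1; d1; e1; k1] <= S} ->
  (1%:M - rG (cyc3 a1 b1 c1)) *m (1%:M - rG (cyc3 d1 e1 k1)) = 0.
Proof.
move=> u1 sS1; set s := cyc3 a1 b1 c1; set s' := cyc3 d1 e1 k1.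
have [v1 v2 s1 s2 S6] := sext_facts u1 sS1.
have [e1' e2 e3 e4 [e5 e6 e7]] := sext_inv Nf u1 sS1.
have s2' : {subset [:: d1; e1; k1] <= S} by move=> x /s2; rewrite inE => /andP[].
have Ss : s \in altS S by exact: cyc3_alt.
have Ss' : s' \in altS S by exact: cyc3_alt.
have S5 : (5 <= #|S|)%N by exact: leq_trans S6.
have C : (s * s' = s' * s)%g.
  apply: (altS_commute (A := [set x in [:: a1; b1; c1]]) (B := S :\: [set x in [:: a1; b1; c1]])).
  - by rewrite disjoints_subset; apply/subsetP=> x; rewrite !inE => ->.
  - by apply: cyc3_alt => // x; rewrite !inE.
  - exact: cyc3_alt.
pose P g : 'M_n := 3%:R^-1 *: (1%:M + rG g + rG g^-1%g).
have n3 : 3%:R != 0 :> algC by rewrite pnatr_eq0.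
have rP g : g \in altS S -> (g ^+ 3 = 1)%g -> P g *m P g = P g /\ rG g *m P g = P g.
  move=> Sg g3; have gg : (g * g = g^-1)%g by apply: (mulIg g); rewrite mulVg -g3 !expgS mulg1 mulgA.
  have SgV : (g^-1)%g \in altS S by rewrite groupV.
  have gP : rG g *m P g = P g.
    rewrite -scalemxAr !mulmxDr mulmx1 -!repr_mxM // gg mulgV repr_mx1.
    by congr (_ *: _); rewrite addrC addrA.
  split=> //; have gVP : rG g^-1%g *m P g = P g by rewrite -gg repr_mxM // -mulmxA !gP.
  rewrite {1}/P -scalemxAl !mulmxDl mul1mx gP gVP.
  by rewrite -mulr2n -mulrSr -scaler_nat scalerA mulVf // scale1r.
have [PP sP] := rP s Ss (cyc3_exp3 v1); have [PP' sP'] := rP s' Ss' (cyc3_exp3 v2).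
have cm g h : g \in altS S -> h \in altS S -> (h * g = g * h)%g -> P g *m rG h = rG h *m P g.
  move=> Sg Sh E; have E' : (h * g^-1 = g^-1 * h)%g := commuteV E.
  rewrite -scalemxAl -scalemxAr !mulmxDl !mulmxDr mul1mx mulmx1 -!repr_mxM ?groupV //.
  by rewrite E E'.
have CC : P s *m P s' = P s' *m P s.
  rewrite {2 3}/P -scalemxAl -scalemxAr !mulmxDl !mulmxDr mul1mx mulmx1.
  by rewrite !cm ?groupV //; apply: esym; apply: commuteV.
have f1E : f 1%g = \tr (1%:M : 'M_n) by rewrite /f repr_mx1.
have trP g : f g^-1%g = f g -> \tr (P g) = 3%:R^-1 * (f 1%g + 2%:R * f g).
  move=> E; rewrite mxtraceZ !mxtraceD -f1E -[\tr (rG g)]/(f g) -[\tr (rG g^-1%g)]/(f g^-1%g) E.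
  by rewrite mulr_natl mulr2n addrA.
have trPP : \tr (P s' *m P s) = 9%:R^-1 * (f 1%g + 4%:R * f s + 4%:R * f (s * s')%g).
  rewrite -scalemxAl -scalemxAr !mulmxDl !mulmxDr !mul1mx !mulmx1 -!repr_mxM ?groupV //.
  rewrite !mxtraceZ !mxtraceD -f1E -?[\tr (rG _)]/(f _).
  move: e1' e2 e3 e4 e5 e6 e7; rewrite /f -/s -/s' => -> -> -> -> -> -> ->.
  by field.
have z1 : f 1%g - 2%:R * f s + f (s * s')%g = 0.
  have [w1 _ t1 _ _] := sext_facts u6 sS6.
  by rewrite -[RHS]z0 (const_cyc33 Nf u1 u6 sS1 sS6) (const_cyc3 Nf S5 v1 w1 s1 t1).
pose Q := 1%:M - P s; pose Q' := 1%:M - P s'.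
have oneB (A : 'M_n) : A *m A = A -> (1%:M - A) *m (1%:M - A) = 1%:M - A.
  by move=> AA; rewrite mulmxBr mulmx1 mulmxBl mul1mx AA subrr subr0.
have [QQ QQ'] : Q *m Q = Q /\ Q' *m Q' = Q' by split; exact: oneB.
have Qc : Q *m Q' = Q' *m Q.
  rewrite !mulmxBl !mulmxBr !mul1mx !mulmx1 CC !opprB addrACA [RHS]addrACA.
  by congr (_ + _); exact: addrC.
have : Q *m Q' = 0.
  apply: idem_trace0.
    by rewrite -mulmxA (mulmxA Q') -Qc -mulmxA QQ' mulmxA QQ.
  have QE : Q' *m Q = 1%:M - P s' - (P s - P s' *m P s).
    by rewrite mulmxBr mulmx1 mulmxBl mul1mx.
  rewrite Qc QE !raddfB /= -f1E trPP !trP //.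
    by rewrite e2 -[RHS](mulr0 (4%:R / 9%:R)) -z1; field.
  by rewrite e3 e2.
have sQ : 1%:M - rG s = (1%:M - rG s) *m Q.
  by rewrite mulmxBr mulmx1 mulmxBl mul1mx sP subrr subr0.
have sQ' : 1%:M - rG s' = Q' *m (1%:M - rG s').
  by rewrite mulmxBl mul1mx mulmxBr mulmx1 cm // sP' subrr subr0.
by move=> E; rewrite sQ sQ' -mulmxA (mulmxA Q) E mul0mx mulmx0.
Qed.

Lemma fix_cyc3 (v : 'rV_n) a1 b1 c1 d1 e1 k1 : uniq [:: a1; b1; c1; d1; e1; k1] ->
  {subset [:: a1; b1; c1; d1; e1; k1] <= S} ->
  (v - v *m rG (cyc3 a1 b1 c1)) *m rG (cyc3 d1 e1 k1) = v - v *m rG (cyc3 a1 b1 c1).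
Proof.
move=> u1 sS1; apply/eqP; rewrite eq_sym -subr_eq0; apply/eqP.
have := kill3 u1 sS1 => /(congr1 (mulmx v)); rewrite mulmx0 mulmxA mulmxBr mulmx1 => <-.
by rewrite mulmxBr mulmx1.
Qed.

(* A vector w with w(12)(34) = -w and w(13)(24) = w gives f = w(1 - (132)) = w(1 - (124)),
   fixed by every even permutation fixing 1 and 2, and changed in sign by (12)(34). *)
Lemma pair_vector : exists v : 'rV_n, [/\ v != 0,
  {in altS (S :\: [set a; b]), forall g, v *m rG g = v},
  v *m rG (dtr a b c d) = - v &
  v + v *m rG (cyc3 a b c) + v *m rG (cyc3 a b c)^-1%g = 0].
Proof.
have [u1 u2 s1 s2 S6] := sext_facts u6 sS6; have S5 : (5 <= #|S|)%N by exact: leq_trans S6.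
have u4 : uniq [:: a; b; c; d] := mask_uniq u6 [:: true; true; true; true].
have s4 : {subset [:: a; b; c; d] <= S}.
  by move=> t; rewrite !inE => /or4P[] /eqP->; rewrite sS6 // !inE eqxx ?orbT.
have u4' := uniq4_rot u4; have u4'' := uniq4_rot u4'.
pose s := cyc3 a b c; pose t1 := dtr a b c d; pose t2 := dtr b c a d; pose t3 := dtr c a b d.
have Ss : s \in altS S by exact: cyc3_alt.
have St1 : t1 \in altS S by exact: dtr_alt.
have s4' : {subset [:: b; c; a; d] <= S}.
  by move=> t; rewrite !inE => /or4P[] /eqP->; rewrite sS6 // !inE eqxx ?orbT.
have s4'' : {subset [:: c; a; b; d] <= S}.
  by move=> t; rewrite !inE => /or4P[] /eqP->; rewrite sS6 // !inE eqxx ?orbT.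
have St2 : t2 \in altS S by exact: dtr_alt.
have St3 : t3 \in altS S by exact: dtr_alt.
have t12 : (t1 * t2 = t3)%g by exact: dtr_mul.
have t23 : (t2 * t3 = t1)%g by exact: dtr_mul.
have t31 : (t3 * t1 = t2)%g by exact: dtr_mul (uniq4_rot u4').
have tt1 : (t1 * t1 = 1)%g by exact: dtr2.
have tt3 : (t3 * t3 = 1)%g by exact: dtr2.
have t13 : (t1 * t3 = t2)%g by rewrite -t12 mulgA tt1 mul1g.
have nd : d \notin [:: a; b; c] by move: u4; rewrite -(rot_uniq 3) => /andP[].
have st1 : (t1 ^ s = t2)%g by rewrite dtrJ cyc3_1 // cyc3_2 // cyc3_3 // cyc3_D.
have st2 : (t2 ^ s = t3)%g by rewrite dtrJ cyc3_1 // cyc3_2 // cyc3_3 // cyc3_D.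
pose M : 'M_n := (1%:M - rG t1) *m (1%:M + rG t3).
(* The three double transpositions are conjugate, so the trace of [M] is f(1) - f(t1), which
   vanishes only for trivial f. *)
have M0 : M != 0.
  apply: contraNneq ntf => M0; have : \tr M = 0 by rewrite M0 mxtrace0.
  have f1E : f 1%g = \tr (1%:M : 'M_n) by rewrite /f repr_mx1.
  have F2 : f t2 = f t1 by rewrite -st1 (charonJ Nf).
  have F3 : f t3 = f t1 by rewrite -st2 (charonJ Nf).
  rewrite /M mulmxBl mul1mx mulmxDr mulmx1 -repr_mxM // t13 raddfB /= !raddfD /=.
  rewrite -f1E -[\tr (rG t1)]/(f t1) -[\tr (rG t2)]/(f t2) -[\tr (rG t3)]/(f t3) F2 F3.
  rewrite addrA addrK => /eqP; rewrite subr_eq0 => /eqP E.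
  have triv := dtr_trivial Nf S5 u4 s4 (esym E).
  by apply/eqP; apply: triv.
have [i wi] : exists i, row i M != 0.
  apply/existsP; rewrite -negb_forall; apply: contra M0 => /forallP z.
  by apply/eqP/row_matrixP => i; rewrite row0; apply/eqP.
pose w := row i M; have w1 : w *m rG t1 = - w.
  have C : (1%:M + rG t3) *m rG t1 = rG t1 *m (1%:M + rG t3).
    by rewrite mulmxDl mulmxDr mul1mx mulmx1 -!repr_mxM // t31 t13.
  rewrite -row_mul -mulmxA C mulmxA mulmxBl mul1mx -repr_mxM // tt1 repr_mx1.
  by rewrite -opprB mulNmx raddfN.
have w3 : w *m rG t3 = w.
  have C : (1%:M + rG t3) *m rG t3 = 1%:M + rG t3.
    by rewrite mulmxDl mul1mx -repr_mxM // tt3 repr_mx1 addrC.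
  by rewrite -row_mul -mulmxA C.
have w2 : w *m rG t2 = - w by rewrite -t31 repr_mxM // mulmxA w3.
pose v := w - w *m rG s^-1%g; exists v.
have SsV : (s^-1)%g \in altS S by rewrite groupV.
have v0 : v != 0.
  apply: contraNneq wi => /eqP; rewrite subr_eq0 => /eqP ws.
  have ws' : w *m rG s = w by rewrite {1}ws -mulmxA -repr_mxM // mulVg repr_mx1 mulmx1.
  have : w *m rG t3 = - w.
    have St2s : (t2 * s)%g \in altS S by rewrite (groupM St2 Ss).
    have -> : t3 = (s^-1 * (t2 * s))%g by rewrite -st2.
    by rewrite repr_mxM // repr_mxM // mulmxA -ws mulmxA w2 mulNmx ws'.
  rewrite w3 => /eqP; rewrite -subr_eq0 opprK -mulr2n -scaler_nat scaler_eq0 pnatr_eq0 /=.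
  by rewrite -/w.
have ud : uniq [:: a; b; d].
  exact: (mask_uniq u4 [:: true; true; false; true]).
have nc : c \notin [:: a; b; d].
  by move: u4 => /=; rewrite !inE !negb_or -!andbA => /and5P[_ ac _ bc /and3P[_ cd _]]; rewrite cd (eq_sym c) ac (eq_sym c) bc.
pose s' := cyc3 a b d.
have Ss' : s' \in altS S.
  by apply: cyc3_alt => // x; rewrite !inE => /or3P[] /eqP->; rewrite sS6 // !inE eqxx ?orbT.
have ss : (s' * s = t3)%g.
  have [q1 q2 q3 q4] := dtrE u4''; apply/permP=> x; rewrite permM.
  have [|nx] := boolP (x \in [:: c; a; b; d]).
    rewrite !inE => /or4P[] /eqP->; rewrite ?(q1, q2, q3, q4).
    - by rewrite (cyc3_D nc) cyc3_3.
    - by rewrite cyc3_1 // cyc3_2.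
    - by rewrite cyc3_2 // cyc3_D.
    - by rewrite cyc3_3 // cyc3_1.
  move: nx; rewrite !inE !negb_or => /and4P[xc xa xb xd].
  have n1 : x \notin [:: a; b; d] by rewrite !inE !negb_or xa xb xd.
  have n2 : x \notin [:: a; b; c] by rewrite !inE !negb_or xa xb xc.
  by rewrite (cyc3_D n1) (cyc3_D n2) dtr_out // !inE !negb_or xc xa xb xd.
(* Since [w] is fixed by t3 = s' s, the vectors w s^-1 and w s' agree. Hence [v] is fixed by the
   3-cycles avoiding a, b, c and also by those avoiding a, b, d. *)
have vE : v = w - w *m rG s'.
  rewrite /v; congr (_ - _); rewrite -{1}w3 -ss repr_mxM // -!mulmxA -repr_mxM //.
  by rewrite mulgV repr_mx1 mulmx1.
have vb : v *m rG t1 = - v.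
  rewrite {1}/v mulmxBl w1 -mulmxA -repr_mxM // (_ : s^-1 * t1 = t1 * s')%g.
    by rewrite repr_mxM // mulmxA w1 mulNmx opprK vE opprB addrC.
  have [q1 q2 q3 q4] := dtrE u4.
  by rewrite conjgC (cyc3V u1) cyc3J -/t1 q1 q2 q3 cyc3_rot.
have vs : v + v *m rG s + v *m rG s^-1%g = 0.
  have sV : (s^-1 * s^-1 = s)%g by rewrite -invMg (cyc3_sq u1) -(cyc3V u1) invgK.
  rewrite {1 2 3}/v !mulmxBl -!mulmxA -!repr_mxM // mulVg repr_mx1 mulmx1 sV.
  by rewrite [w - _ + _]addrC !subrKA subrr.
split=> //.
have sH : altS (S :\: [set a; b]) \subset rstab_group rG v.
  have Hfix x : x \in altS S -> v *m rG x = v -> x \in rstab_group rG v.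
    by move=> Sx vx; rewrite inE Sx vx eqxx.
  have HV x y z : uniq [:: x; y; z] -> (cyc3 x z y \in rstab_group rG v) = (cyc3 x y z \in rstab_group rG v).
    by move=> u; rewrite -cyc3V // groupV.
  have Hrot x y z : uniq [:: x; y; z] -> (cyc3 y z x \in rstab_group rG v) = (cyc3 x y z \in rstab_group rG v).
    by move=> u; rewrite cyc3_rot.
  have nab x : x \in S :\: [set a; b] -> [/\ x != a, x != b & x \in S].
    by rewrite !inE negb_or -andbA => /and3P.
  have sub3 (x y z : T) : {subset [:: x; y; z] <= S :\: [set a; b]} ->
      [/\ x \in S :\: [set a; b], y \in S :\: [set a; b] & z \in S :\: [set a; b]].
    by move=> h; rewrite !h ?inE ?eqxx ?orbT.
  have Hc x y z : uniq [:: x; y; z] -> {subset [:: x; y; z] <= S :\: [set a; b]} ->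
      c \notin [:: x; y; z] -> cyc3 x y z \in rstab_group rG v.
    move=> u h nc'; have [hx hy hz] := sub3 _ _ _ h.
    have [[[xa xb Sx] [ya yb Sy]] [za zb Sz]] := (nab x hx, nab y hy, nab z hz).
    have u6' : uniq [:: a; c; b; x; y; z].
      have [ab ac bc] := uniq3 u1; have [xy xz yz] := uniq3 u.
      move: nc'; rewrite /= !inE !negb_or => /and3P[cx cy cz].
      by rewrite ac ab (eq_sym c b) bc cx cy cz !(eq_sym a) xa ya za !(eq_sym b) xb yb zb xy xz yz.
    have s6' : {subset [:: a; c; b; x; y; z] <= S}.
      move=> t; rewrite -[_ :: _]/([:: a; c; b] ++ [:: x; y; z]) mem_cat => /orP[|/h].
        by rewrite !inE => /or3P[] /eqP->; rewrite sS6 // !inE eqxx ?orbT.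
      by rewrite inE => /andP[].
    apply: Hfix; first by apply: cyc3_alt => // t /h; rewrite inE => /andP[].
    by have := fix_cyc3 w u6' s6'; rewrite -cyc3V.
  have Hd x y z : uniq [:: x; y; z] -> {subset [:: x; y; z] <= S :\: [set a; b]} ->
      d \notin [:: x; y; z] -> cyc3 x y z \in rstab_group rG v.
    move=> u h nd'; have [hx hy hz] := sub3 _ _ _ h.
    have [[[xa xb Sx] [ya yb Sy]] [za zb Sz]] := (nab x hx, nab y hy, nab z hz).
    have u6' : uniq [:: a; b; d; x; y; z].
      have [ab ad bd] := uniq3 ud; have [xy xz yz] := uniq3 u.
      move: nd'; rewrite /= !inE !negb_or => /and3P[dx dy dz].
      by rewrite ad ab bd dx dy dz !(eq_sym a) xa ya za !(eq_sym b) xb yb zb xy xz yz.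
    have s6' : {subset [:: a; b; d; x; y; z] <= S}.
      move=> t; rewrite -[_ :: _]/([:: a; b; d] ++ [:: x; y; z]) mem_cat => /orP[|/h].
        by rewrite !inE => /or3P[] /eqP->; rewrite sS6 // !inE eqxx ?orbT.
      by rewrite inE => /andP[].
    apply: Hfix; first by apply: cyc3_alt => // t /h; rewrite inE => /andP[].
    by have := fix_cyc3 w u6' s6'; rewrite -vE.
  have [ab ac bc] := uniq3 u1.
  have [cS dS] : c \in S :\: [set a; b] /\ d \in S :\: [set a; b].
    move: nd; rewrite !inE !negb_or => /and3P[da db dc].
    by rewrite da db !(eq_sym c) ac bc !sS6 // !inE eqxx ?orbT.
  (* A 3-cycle through both c and d is not covered by these two cases. It is the conjugate of (c y
     z) by (y d z), where z is a sixth point. *)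
  have Hcd y : uniq [:: c; d; y] -> y \in S :\: [set a; b] -> cyc3 c d y \in rstab_group rG v.
    move=> u yS; have [z Sz nz] := @pick_out T S [:: a; b; c; d; y] S6.
    have /and5P[za zb zc zd zy] : [&& z != a, z != b, z != c, z != d & z != y].
      by move: nz; rewrite !inE !negb_or.
    have [cd cy dy] := uniq3 u.
    have zS : z \in S :\: [set a; b] by rewrite !inE negb_or za zb.
    have v1 : uniq [:: c; y; z] by rewrite /= !inE negb_or cy !(eq_sym _ z) zc zy.
    have v2 : uniq [:: y; d; z] by rewrite /= !inE negb_or (eq_sym y) dy !(eq_sym _ z) zd zy.
    have H1 : cyc3 c y z \in rstab_group rG v.
      apply: Hd => //; first by move=> t; rewrite !inE => /or3P[] /eqP->; move: cS yS zS; rewrite !inE.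
      by rewrite !inE !negb_or (eq_sym d) cd dy eq_sym zd.
    have H2 : cyc3 y d z \in rstab_group rG v.
      apply: Hc => //; first by move=> t; rewrite !inE => /or3P[] /eqP->; move: dS yS zS; rewrite !inE.
      by rewrite !inE !negb_or cy cd eq_sym zc.
    have nc2 : c \notin [:: y; d; z] by rewrite !inE !negb_or cy cd eq_sym zc.
    by have := groupJ H1 H2; rewrite cyc3J (cyc3_D nc2) (cyc3_1 v2) (cyc3_3 v2).
  apply: altS_gen => x y z u h; have [hx hy hz] := sub3 _ _ _ h.
  have [cxyz|/(Hc _ _ _ u h)//] := boolP (c \in [:: x; y; z]).
  have [dxyz|/(Hd _ _ _ u h)//] := boolP (d \in [:: x; y; z]).
  have ur : uniq [:: y; z; x] by rewrite -(rot_uniq 2).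
  have ur' : uniq [:: z; x; y] by rewrite -(rot_uniq 1).
  have uV : uniq [:: x; z; y] by rewrite -(rot_uniq 1) -rev_uniq.
  have urV : uniq [:: y; x; z] by rewrite -(rot_uniq 1) -rev_uniq.
  have urV' : uniq [:: z; y; x] by rewrite -(rot_uniq 1) -rev_uniq.
  have cd : c != d by move: nd; rewrite !inE !negb_or (eq_sym d c) => /and3P[].
  have c3 : [|| c == x, c == y | c == z] by move: cxyz; rewrite !inE.
  have d3 : [|| d == x, d == y | d == z] by move: dxyz; rewrite !inE.
  move: u ur ur' uV urV urV' hx hy hz {h cxyz dxyz}.
  case/or3P: c3 => /eqP Ec; case/or3P: d3 => /eqP E; rewrite -?Ec -?E => u ur ur' uV urV urV' hx hy hz.
  - by case/eqP: cd; rewrite Ec E.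
  - exact: Hcd.
  - by rewrite (HV c d y) // Hcd.
  - by rewrite (HV d z c) // (Hrot c d z) // Hcd.
  - by case/eqP: cd; rewrite Ec E.
  - by rewrite (Hrot d x c) // (Hrot c d x) // Hcd.
  - by rewrite (Hrot c d y) // Hcd.
  - by rewrite (HV x c d) // (Hrot d x c) // (Hrot c d x) // Hcd.
  - by case/eqP: cd; rewrite Ec E.
by move=> g /(subsetP sH); rewrite inE => /andP[_ /eqP].
Qed.

End FixedVector.

(* Write v as f_ab and let f_ij be its translates. Then f_ij = x_i - x_j up to a scalar, where
   x_i is the sum of the f_ij over j, so one of x_a, x_b is a nonzero fixed vector of a point
   stabiliser. *)
Lemma nonstar_fixed (T : finType) (S : {set T}) (f : {perm T} -> algC) a b c d e k :
  charon (altS S) f -> uniq [:: a; b; c; d; e; k] ->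
  {subset [:: a; b; c; d; e; k] <= S} ->
  f 1%g - 2%:R * f (cyc3 a b c) + f (cyc3 a b c * cyc3 d e k)%g = 0 ->
  f (cyc3 a b c) != f 1%g ->
  exists2 p, p \in S & dotf (altS (S :\ p)) f (fun=> 1) != 0.
Proof.
move=> Nf u6 s6 z0 ntf; have [u1 u2 s1 s2 S6] := sext_facts u6 s6.
have [ab ac bc] := uniq3 u1.
have [Sa Sb Sc] : [/\ a \in S, b \in S & c \in S] by rewrite !s6 ?inE ?eqxx ?orbT.
have Ss : cyc3 a b c \in altS S by exact: cyc3_alt.
have Ss' : cyc3 d e k \in altS S.
  by apply: cyc3_alt => // x /s2; rewrite inE => /andP[].
have [n [rG fE]] := charon_repP Nf.
have [||v [v0 vH vt vs]] := pair_vector (rG := rG) u6 s6.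
- by rewrite -!fE ?group1 ?(groupM Ss Ss').
- by rewrite -!fE ?group1.
have u4 : uniq [:: a; b; c; d] := mask_uniq u6 [:: true; true; true; true].
have s4 : {subset [:: a; b; c; d] <= S}.
  by move=> t; rewrite !inE => /or4P[] /eqP->; rewrite s6 // !inE eqxx ?orbT.
have St := dtr_alt u4 s4; have [ta tb _ _] := dtrE u4.
(* The translate of v by any even permutation carrying (a, b) to (i, j). The choice is irrelevant
   because the even permutations fixing a and b fix v, and the default 0 is not reached for distinct
   i and j in [S]. *)
pose F i j := if [pick g in altS S | (g a == i) && (g b == j)] is Some g
  then v *m rG g else 0.
have FE g : g \in altS S -> F (g a) (g b) = v *m rG g.
  move=> Sg; rewrite /F; case: pickP => [h /and3P[Sh /eqP ha /eqP hb]|/(_ g)]; last first.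
    by rewrite Sg !eqxx.
  have /vH : (h * g^-1)%g \in altS (S :\: [set a; b]).
    have : (h * g^-1)%g \in altS S by rewrite groupM ?groupV.
    rewrite !altSE => /andP[Shg ->]; rewrite andbT; apply/subsetP=> x; rewrite inE => nx.
    have Sx := subsetP Shg x nx; rewrite !inE Sx andbT negb_or.
    by apply/andP; split; apply: contra nx => /eqP->; rewrite permM ?ha ?hb permK.
  by rewrite repr_mxM ?groupV // => {2}<-; rewrite -!mulmxA -repr_mxM ?groupV // mulVg repr_mx1 mulmx1.
have reach i j : i \in S -> j \in S -> i != j -> exists2 g, g \in altS S & g a = i /\ g b = j.
  move=> Si Sj ij; have [|||||g Sg [ga gb]] := @alt_to T S [:: a; b] [:: i; j] _ _ erefl.
  - by rewrite /= !inE ab.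
  - by rewrite /= !inE ij.
  - by move=> x; rewrite !inE => /orP[] /eqP->.
  - by move=> x; rewrite !inE => /orP[] /eqP->.
  - by rewrite (leq_trans _ S6).
  by exists g.
have Fact i j h : i \in S -> j \in S -> i != j -> h \in altS S ->
    F i j *m rG h = F (h i) (h j).
  move=> Si Sj ij Sh; have [g Sg [<- <-]] := reach _ _ Si Sj ij.
  by rewrite FE // -mulmxA -repr_mxM // -FE ?groupM // !permM.
have Fv : F a b = v by have := FE 1%g (group1 _); rewrite !perm1 repr_mx1 mulmx1.
have Fanti i j : i \in S -> j \in S -> i != j -> F j i = - F i j.
  move=> Si Sj ij; have [g Sg [<- <-]] := reach _ _ Si Sj ij.
  have -> : F (g b) (g a) = v *m rG (dtr a b c d * g)%g.
    by rewrite -FE ?(groupM St Sg) // 2!(permM _ g) ta tb.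
  by rewrite repr_mxM // mulmxA vt mulNmx FE.
have Ftri j : j \in S -> j != a -> j != b -> F a b + F b j + F j a = 0.
  move=> Sj ja jb; have uj : uniq [:: a; b; j] by rewrite /= !inE negb_or ab !(eq_sym _ j) ja jb.
  have [||g Sg [ga gb gc]] := @alt_to T S [:: a; b; c] [:: a; b; j] u1 uj erefl s1.
  - by move=> x; rewrite !inE => /or3P[] /eqP->.
  - by rewrite (leq_trans _ S6).
  rewrite Fv; have <- : v *m rG g = v by rewrite -FE // ga gb.
  have -> : F b j = v *m rG (cyc3 a b c * g)%g.
    by rewrite -FE ?(groupM Ss Sg) // 2!(permM _ g) cyc3_1 // cyc3_2 // gb gc.
  have -> : F j a = v *m rG ((cyc3 a b c)^-1 * g)%g.
    have uV : uniq [:: a; c; b] by rewrite -(rot_uniq 1) -rev_uniq.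
    have SsV : (cyc3 a b c)^-1%g \in altS S by rewrite groupV.
    by rewrite -FE ?(groupM SsV Sg) // 2!(permM _ g) cyc3V // cyc3_1 // cyc3_3 // gc ga.
  have SsV : (cyc3 a b c)^-1%g \in altS S by rewrite groupV.
  by rewrite (repr_mxM rG Ss Sg) (repr_mxM rG SsV Sg) !mulmxA -!mulmxDl vs mul0mx.
pose X i := \sum_(j in S :\ i) F i j.
have Xfix i : i \in S -> {in altS (S :\ i), forall h, X i *m rG h = X i}.
  move=> Si h Sh; have Sh' : h \in altS S by apply: (subsetP (altSS (subD1set S i))).
  rewrite mulmx_suml [RHS](reindex_inj (@perm_inj _ h)) /=.
  have hi : h i = i by apply: (altS_fix Sh); rewrite !inE eqxx.
  apply: eq_big => [j|j]; first by rewrite (altS_stable j Sh).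
  by rewrite !inE => /andP[ji Sj]; rewrite Fact // ?hi // eq_sym.
(* For each j other than a and b, the relation [Ftri] makes F a j - F b j equal to v; the terms F a
   b and F b a contribute the remaining 2v. *)
have XX : X a - X b = #|S|%:R *: v.
  have Ea : X a = v + \sum_(j in S :\: [set a; b]) F a j.
    rewrite /X (bigD1 b) /=; last by rewrite !inE eq_sym ab Sb.
    by rewrite Fv; congr (_ + _); apply: eq_bigl => j; rewrite !inE negb_or andbAC.
  have Eb : X b = - v + \sum_(j in S :\: [set a; b]) F b j.
    rewrite /X (bigD1 a) /=; last by rewrite !inE ab Sa.
    rewrite (Fanti a b) // Fv; congr (_ + _).
    by apply: eq_bigl => j; rewrite !inE negb_or andbAC (andbC (j != b)).
  have card : #|S| = (#|S :\: [set a; b]| + 2)%N.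
    have sab : [set a; b] \subset S by apply/subsetP=> x; rewrite !inE => /orP[] /eqP->.
    by rewrite cardsDS // cards2 ab subnK // (leq_trans _ S6).
  rewrite Ea Eb opprD opprK addrACA -sumrB (eq_bigr (fun=> v)).
    by rewrite sumr_const card natrD scalerDl addrC -!scaler_nat mulr2n scalerDl scale1r.
  move=> j; rewrite !inE negb_or -andbA => /and3P[ja jb Sj].
  rewrite -Fv; have := Ftri j Sj ja jb; rewrite (Fanti a j) 1?eq_sym // => /eqP.
  by rewrite subr_eq0 => /eqP<-; rewrite addrK.
have SX : X a != 0 \/ X b != 0.
  have : X a - X b != 0.
    by rewrite XX scaler_eq0 negb_or v0 pnatr_eq0 andbT -lt0n (leq_trans _ S6).
  by case: (eqVneq (X a) 0) => [->|]; [rewrite sub0r oppr_eq0; right | left].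
have dotE p : p \in S -> X p != 0 -> dotf (altS (S :\ p)) f (fun=> 1) != 0.
  move=> Sp Xp; rewrite (eq_dotf (f' := fun x => \tr (rG x)) (g' := fun=> 1)) //.
    by apply: (fixed_vec_dot (altSS (subD1set S p)) Xp); exact: Xfix.
  by move=> x Sx; rewrite fE // (subsetP (altSS (subD1set S p))).
by case: SX => [Xa|Xb]; [exists a | exists b] => //; exact: dotE.
Qed.

(** * The doubly transitive permutation character *)

Section FixedPoints.

Variable T : finType.
Implicit Types (S : {set T}) (g h : {perm T}).

Definition sfix S g := #|[set x in S | g x == x]|.

Lemma stab_altS S x g : x \in S -> (g \in altS (S :\ x)) = (g \in altS S) && (g x == x).
Proof.
move=> Sx; rewrite !altSE; case: (odd_perm g); rewrite ?andbF ?andbT //.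
apply/idP/andP => [Sg|[Sg /eqP gx]].
  split; first by apply: perm_onS Sg; exact: subD1set.
  by rewrite (out_perm Sg) // !inE eqxx.
apply/subsetP=> y; rewrite inE => gy; rewrite !inE (subsetP Sg) ?inE // andbT.
by apply: contraNneq gy => ->; rewrite gx.
Qed.

Lemma card_altS_point S x : (3 <= #|S|)%N -> x \in S -> (#|altS S| = #|S| * #|altS (S :\ x)|)%N.
Proof.
move=> S3 Sx; have cS := cardsD1 x S; rewrite Sx in cS.
apply/eqP; rewrite -(eqn_pmul2l (isT : (0 < 2)%N)) card_altS 1?ltnW //.
rewrite mulnCA card_altS; last by move: S3; rewrite cS.
by rewrite cS add1n factS.
Qed.

Lemma altS_point S x y : (3 <= #|S|)%N -> x \in S -> y \in S -> exists2 h, h \in altS S & h x = y.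
Proof.
move=> S3 Sx Sy; have [||h Sh [hx]] := @alt_to T S [:: x] [:: y] isT isT erefl _ _ S3.
- by move=> z; rewrite inE => /eqP->.
- by move=> z; rewrite inE => /eqP->.
by exists h.
Qed.

Lemma sum_point S (F : {perm T} -> algC) x y : (3 <= #|S|)%N -> x \in S -> y \in S ->
  {in altS S &, forall g h, F (g ^ h)%g = F g} ->
  \sum_(g in altS (S :\ x)) F g = \sum_(g in altS (S :\ y)) F g.
Proof.
move=> S3 Sx Sy FJ; have [h Sh hx] := altS_point S3 Sx Sy.
rewrite [RHS](reindex_inj (conjg_inj h)) /=; apply: eq_big => [g|g]; last first.
  by rewrite stab_altS // => /andP[Sg _]; rewrite FJ.
rewrite !stab_altS // memJ_norm ?(subsetP (normG _)) //; congr (_ && _).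
by rewrite -hx permJ (inj_eq perm_inj).
Qed.

(** Frobenius reciprocity for the permutation character on [S], induced from the trivial character
    of a point stabiliser. *)
Lemma dot_sfix S (F : {perm T} -> algC) x : (3 <= #|S|)%N -> x \in S ->
  {in altS S &, forall g h, F (g ^ h)%g = F g} ->
  dotf (altS S) (fun g => (sfix S g)%:R) F = dotf (altS (S :\ x)) (fun=> 1) F.
Proof.
move=> S3 Sx FJ; rewrite /dotf.
have -> : \sum_(g in altS S) (sfix S g)%:R * (F g)^* =
    \sum_(y in S) \sum_(g in altS (S :\ y)) 1 * (F g)^*.
  transitivity (\sum_(g in altS S) \sum_(y in S) (g y == y)%:R * (F g)^*).
    apply: eq_bigr => g _; rewrite -mulr_suml; congr (_ * _).
    rewrite /sfix -sum1_card natr_sum big_mkcond [RHS]big_mkcond /=.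
    by apply: eq_bigr => y _; rewrite inE; case: (y \in S); case: (g y == y).
  rewrite exchange_big /=; apply: eq_bigr => y Sy.
  rewrite big_mkcond [RHS]big_mkcond /=; apply: eq_bigr => g _; rewrite stab_altS //.
  by case: (g \in altS S); case: (g y == y); rewrite ?mul0r.
rewrite (eq_bigr (fun=> \sum_(g in altS (S :\ x)) 1 * (F g)^*)) => [|y Sy]; last first.
  by apply: (sum_point (S := S)) => // g h Sg Sh; rewrite FJ.
rewrite sumr_const -(mulr_natl (\sum_(g in _) _)) mulrA; congr (_ * _).
rewrite (card_altS_point S3 Sx) natrM invfM mulrAC mulVf ?mul1r //.
by rewrite pnatr_eq0 -lt0n (leq_trans _ S3).
Qed.

Lemma sfixJ S g h : h \in altS S -> sfix S (g ^ h)%g = sfix S g.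
Proof.
move=> Sh; rewrite /sfix -[RHS](card_imset _ (@perm_inj _ h)); apply: eq_card => x.
rewrite -[x](permKV h) (mem_imset _ _ (@perm_inj _ h)) !inE permJ (inj_eq perm_inj).
by rewrite (altS_stable _ Sh).
Qed.

Lemma dotf1 (H : {group {perm T}}) : dotf H (fun=> 1) (fun=> 1) = 1.
Proof.
rewrite /dotf (eq_bigr (fun=> 1)) => [|x _]; last by rewrite rmorph1 mulr1.
by rewrite sumr_const mulVf // pnatr_eq0 -lt0n cardG_gt0.
Qed.

Lemma sfix_char S : (3 <= #|S|)%N -> charon (altS S) (fun g => (sfix S g)%:R).
Proof.
move=> S3; have [x Sx _] := @pick_out T S [::] ltac:(by apply: leq_trans S3).
apply: charon_of_dot => [g h Sg Sh|i]; first by rewrite sfixJ.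
have Ni := charon_irr i; rewrite (dot_sfix S3 Sx).
  by apply: charon_nat; [exact: charon_1 | apply: charon_res Ni; rewrite altSS ?subD1set].
by move=> g h Sg Sh; rewrite (charonJ Ni).
Qed.

(** Double transitivity: a point stabiliser has two orbits on [S], one of which is a single point.
    The proof applies reciprocity once for [S] and once for the points left. *)
Lemma sfix_norm S : (4 <= #|S|)%N ->
  dotf (altS S) (fun g => (sfix S g)%:R) (fun g => (sfix S g)%:R) = 2%:R.
Proof.
move=> S4; have S3 := ltnW S4; have [x Sx _] := @pick_out T S [::] ltac:(by apply: leq_trans S3).
have S3' : (3 <= #|S :\ x|)%N by move: S4; rewrite (cardsD1 x) Sx.
have [y Sy _] := @pick_out T (S :\ x) [::] ltac:(by apply: leq_trans S3').
rewrite (dot_sfix S3 Sx) => [|g h Sg Sh]; last by rewrite sfixJ.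
have E : {in altS (S :\ x), forall g, (sfix S g)%:R = 1 + (sfix (S :\ x) g)%:R :> algC}.
  move=> g; rewrite stab_altS // => /andP[_ /eqP gx].
  rewrite -[1]/(1%:R) -natrD /sfix (cardsD1 x) inE Sx gx eqxx; congr (_ + _)%:R.
  by apply: eq_card => z; rewrite !inE andbA.
rewrite /dotf (eq_bigr (fun g => 1 + 1 * ((sfix (S :\ x) g)%:R)^*)) => [|g Hg]; last first.
  by rewrite mul1r mul1r E // rmorphD rmorph1.
rewrite big_split /= mulrDr -[X in X + _](mulr1) -mulrA mulr_suml.
have -> : #|altS (S :\ x)|%:R^-1 * \sum_(i in altS (S :\ x)) 1 * 1 = 1 :> algC.
  rewrite -[RHS](dotf1 (altS (S :\ x))) /dotf; congr (_ * _).
  by apply: eq_bigr => g _; rewrite rmorph1.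
suff -> : #|altS (S :\ x)|%:R^-1 * \sum_(i in altS (S :\ x)) 1 * ((sfix (S :\ x) i)%:R)^* = 1 :> algC.
  by rewrite -natr1.
rewrite -[RHS](dotf1 (altS (S :\ x :\ y))) -(dot_sfix S3' Sy) // /dotf; congr (_ * _).
by apply: eq_bigr => g _; rewrite conjC_nat rmorph1 mul1r mulr1.
Qed.

(** Norm 2 and one trivial constituent leave exactly one further irreducible, of multiplicity one.
    By reciprocity only these two have vectors fixed by a point stabiliser. *)
Lemma sfix_irr S : (4 <= #|S|)%N -> exists j : Iirr (altS S), [/\ j != 0,
  {in altS S, forall g, (sfix S g)%:R = 1 + 'chi_j g} &
  forall i x, x \in S -> dotf (altS (S :\ x)) 'chi_i (fun=> 1) != 0 -> i = 0 \/ i = j].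
Proof.
move=> S4; have S3 := ltnW S4; have [n [nE sE]] := charon_dec (sfix_char S3).
have nJ i : {in altS S &, forall g h, 'chi[altS S]_i (g ^ h)%g = 'chi_i g}.
  by move=> g h Sg Sh; rewrite (charonJ (charon_irr i)).
have [x0 Sx0 _] := @pick_out T S [::] ltac:(by apply: leq_trans S3).
have n0 : n 0 = 1%N.
  apply/eqP; rewrite -(eqr_nat algC) nE (dot_sfix S3 Sx0) //.
  rewrite -[X in _ == X](dotf1 (altS (S :\ x0))); apply/eqP/eq_dotf => // g Sg.
  by rewrite irr0 cfun1E (subsetP (altSS (subD1set S x0)) _ Sg).
have : (\sum_i n i * n i = 2)%N.
  apply/eqP; rewrite -(eqr_nat algC) -(sfix_norm S4) natr_sum; apply/eqP.
  have [phi Nphi phiE] := sfix_char S3.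
  rewrite (eq_dotf phiE phiE) dotfE cfdot_sum_irr; apply: eq_bigr => i _.
  by rewrite natrM nE (eq_dotf phiE (fun _ _ => erefl)) dotfE; congr (_ * _); rewrite conj_natr // Cnat_cfdot_char_irr.
rewrite (bigD1 0) // n0 => E.
have /sum_nat_eq1[j [j0 njj nj]] : (\sum_(i : Iirr (altS S) | i != 0%R) n i * n i == 1)%N.
  by rewrite -(eqn_add2l (1 * 1)) E.
have nj1 : n j = 1%N by move: njj; case: (n j) => [|[|m]].
have nz i : i != 0 -> i != j -> n i = 0%N.
  by move=> i0 ij; have := nj i ij i0; case: (n i).
exists j; split=> // [g Sg|i x Sx dx].
  rewrite sE // (bigD1 0) // n0 mul1r irr0 cfun1E Sg; congr (_ + _).
  rewrite (bigD1 j) //= nj1 mul1r big1 ?addr0 // => i /andP[i0 ij].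
  by rewrite nz // mul0r.
have [->|i0] := eqVneq i 0; [by left | right; apply/eqP; apply: contraNT dx => ij].
by rewrite -conjC_eq0 dotfC -(dot_sfix S3 Sx) // -nE nz.
Qed.

End FixedPoints.

(** * Characters of small degree *)

Section MinimalDegree.

Variable T : finType.
Implicit Types (S : {set T}) (f : {perm T} -> algC).

(* Nine times the multiplicity of a product of two nontrivial characters in the restriction
   to the group generated by the two 3-cycles. *)
Definition zval f (a b c d e k : T) : algC :=
  f 1%g - 2%:R * f (cyc3 a b c) + f (cyc3 a b c * cyc3 d e k)%g.

Lemma zval_ge0 S f a b c d e k : charon (altS S) f -> uniq [:: a; b; c; d; e; k] ->
  {subset [:: a; b; c; d; e; k] <= S} -> 0 <= zval f a b c d e k.
Proof.
move=> Nf u sS; have [x [y [z [E1 E2 E3]]]] := data6 Nf u sS.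
rewrite /zval E1 E2 E3.
suff -> : (x + 4 * y + 4 * z)%:R - 2%:R * ((x + y)%:R - 2%:R * z%:R) +
  ((x + z)%:R - 2%:R * y%:R) = (9 * z)%:R :> algC by rewrite ler0n.
by ring.
Qed.

Lemma zval_const S f a b c d e k a' b' c' d' e' k' : charon (altS S) f ->
  uniq [:: a; b; c; d; e; k] -> uniq [:: a'; b'; c'; d'; e'; k'] ->
  {subset [:: a; b; c; d; e; k] <= S} -> {subset [:: a'; b'; c'; d'; e'; k'] <= S} ->
  zval f a b c d e k = zval f a' b' c' d' e' k'.
Proof.
move=> Nf u u' sS sS'; have [u1 _ s1 _ S6] := sext_facts u sS.
have [u1' _ s1' _ _] := sext_facts u' sS'; rewrite /zval (const_cyc33 Nf u u' sS sS').
by rewrite (const_cyc3 Nf _ u1 u1' s1 s1') // (leq_trans _ S6).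
Qed.

Section Sext.

Variables (S : {set T}) (a b c d e k : T).
Hypothesis u6 : uniq [:: a; b; c; d; e; k].
Hypothesis s6 : {subset [:: a; b; c; d; e; k] <= S}.

Let S6 : (6 <= #|S|)%N.
Proof. by have [] := sext_facts u6 s6. Qed.

Let Sc : cyc3 a b c \in altS S.
Proof. by have [u1 _ s1 _ _] := sext_facts u6 s6; exact: cyc3_alt. Qed.

Let Scc : (cyc3 a b c * cyc3 d e k)%g \in altS S.
Proof.
have [_ u2 _ s2 _] := sext_facts u6 s6; apply: groupM Sc _.
by apply: cyc3_alt => // x /s2; rewrite inE => /andP[].
Qed.

Lemma zval_dec f (n : Iirr (altS S) -> nat) :
  {in altS S, forall g, f g = \sum_i (n i)%:R * 'chi_i g} ->
  zval f a b c d e k = \sum_i (n i)%:R * zval 'chi_i a b c d e k.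
Proof.
move=> fE; rewrite /zval !fE ?group1 // mulr_sumr -sumrB -big_split /=.
by apply: eq_bigr => i _; ring.
Qed.

(** [zval] is nonnegative on characters, so it vanishes on every constituent. A nontrivial
    irreducible with [zval] zero has a vector fixed by a point stabiliser, hence is the constituent
    of the permutation character of degree |S| - 1. *)
Lemma nonstar_form f : charon (altS S) f -> zval f a b c d e k = 0 ->
  exists A B : nat, {in altS S, forall g, f g = A%:R + B%:R * ((sfix S g)%:R - 1)}.
Proof.
move=> Nf z0; have [n [_ fE]] := charon_dec Nf.
have [j [j0 jE jU]] := sfix_irr (ltac:(by apply: leq_trans S6) : (4 <= #|S|)%N).
have nz i : i != 0 -> i != j -> n i = 0%N.
  move=> i0 ij; apply/eqP; apply: contraTT isT => ni.
  have /eqP : zval 'chi[altS S]_i a b c d e k = 0.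
    have := zval_dec fE; rewrite z0 (bigD1 i) // => /esym/eqP; rewrite paddr_eq0; last first.
    - by apply: sumr_ge0 => l _; rewrite mulr_ge0 ?ler0n // (zval_ge0 (charon_irr l) u6).
    - by rewrite mulr_ge0 ?ler0n // (zval_ge0 (charon_irr i) u6).
    by case/andP=> /eqP/eqP; rewrite mulf_eq0 pnatr_eq0 (negPf ni) => /eqP.
  move/eqP=> zi; have [E|ne] := eqVneq ('chi[altS S]_i (cyc3 a b c)) ('chi_i 1%g).
    have [u1 _ s1 _ _] := sext_facts u6 s6.
    have triv := cyc3_trivial (charon_irr i) u1 s1 E.
    case/eqP: i0; apply: irr_inj; apply/cfun_inP => g Sg.
    rewrite irr0 cfun1E Sg triv //; have lin : 'chi[altS S]_i \is a linear_char.
      apply/andP; split; first exact: irr_char.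
      have := cfnorm_irr i; rewrite -dotfE /dotf.
      rewrite (eq_bigr (fun=> 'chi_i 1%g * ('chi_i 1%g)^*)) => [|h Sh]; last by rewrite triv.
      rewrite avg_const.
      have /natrP[m ->] := Cnat_irr1 i; rewrite conjC_nat -natrM => /eqP; rewrite pnatr_eq1.
      by rewrite muln_eq1 => /andP[/eqP-> _].
    by rewrite lin_char1.
  have [p Sp dp] := nonstar_fixed (charon_irr i) u6 s6 zi ne.
  by have [E|E] := jU i p Sp dp; move: i0 ij; rewrite E eqxx.
exists (n 0), (n j) => g Sg; rewrite fE // (bigD1 0) // irr0 cfun1E Sg mulr1; congr (_ + _).
rewrite (bigD1 j) //= big1 ?addr0 => [|i /andP[i0 ij]]; last by rewrite nz // mul0r.
by rewrite jE // [1 + _]addrC addrK.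
Qed.

End Sext.

Lemma sextuple S : (6 <= #|S|)%N -> exists a b c d e k, uniq [:: a; b; c; d; e; k] /\
  {subset [:: a; b; c; d; e; k] <= S}.
Proof.
move=> S6; have : (6 <= size (enum S))%N by rewrite -cardE.
have := enum_uniq (mem S); have : {subset enum S <= S} by move=> x; rewrite mem_enum.
case: (enum S) => [|a [|b [|c [|d [|e [|k s]]]]]] // sS us _.
exists a, b, c, d, e, k; split.
  by have := us; rewrite -[_ :: _]/([:: a; b; c; d; e; k] ++ s) cat_uniq => /andP[].
by move=> x xs; apply: sS; rewrite -[_ :: _]/([:: a; b; c; d; e; k] ++ s) mem_cat xs.
Qed.

Lemma sfix1 S : sfix S 1%g = #|S|.
Proof. by apply: eq_card => x; rewrite !inE perm1 eqxx andbT. Qed.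

(** The degree is that of the trivial slice along a 3-cycle plus twice that of a nontrivial one.
    Both slices are nontrivial because y and z are positive, so each has degree at least |S| - 4 by
    the hypothesis on smaller sets; nine points leave the six which that hypothesis needs. *)
Lemma star_degree S f a b c d e k : charon (altS S) f -> uniq [:: a; b; c; d; e; k] ->
  {subset [:: a; b; c; d; e; k] <= S} -> zval f a b c d e k != 0 ->
  (forall S' g x y z, (#|S'| < #|S|)%N -> (6 <= #|S'|)%N -> charon (altS S') g ->
     uniq [:: x; y; z] -> {subset [:: x; y; z] <= S'} -> g (cyc3 x y z) != g 1%g ->
     (#|S'|.-1)%:R <= g 1%g) ->
  (9 <= #|S|)%N -> (3 * (#|S| - 4))%:R <= f 1%g.
Proof.
move=> Nf u6 s6 z0 IH S9; have [u1 u2 s1 s2 S6] := sext_facts u6 s6.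
have [e1 e2 e3 e4 [e5 e6 e7]] := sext_inv Nf u6 s6.
have [w [w3 w0]] := omega_exists.
have N1 := cslice_char Nf u1 s1 (expr1n _ 3); have Nw := cslice_char Nf u1 s1 w3.
have y0 := y_pos Nf u6 s6 (ltac:(by apply: leq_trans S9)) z0.
set S' := S :\: [set x in [:: a; b; c]] in s2 N1 Nw *.
have cS' : #|S'| = (#|S| - 3)%N.
  rewrite /S' cardsDS; last by apply/subsetP=> x; rewrite inE => /s1.
  by congr (_ - _)%N; rewrite cardsE (card_uniqP u1).
have L g := IH S' g _ _ _ (ltac:(by rewrite cS'; lia)) (ltac:(by rewrite cS'; lia)).
have i1 : f (1 * (cyc3 a b c)^-1)%g = f (1 * cyc3 a b c)%g by rewrite !mul1g.
have i2 : f (cyc3 d e k * (cyc3 a b c)^-1)%g = f (cyc3 d e k * cyc3 a b c)%g by rewrite e4 e5.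
have n3 : 3%:R^-1 != 0 :> algC by rewrite invr_eq0 pnatr_eq0.
have L1 : (#|S'|.-1)%:R <= cslice f a b c 1 1%g.
  apply: (L _ _ _ _ N1 u2 s2); rewrite !cslice1E // mul1g e2 e4 (inj_eq (mulfI n3)).
  apply: contraNneq y0 => E; apply/eqP; rewrite -[RHS](subrr (f 1%g + 2%:R * f (cyc3 a b c))) -{2}E.
  by ring.
have L2 : (#|S'|.-1)%:R <= cslice f a b c w 1%g.
  apply: (L _ _ _ _ Nw u2 s2); rewrite !csliceE // mul1g e2 e4 (inj_eq (mulfI n3)).
  apply: contraNneq z0 => E; apply/eqP; rewrite /zval -[RHS](subrr (f 1%g - f (cyc3 a b c))) -{2}E.
  by ring.
have -> : f 1%g = cslice f a b c 1 1%g + 2%:R * cslice f a b c w 1%g.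
  by rewrite cslice1E // csliceE // mul1g; field.
have -> : (3 * (#|S| - 4) = #|S'|.-1 + 2 * #|S'|.-1)%N by rewrite cS'; lia.
by rewrite natrD natrM lerD // ler_pM2l ?ltr0n.
Qed.

(** When [zval] vanishes, f is built from 1 and the character of degree |S| - 1. Otherwise the bound
    5 settles six points, the bound 8 settles seven and eight points, and induction through slices
    gives 3(|S| - 4) from nine points on. *)
Lemma alt_min_degree S f a b c : (6 <= #|S|)%N -> charon (altS S) f ->
  uniq [:: a; b; c] -> {subset [:: a; b; c] <= S} -> f (cyc3 a b c) != f 1%g ->
  (#|S|.-1)%:R <= f 1%g.
Proof.
have [n] := ubnP #|S|; elim: n S f a b c => // n IHn S f a b c Sn S6 Nf u s ntf.
have [a' [b' [c' [d' [e' [k' [u6 s6]]]]]]] := sextuple S6.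
have [z0|z0] := eqVneq (zval f a' b' c' d' e' k') 0.
  have [A [B fE]] := nonstar_form u6 s6 Nf z0.
  have B0 : B != 0%N.
    apply: contraNneq ntf => B0; rewrite !fE ?group1 ?cyc3_alt //.
    by rewrite B0 !mul0r.
  rewrite fE ?group1 // sfix1; apply: (@le_trans _ _ (B%:R * (#|S|%:R - 1))); last first.
    by rewrite lerDr ler0n.
  have -> : #|S|%:R - 1 = (#|S|.-1)%:R :> algC.
    by rewrite -[in LHS](prednK (ltac:(by apply: leq_trans S6) : (0 < #|S|)%N)) -natr1 addrK.
  by rewrite -natrM ler_nat leq_pmull // lt0n.
have S5 := star_deg5 Nf u6 s6 z0.
have [S6'|S7] := eqVneq #|S| 6%N; first by rewrite S6'.
have {S7}S7 : (7 <= #|S|)%N by rewrite ltn_neqAle eq_sym S7.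
have S8 := star_deg8 Nf u6 s6 S7 z0.
have [S8'|S9] := leqP #|S| 8; first by apply: le_trans S8; rewrite ler_nat; lia.
apply: (@le_trans _ _ (3 * (#|S| - 4))%:R); first by rewrite ler_nat; lia.
apply: (star_degree Nf u6 s6 z0) => // S' g x y z lt S'6 Ng uz sz ntg.
by apply: (IHn _ _ x y z) => //; apply: leq_trans lt Sn.
Qed.

End MinimalDegree.

(** * The character table of Sym(7) and the prime 3 *)

Section PermutationCharacters.

Variables (gT : finGroupType) (G : {group gT}) (X : finType) (h : gT -> X -> X).
Hypothesis h1 : h 1%g =1 id.
Hypothesis hM : {in G &, forall x y, h (x * y)%g =1 h y \o h x}.

Lemma charon_perm : charon G (fun g => #|[set x | h g x == x]|%:R).
Proof.
pose R g : 'M[algC]_#|X| := \matrix_(i, j) (h g (enum_val i) == enum_val j)%:R.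
have rP : mx_repr G R.
  split=> [|x y Gx Gy]; apply/matrixP=> i j; rewrite !mxE.
    by rewrite h1 (inj_eq enum_val_inj).
  rewrite (bigD1 (enum_rank (h x (enum_val i)))) //= !mxE enum_rankK eqxx mul1r hM //=.
  rewrite big1 ?addr0 // => l nl; rewrite !mxE (negPf (_ : h x (enum_val i) != _)) ?mul0r //.
  by apply: contraNneq nl => ->; rewrite enum_valK.
apply: charon_ext (charon_rep (MxRepresentation rP)) => g _ /=.
rewrite /mxtrace -[in RHS]sum1_card natr_sum [RHS]big_mkcond (reindex_onto enum_rank enum_val) /=.
  apply: eq_big => [x|x _]; first by rewrite enum_rankK eqxx.
  by rewrite mxE enum_rankK inE; case: (h g x == x).
by move=> i _; rewrite enum_valK.
Qed.

End PermutationCharacters.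

Section Powers.

Variables (T : finType) (G : {group {perm T}}).

Definition pfix (g : {perm T}) : nat := #|[set x | g x == x]|.

Lemma charon_pfix : charon G (fun g => (pfix g)%:R).
Proof.
by apply: (charon_perm (h := fun (g : {perm T}) x => g x)) => [x|g h _ _ x];
   rewrite ?perm1 // permM.
Qed.

(** A cyclic group of order two rotates pairs and one of order three rotates triples, commuting with
    the action on coordinates. The slices at its characters are Schur functors of the permutation
    representation. *)
Let sq (u : {perm T} * 'I_2) (x : T * T) : T * T :=
  if u.2 == 0 :> nat then (u.1 x.1, u.1 x.2) else (u.1 x.2, u.1 x.1).

Let cu (u : {perm T} * 'I_3) (x : T * T * T) : T * T * T :=
  if u.2 == 0 :> nat then (u.1 x.1.1, u.1 x.1.2, u.1 x.2)
  else if u.2 == 1%N :> nat then (u.1 x.1.2, u.1 x.2, u.1 x.1.1)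
  else (u.1 x.2, u.1 x.1.1, u.1 x.1.2).

Let fix_sq (g : {perm T}) (i : 'I_2) :
  #|[set x | sq (g, i) x == x]| = if i == 0 :> nat then (pfix g ^ 2)%N else pfix (g ^+ 2)%g.
Proof.
rewrite /sq /=; case: ifP => _.
  rewrite -mulnn /pfix -cardsX; apply: eq_card => [[x y]].
  by rewrite !inE -pair_eqE.
rewrite /pfix -(card_imset _ (_ : injective (fun x => (x, g x)))) => [|x y [] //].
apply: eq_card => [[x y]]; rewrite inE; apply/eqP/imsetP => [[gx gy]|[z]].
  by exists x; rewrite -?gy // inE expgS expg1 permM gy gx.
by rewrite inE expgS expg1 permM => /eqP gz [-> ->]; rewrite /= gz.
Qed.

Let fix_cu (g : {perm T}) (i : 'I_3) :
  #|[set x | cu (g, i) x == x]| = if i == 0 :> nat then (pfix g ^ 3)%N else pfix (g ^+ 3)%g.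
Proof.
case: i => [[|[|[|i]]] i3] //; rewrite /cu /=.
- rewrite (expnS _ 2) mulnC -mulnn /pfix -!cardsX; apply: eq_card => [[[x y] z]].
  by rewrite !inE -!pair_eqE.
- rewrite /pfix -(card_imset _ (_ : injective (fun x => (x, g (g x), g x)))) => [|x y [] //].
  apply: eq_card => [[[x y] z]]; rewrite inE; apply/eqP/imsetP => [[/= gx gy gz]|[t]].
    by exists x; rewrite ?gz ?gy // inE !expgS mulg1 !permM gz gy gx.
  by rewrite inE !expgS mulg1 !permM => /eqP gt [-> -> ->]; rewrite /= gt.
- rewrite /pfix -(card_imset _ (_ : injective (fun x => (x, g x, g (g x))))) => [|x y [] //].
  apply: eq_card => [[[x y] z]]; rewrite inE; apply/eqP/imsetP => [[/= gx gy gz]|[t]].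
    by exists x; rewrite ?gy ?gz // inE !expgS mulg1 !permM gy gz gx.
  by rewrite inE !expgS mulg1 !permM => /eqP gt [-> -> ->]; rewrite /= gt.
Qed.

Lemma charon_sym2 : charon G (fun g => ((pfix g ^ 2)%:R + (pfix (g ^+ 2)%g)%:R) / 2%:R).
Proof.
have Nsq : charon [group of setX G [set: 'I_2]] (fun u => #|[set x | sq u x == x]|%:R).
  apply: charon_perm => [[x y]|[g i] [h j] _ _ [x y]]; first by rewrite /sq /= !perm1.
  by rewrite /sq /=; case: i j => [[|[|i]]] // ? [[|[|j]]] // ?; rewrite !permM.
have := charon_slice Nsq (charon_1 _); apply: charon_ext => g _.
rewrite /dotf cardsT card_ord (eq_bigl predT) => [|i]; last by rewrite inE.
rewrite !big_ord_recl big_ord0 /= !fix_sq /= rmorph1 !mulr1 addr0 mulrC.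
by [].
Qed.

(** The eigenspace of the rotation of triples for a nontrivial cube root of unity is the Schur
    functor of shape (2,1); the numbers of fixed points of powers play the role of power sums. *)
Lemma charon_mixed3 : charon G (fun g => ((pfix g ^ 3)%:R - (pfix (g ^+ 3)%g)%:R) / 3%:R).
Proof.
have Ncu : charon [group of setX G [set: 'I_3]] (fun u => #|[set x | cu u x == x]|%:R).
  apply: charon_perm => [[[x y] z]|[g i] [h j] _ _ [[x y] z]]; first by rewrite /cu /= !perm1.
  by rewrite /cu /=; case: i j => [[|[|[|i]]]] // ? [[|[|[|j]]]] // ?; rewrite !permM.
have [w [w3 w0]] := omega_exists.
have := charon_slice Ncu (charon_root w3); apply: charon_ext => g _.
rewrite /dotf cardsT card_ord (eq_bigl predT) => [|i]; last by rewrite inE.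
rewrite !big_ord_recl big_ord0 /= !fix_cu /= rmorph1 !mulr1 addr0 expr1 -mulrDr -rmorphD.
have -> : w + w ^+ bump 0 1 = -1.
  by apply/eqP; rewrite -subr_eq0 opprK addrC addrA w0.
by rewrite rmorphN rmorph1 mulrN1 mulrC.
Qed.

End Powers.

Section VirtualCharacters.

Variables (gT : finGroupType) (G : {group gT}).

Definition vcharon (f : gT -> algC) : Prop :=
  exists2 phi : 'CF(G), phi \in 'Z[irr G] & {in G, f =1 phi}.

Lemma vcharon_charon f : charon G f -> vcharon f.
Proof. by case=> phi Nphi fE; exists phi => //; exact: char_vchar. Qed.

Lemma vcharon_ext f g : {in G, f =1 g} -> vcharon f -> vcharon g.
Proof. by move=> fg [phi Nphi fE]; exists phi => // x Gx; rewrite -fg // fE. Qed.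

Lemma vcharonB f g : vcharon f -> vcharon g -> vcharon (fun x => f x - g x).
Proof.
move=> [phi Nphi fE] [psi Npsi gE]; exists (phi - psi); first exact: rpredB.
by move=> x Gx; rewrite !cfunE fE // gE.
Qed.

Lemma vcharonD f g : vcharon f -> vcharon g -> vcharon (fun x => f x + g x).
Proof.
move=> [phi Nphi fE] [psi Npsi gE]; exists (phi + psi); first exact: rpredD.
by move=> x Gx; rewrite !cfunE fE // gE.
Qed.

Lemma vcharonM f g : vcharon f -> vcharon g -> vcharon (fun x => f x * g x).
Proof.
move=> [phi Nphi fE] [psi Npsi gE]; exists (phi * psi); first exact: rpredM.
by move=> x Gx; rewrite !cfunE fE // gE.
Qed.

Lemma vcharon_irr f : vcharon f -> dotf G f f = 1 -> 0 < f 1%g ->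
  exists i, {in G, f =1 'chi[G]_i}.
Proof.
case=> phi Nphi fE; rewrite (eq_dotf fE fE) dotfE fE // => n1 p1.
have [b [i phiE]] := vchar_norm1P Nphi n1; exists i => x Gx; rewrite fE // phiE.
move: p1; rewrite phiE cfunE; case: b {phiE}; rewrite ?expr1 ?expr0 ?scale1r // mulN1r.
by rewrite oppr_gt0 lt_gtF // irr1_gt0.
Qed.

(** Orthogonality makes the family injective into the irreducible characters, and the sum of squared
    degrees leaves no room for others. *)
Lemma dot_irr_basis (I : finType) (psi : I -> gT -> algC) f :
  (forall k, exists i, {in G, psi k =1 'chi[G]_i}) ->
  (forall k l, k != l -> dotf G (psi k) (psi l) = 0) ->
  \sum_k psi k 1%g ^+ 2 = #|G|%:R -> charon G f ->
  exists a : I -> nat, (forall k, (a k)%:R = dotf G f (psi k)) /\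
    {in G, forall g, f g = \sum_k (a k)%:R * psi k g}.
Proof.
move=> irrP orth sumd Nf; have [n [nE fE]] := charon_dec Nf.
have iP k : exists i, [forall x in G, psi k x == 'chi[G]_i x].
  by have [i ki] := irrP k; exists i; apply/forall_inP => x Gx; rewrite ki.
pose i k := xchoose (iP k).
have iE k : {in G, psi k =1 'chi_(i k)}.
  by move=> x Gx; have /forall_inP/(_ x Gx)/eqP := xchooseP (iP k).
have inj_i : injective i.
  move=> k l kl; apply/eqP; apply: contraTT isT => /orth/eqP.
  by rewrite (eq_dotf (iE k) (iE l)) dotfE kl cfnorm_irr oner_eq0.
pose D := [set i k | k : I].
have sumD (F : Iirr G -> algC) : \sum_(j in D) F j = \sum_k F (i k).
  rewrite /D big_imset /= => [|k l _ _]; last exact: inj_i.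
  by apply: eq_bigl => k.
have onto j : j \in D.
  apply: contraTT isT => nj; have : \sum_(l | l \notin D) 'chi[G]_l 1%g ^+ 2 = 0.
    apply: (addrI (\sum_(l in D) 'chi[G]_l 1%g ^+ 2)); rewrite addr0.
    transitivity (\sum_l 'chi[G]_l 1%g ^+ 2); first by rewrite [RHS](bigID (mem D)).
    by rewrite irr_sum_square sumD -sumd; apply: eq_bigr => k _; rewrite iE.
  move/eqP; rewrite psumr_eq0 => [/allP/(_ j (mem_index_enum j))/implyP/(_ nj)|l _].
    by rewrite expf_eq0 /= (negPf (irr1_neq0 j)).
  by rewrite exprn_ge0 // ltW // irr1_gt0.
exists (fun k => n (i k)); split=> [k|g Gg].
  by rewrite nE; apply: eq_dotf => // x Gx; rewrite iE.
rewrite fE //; have := sumD (fun j => (n j)%:R * 'chi_j g).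
rewrite (eq_bigl predT) => [->|j]; last by rewrite onto.
by apply: eq_bigr => k _; rewrite iE.
Qed.

End VirtualCharacters.

Section Enumeration.

Variable n : nat.
Implicit Types (g h : {perm 'I_n}) (l : seq nat).

Definition images g : seq nat := [seq val (g i) | i <- enum 'I_n].

Definition swapn (i m x : nat) : nat := if x == i then m else if x == m then i else x.

(* The permutations fixing all points from k on, as lists of images with a parity. *)
Fixpoint all_images (k : nat) : seq (seq nat * bool) :=
  if k is m.+1 then
    flatten [seq [seq (map (swapn i m) u.1, u.2 (+) (i != m)) | u <- all_images m]
            | i <- iota 0 m.+1]
  else [:: (iota 0 n, false)].

Lemma all_imagesS m : all_images m.+1 =
  flatten [seq [seq (map (swapn i m) u.1, u.2 (+) (i != m)) | u <- all_images m]
          | i <- iota 0 m.+1].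
Proof. by []. Qed.

Lemma images1 : images 1%g = iota 0 n.
Proof. by rewrite /images -val_enum_ord; apply: eq_map => i; rewrite perm1. Qed.

Lemma images_tperm g (i m : 'I_n) : images (g * tperm i m)%g = map (swapn i m) (images g).
Proof.
rewrite /images -map_comp; apply: eq_map => j; rewrite /= permM /swapn.
case: tpermP => [->|->|ni nm]; rewrite ?eqxx //; first by case: eqP => // /val_inj->.
by do 2![case: eqP => [/val_inj//|_]].
Qed.

(** Coset decomposition: the permutations sending the last point [M] to i are h * [tperm i M] with h
    fixing [M]. This lets sums over Sym(7) and Sym(5) be evaluated by computation on lists. *)
Lemma sum_images (F : seq nat -> bool -> algC) k : (k <= n)%N ->
  \sum_(g : {perm 'I_n} | perm_on [set i : 'I_n | (i < k)%N] g) F (images g) (odd_perm g) =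
  \sum_(u <- all_images k) F u.1 u.2.
Proof.
elim: k F => [|m IHm] F le.
  rewrite big_seq1 (big_pred1 1%g) ?images1 ?odd_perm1 // => g.
  apply/idP/eqP => [Sg|->]; last exact: perm_on1.
  by apply/permP=> x; rewrite perm1 (out_perm Sg) // inE.
pose M := Ordinal le; rewrite all_imagesS big_flatten big_map.
rewrite (partition_big (fun g => g M) (fun i : 'I_n => (i < m.+1)%N)); last first.
  by move=> g Sg; have := perm_closed M Sg; rewrite !inE /= ltnSn => ->.
pose G i := \sum_(u <- all_images m) F (map (swapn i m) u.1) (u.2 (+) (i != m)).
transitivity (\sum_(i < n | (i < m.+1)%N) G i); last first.
  rewrite -(big_ord_widen n G le) -(big_mkord xpredT G) /index_iota subn0.
  by apply: eq_bigr => i _; rewrite big_map.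
apply: eq_bigr => i lt; rewrite /G.
rewrite -(IHm (fun l b => F (map (swapn i m) l) (b (+) (i != m :> nat)))) 1?ltnW //.
rewrite (reindex_inj (mulIg (tperm i M))) /=; apply: eq_big => [g|g _]; last first.
  by rewrite images_tperm odd_permM odd_tperm -(inj_eq val_inj).
have St : perm_on [set j : 'I_n | (j < m.+1)%N] (tperm i M).
  by apply: perm_on_tperm; rewrite inE //= ltnSn.
apply/andP/idP => [[Sg /eqP gM]|Sg].
  have gM' : g M = M by apply: (@perm_inj _ (tperm i M)); rewrite -permM gM tpermR.
  have Sg' : perm_on [set j : 'I_n | (j < m.+1)%N] g.
    by rewrite -[g]mulg1 -(tperm2 i M) mulgA perm_onM.
  apply/subsetP=> x; rewrite inE => gx; have := subsetP Sg' x gx.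
  rewrite !inE ltnS leq_eqVlt => /orP[/eqP xm|//].
  have xM : x = M by apply: val_inj.
  by have /eqP[] : g x != x by []; rewrite xM.
have gM : g M = M by rewrite (out_perm Sg) // inE ltnn.
rewrite permM gM tpermR eqxx; split=> //; apply: perm_onM => //.
by apply: perm_onS Sg; apply/subsetP=> x; rewrite !inE => /ltnW.
Qed.

Definition nfix l : nat := count (fun i => nth 0%N l i == i) (iota 0 n).

Lemma nth_images g (i : 'I_n) : nth 0%N (images g) i = g i.
Proof. by rewrite (nth_map i) ?size_enum_ord // nth_ord_enum. Qed.

Lemma pfix_images g : pfix g = nfix (images g).
Proof.
rewrite /nfix /pfix cardE -val_enum_ord count_map -size_filter /=; congr (size _).
rewrite enumT; apply: eq_filter => i.
by rewrite [RHS]/= nth_images val_eqE; apply: (in_set (fun x => g x == x)).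
Qed.

Lemma images_mul g h : images (g * h)%g = map (nth 0%N (images h)) (images g).
Proof. by rewrite /images -map_comp; apply: eq_map => i; rewrite /= permM nth_images. Qed.

(** Numbers of fixed points of the first three powers and the parity; in degree seven these
    invariants separate the fifteen conjugacy classes. *)
Definition ctype (x : seq nat * bool) : nat * nat * nat * bool :=
  let l := x.1 in let l2 := map (nth 0%N l) l in
  (nfix l, nfix l2, nfix (map (nth 0%N l) l2), x.2).

Definition pctype g := ctype (images g, odd_perm g).

Lemma pctypeE g : pctype g = (pfix g, pfix (g ^+ 2)%g, pfix (g ^+ 3)%g, odd_perm g).
Proof. by rewrite /pctype /ctype /= !pfix_images (expgSr _ 2) (expgSr _ 1) expg1 !images_mul. Qed.

Lemma sum_tally (K : eqType) (s : seq K) (F : K -> algC) :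
  \sum_(x <- s) F x = \sum_(b <- tally s) b.2%:R * F b.1.
Proof.
rewrite -(perm_big _ (tallyK s)) /= big_flatten big_map.
by apply: eq_bigr => b _; rewrite big_nseq -Monoid.iteropE /= mulr_natl /iterop; elim: b.2 => // k IHk; rewrite mulrS; case: k IHk => [|k] IHk; rewrite ?addr0 //=.
Qed.

Lemma sum_ctype (F : nat * nat * nat * bool -> algC) :
  \sum_(g in [set: {perm 'I_n}]) F (pctype g) =
  \sum_(b <- tally (map ctype (all_images n))) b.2%:R * F b.1.
Proof.
rewrite -sum_tally big_map -(sum_images (fun l b => F (ctype (l, b))) (leqnn n)).
  apply: eq_bigl => g; rewrite inE; apply/esym/subsetP => x _; by rewrite inE ltn_ord.
Qed.

End Enumeration.

Definition table7 := Eval vm_compute in tally (map (ctype 7) (all_images 7 7)).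

Lemma table7E : tally (map (ctype 7) (all_images 7 7)) = table7.
Proof. by vm_compute. Qed.

Definition table5 := Eval vm_compute in tally (map (ctype 5) (all_images 5 5)).

Lemma table5E : tally (map (ctype 5) (all_images 5 5)) = table5.
Proof. by vm_compute. Qed.

Section Extension.

Variables (X Y : finType) (e : X -> Y).
Hypothesis eI : injective e.
Implicit Types (g h : {perm X}) (x : X) (y : Y).

Definition pextf g y : Y := if [pick x | e x == y] is Some x then e (g x) else y.

Lemma pextfE g x : pextf g (e x) = e (g x).
Proof.
by rewrite /pextf; case: pickP => [x' /eqP/eI->//|/(_ x)]; rewrite eqxx.
Qed.

Lemma pextf_out g y : y \notin codom e -> pextf g y = y.
Proof.
by rewrite /pextf; case: pickP => // x /eqP <-; rewrite codom_f.
Qed.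

Lemma pextf_inj g : injective (pextf g).
Proof.
move=> y z; case: (boolP (y \in codom e)) => [/codomP[x ->]|oy];
  case: (boolP (z \in codom e)) => [/codomP[x' ->]|oz]; rewrite ?pextfE ?pextf_out //.
- by move/eI/perm_inj->.
- by move=> zE; rewrite -zE codom_f in oz.
by move=> yE; rewrite yE codom_f in oy.
Qed.

Definition pext g : {perm Y} := perm (@pextf_inj g).

Lemma pextE g x : pext g (e x) = e (g x).
Proof. by rewrite permE pextfE. Qed.

Lemma pext_out g y : y \notin codom e -> pext g y = y.
Proof. by move=> oy; rewrite permE pextf_out. Qed.

Lemma pextM : {morph pext : g h / (g * h)%g}.
Proof.
move=> g h; apply/permP=> y; rewrite permM.
case: (boolP (y \in codom e)) => [/codomP[x ->]|oy]; first by rewrite !pextE permM.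
by rewrite !pext_out.
Qed.

Lemma pext1 : pext 1%g = 1%g.
Proof. by apply: (mulgI (pext 1%g)); rewrite -pextM !mulg1. Qed.

Lemma pext_tperm a b : pext (tperm a b) = tperm (e a) (e b).
Proof.
apply/permP=> y; case: (boolP (y \in codom e)) => [/codomP[x ->]|oy].
  rewrite pextE; case: tpermP => [->|->|/eqP na /eqP nb]; rewrite ?tpermL ?tpermR //.
  by rewrite tpermD // (inj_eq eI) eq_sym.
by rewrite pext_out // tpermD //; apply: contraNneq oy => <-; apply: codom_f.
Qed.

Lemma pext_cyc3 a b c : pext (cyc3 a b c) = cyc3 (e a) (e b) (e c).
Proof. by rewrite /cyc3 pextM !pext_tperm. Qed.

Lemma pext_odd g : pext g = odd_perm g :> bool.
Proof.
have [ts -> dts] := prod_tpermP g; elim: ts dts => [|[a b] ts IH] /=.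
  by rewrite big_nil pext1 !odd_perm1.
case/andP=> _ dts; rewrite big_cons pextM !odd_permM pext_tperm !odd_tperm IH //.
by rewrite (inj_eq eI).
Qed.

Lemma pext_on (A : {set X}) g : perm_on A g -> perm_on (e @: A) (pext g).
Proof.
move=> Ag; apply/subsetP=> y; case: (boolP (y \in codom e)) => [/codomP[x ->]|oy].
  rewrite inE pextE (inj_eq eI) => gx; apply: imset_f.
  by apply: contraR gx => nAx; rewrite (out_perm Ag).
by rewrite inE pext_out ?eqxx.
Qed.

Lemma pext_alt (A : {set X}) g : g \in altS A -> pext g \in altS (e @: A).
Proof. by rewrite !altSE pext_odd => /andP[Ag ->]; rewrite pext_on. Qed.

End Extension.

Lemma in_altT (T : finType) (g : {perm T}) : (g \in altS setT) = ~~ odd_perm g :> bool.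
Proof. by rewrite altSE; case: (odd_perm g); rewrite ?andbF // andbT; apply/subsetP => x; rewrite inE. Qed.

Section IndexTwo.

Variables (T : finType) (tau : {perm T}) (f : {perm T} -> algC).
Hypotheses (odt : odd_perm tau) (Nf : charon (altS setT) f).

(** The character induced from the alternating to the symmetric group. *)
Definition ind2 g : algC := if odd_perm g then 0 else f g + f (g ^ tau)%g.

Lemma ind2_char : charon [set: {perm T}]%G ind2.
Proof.
have fJ g x : ~~ odd_perm g -> ~~ odd_perm x -> f (g ^ x)%g = f g.
  by move=> eg ex; apply: (charonJ Nf); rewrite in_altT.
have fO g x : ~~ odd_perm g -> odd_perm x -> f (g ^ x)%g = f (g ^ tau)%g.
  move=> eg ox; have -> : (g ^ x = (g ^ tau) ^ (tau^-1 * x))%g by rewrite -conjgM mulKVg.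
  by rewrite fJ // ?odd_permJ // odd_permM odd_permV odt ox.
apply: charon_of_dot => [g x _ _|i].
  rewrite /ind2 odd_permJ; case: ifP => // /negbT eg.
  rewrite -conjgM; have [ox|ex] := boolP (odd_perm x).
    by rewrite (fO g x) // addrC (fJ g (x * tau)%g) // odd_permM ox odt.
  by rewrite (fJ g x) // (fO g (x * tau)%g) // odd_permM odt (negbTE ex).
have sAG : altS setT \subset [set: {perm T}] by apply: subsetT.
have Nchi : charon (altS setT) 'chi[[set: {perm T}]]_i.
  by apply: (charon_res sAG); apply: charon_irr.
have -> : dotf [set: {perm T}] ind2 'chi_i = dotf (altS setT) f 'chi_i; last exact: charon_nat.
have cardG : #|[set: {perm T}]| = (2 * #|altS [set: T]|)%N.
  rewrite -(cardsID (altS [set: T]) [set: {perm T}]) setTI -[X in (X + _)%N]mul1n -[X in (_ + X)%N]mul1n.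
  have -> : #|[set: {perm T}] :\: altS setT| = #|altS [set: T]|; last by rewrite -mulnDl.
  rewrite -(card_rcoset (altS setT) tau); apply: eq_card => g.
  by rewrite in_setD mem_rcoset in_setT andbT !in_altT odd_permM odd_permV odt; case: (odd_perm g).
rewrite /dotf cardG natrM invfM -mulrA mulrCA; congr (_ * _).
rewrite (bigID (mem (altS setT))) /= [X in _ + X]big1 ?addr0; last first.
  by move=> g /andP[_]; rewrite in_altT /ind2 negbK => ->; rewrite mul0r.
have -> : \sum_(g in [set: {perm T}] | g \in altS setT) ind2 g * ('chi_i g)^* =
          \sum_(g in altS setT) f g * ('chi_i g)^* + \sum_(g in altS setT) f (g ^ tau)%g * ('chi_i g)^*.
  rewrite -big_split /=; apply: eq_big => [g|g /andP[_]]; first by rewrite in_setT.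
  by rewrite in_altT /ind2 => /negbTE->; rewrite mulrDl.
have -> : \sum_(g in altS setT) f (g ^ tau)%g * ('chi_i g)^* = \sum_(g in altS setT) f g * ('chi_i g)^*.
  rewrite [RHS](reindex_inj (conjg_inj tau)); apply: eq_big => [g|g _].
    by rewrite !in_altT odd_permJ.
  by rewrite cfunJ ?in_setT.
have half (s : algC) : 2%:R^-1 * (s + s) = s by field.
exact: half.
Qed.

End IndexTwo.

(** With c1, c2, c3 as power sums, [h2], [e2], [h3], [e3], [w] are six times the symmetric and
    exterior powers and the shape (2,1). The list is six times the characters of the partitions (7),
    (6,1), (5,2), (5,1,1), (4,3), (4,2,1), (3,3,1), (4,1,1,1). The last is its own sign twist, so
    [irr7] twists only the first seven. *)
Definition irr7_base (R : comNzRingType) (c1 c2 c3 : R) : seq R :=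
  let h2 := 3%:R * (c1 * c1 + c2) in let w := 2%:R * (c1 * c1 * c1 - c3) in
  let e2 := 6%:R * c1 * c1 - h2 in
  let p1 := 6%:R * (c1 - 1) in let p2 := h2 - 12%:R * c1 in let p3 := e2 - 6%:R * c1 + 6%:R in
  let h3 := h2 * c1 - w in let e3 := e2 * c1 - w in
  let p4 := h3 - 6%:R * c1 * c1 - h2 + 6%:R * c1 in
  let p5 := w - p2 - p2 - p3 - p3 - 6%:R - p1 - p1 - p1 in
  [:: 6%:R; p1; p2; p3; p4; p5; c1 * p4 - p4 - p4 - p2 - p5; e3 - p3].

Lemma map_irr7 (c1 c2 c3 : int) :
  map (fun x : int => x%:~R : algC) (irr7_base c1 c2 c3) = irr7_base c1%:~R c2%:~R c3%:~R.
Proof. by rewrite /irr7_base /= !(rmorphB, rmorphD, rmorphM, rmorph_nat, rmorph1). Qed.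

(* Six times the values of the irreducible characters of the symmetric group of degree
   seven, as polynomials in the numbers of fixed points of the first three powers. *)
Definition irr7 (t : nat * nat * nat * bool) : seq int :=
  let: (c1, c2, c3, e) := t in let s := irr7_base c1%:Z c2%:Z c3%:Z in
  s ++ [seq (if e then - x else x) | x <- take 7 s].

Definition chi7 (k : 'I_15) (g : {perm 'I_7}) : algC := (nth 0 (irr7 (pctype g)) k)%:~R / 6%:R.

Lemma irr7_orth : all (fun k => all (fun l =>
  foldr +%R 0 [seq b.2%:Z * (nth 0 (irr7 b.1) k * nth 0 (irr7 b.1) l) | b <- table7] ==
   (if k == l then 36 * 5040 else 0)) (iota 0 15)) (iota 0 15).
Proof. by vm_compute. Qed.

Local Notation S7 := [set: {perm 'I_7}]%G.

Lemma chi7_dot k l : dotf S7 (chi7 k) (chi7 l) = (k == l)%:R.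
Proof.
have card7 : #|S7| = 5040 by rewrite cardsT card_Sn.
pose F t : algC := ((nth 0 (irr7 t) k * nth 0 (irr7 t) l)%:~R) / 36%:R.
rewrite /dotf card7 (eq_bigr (fun g => F (pctype g))); last first.
  move=> g _; rewrite /chi7 /F fmorph_div /= rmorph_int rmorph_nat rmorphM /=.
  by field.
rewrite sum_ctype table7E.
have -> : \sum_(b <- table7) b.2%:R * F b.1 =
    (foldr +%R 0 [seq b.2%:Z * (nth 0 (irr7 b.1) k * nth 0 (irr7 b.1) l) | b <- table7])%:~R / 36%:R.
  elim: table7 => [|b s IH]; first by rewrite big_nil mul0r.
  by rewrite big_cons IH /= /F rmorphD rmorphM /= mulrDl mulrA.
have /allP/(_ k) := irr7_orth; rewrite mem_iota ltn_ord => /(_ isT)/allP/(_ l).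
rewrite mem_iota ltn_ord => /(_ isT)/eqP->; rewrite -(inj_eq val_inj).
case: eqP => _; last by rewrite mul0r mulr0.
rewrite rmorphM /= [36%:~R]/(36%:R) [5040%:~R]/(5040%:R) [36%:R * _]mulrC mulfK ?pnatr_eq0 //.
by rewrite mulVf ?pnatr_eq0.
Qed.

(** Each entry is an integral polynomial in the permutation character, its symmetric square, its
    functor of shape (2,1) and the sign. Together with norm one and positive degree this gives
    irreducibility. *)
Lemma chi7_vchar k : vcharon S7 (chi7 k).
Proof.
pose X (g : {perm 'I_7}) : algC := (pfix g)%:R.
pose H (g : {perm 'I_7}) : algC := ((pfix g ^ 2)%:R + (pfix (g ^+ 2)%g)%:R) / 2%:R.
pose W (g : {perm 'I_7}) : algC := ((pfix g ^ 3)%:R - (pfix (g ^+ 3)%g)%:R) / 3%:R.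
have V1 : vcharon S7 (fun=> 1) by apply: vcharon_charon; apply: charon_1.
have VX : vcharon S7 X by apply: vcharon_charon; apply: charon_pfix.
have VH : vcharon S7 H by apply: vcharon_charon; apply: charon_sym2.
have VW : vcharon S7 W by apply: vcharon_charon; apply: charon_mixed3.
have Vs : vcharon S7 (fun g => (-1) ^+ odd_perm g).
  apply: vcharon_charon; apply: charon_lin; first by rewrite odd_perm1.
  by move=> x y _ _; rewrite odd_permM signr_addb.
have vB := vcharonB; have vD := vcharonD; have vM := vcharonM.
have := vB _ _ _ _ VX V1; set v1 := fun x => _ => W1.
have := vB _ _ _ _ VH (vD _ _ _ _ VX VX); set v2 := fun x => _ => W2.
have := vB _ _ _ _ (vM _ _ _ _ VX VX) VH; set e2 := fun x => _ => We2.
have := vB _ _ _ _ We2 W1; set v3 := fun x => _ => W3.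
have := vB _ _ _ _ (vM _ _ _ _ VH VX) VW; set h3 := fun x => _ => Wh3.
have := vB _ _ _ _ (vM _ _ _ _ We2 VX) VW; set e3 := fun x => _ => We3.
have := vB _ _ _ _ (vD _ _ _ _ Wh3 VX) (vD _ _ _ _ (vM _ _ _ _ VX VX) VH); set v4 := fun x => _ => W4.
have := vB _ _ _ _ VW (vD _ _ _ _ (vD _ _ _ _ (vD _ _ _ _ W2 W2) (vD _ _ _ _ W3 W3))
  (vD _ _ _ _ V1 (vD _ _ _ _ W1 (vD _ _ _ _ W1 W1)))); set v5 := fun x => _ => W5.
have := vB _ _ _ _ (vM _ _ _ _ VX W4) (vD _ _ _ _ (vD _ _ _ _ W4 W4) (vD _ _ _ _ W2 W5)).
set v6 := fun x => _ => W6.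
have := vB _ _ _ _ We3 W3; set v7 := fun x => _ => W7.
have S v : vcharon S7 v -> vcharon S7 (fun g => (-1) ^+ odd_perm g * v g) by apply: vM.
pose b7 g := irr7_base (X g) (pfix (g ^+ 2)%g)%:R (pfix (g ^+ 3)%g)%:R.
have base k' : (k' < 8)%N -> vcharon S7 (fun g => nth 0 (b7 g) k' / 6%:R).
  have ext v : vcharon S7 v -> (forall g, v g = nth 0 (b7 g) k' / 6%:R) ->
      vcharon S7 (fun g => nth 0 (b7 g) k' / 6%:R).
    by move=> Vv vE; apply: vcharon_ext Vv => g _; apply: vE.
  case: k' ext => [|[|[|[|[|[|[|[|k']]]]]]]] //= ext _.
  - by apply: (ext _ V1) => g; field.
  - by apply: (ext _ W1) => g; rewrite /v1; field.
  - by apply: (ext _ W2) => g; rewrite /v2 /H !natrX -/(X g); move: (X g) (pfix _)%:R => x y; field.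
  - by apply: (ext _ W3) => g; rewrite /v3 /v1 /e2 /H !natrX -/(X g); move: (X g) (pfix _)%:R => x y; field.
  - by apply: (ext _ W4) => g; rewrite /v4 /h3 /W /H !natrX -/(X g); move: (X g) (pfix _)%:R (pfix _)%:R => x y z; field.
  - by apply: (ext _ W5) => g; rewrite /v5 /v3 /v2 /v1 /e2 /W /H !natrX -/(X g); move: (X g) (pfix _)%:R (pfix _)%:R => x y z; field.
  - by apply: (ext _ W6) => g; rewrite /v6 /v5 /v4 /h3 /v3 /v2 /v1 /e2 /W /H !natrX -/(X g); move: (X g) (pfix _)%:R (pfix _)%:R => x y z; field.
  - by apply: (ext _ W7) => g; rewrite /v7 /e3 /v3 /v1 /e2 /W /H !natrX -/(X g); move: (X g) (pfix _)%:R (pfix _)%:R => x y z; field.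
have irrE g : chi7 k g = if (k < 8)%N then nth 0 (b7 g) k / 6%:R
    else (-1) ^+ odd_perm g * (nth 0 (b7 g) (k - 8) / 6%:R).
  have toZ (m : nat) : m%:R = (m%:Z)%:~R :> algC by [].
  rewrite /chi7 /irr7 pctypeE nth_cat /b7 /X !(toZ (pfix _)) -map_irr7.
  case: ltnP => le8; first by rewrite (nth_map 0).
  have lt7 : (k - 8 < 7)%N by have := ltn_ord k; lia.
  rewrite (nth_map 0) ?size_takel // nth_take // (nth_map 0); last exact: ltn_trans lt7 _.
  by case: (odd_perm g); rewrite ?rmorphN ?mulN1r ?mul1r ?mulNr.
case: (ltnP k 8) => k8; first by apply: vcharon_ext (base k k8) => g _; rewrite irrE k8.
apply: vcharon_ext (S _ (base (k - 8)%N _)) => [g _|]; first by rewrite irrE ltnNge k8.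
by have := ltn_ord k; lia.
Qed.

Lemma chi7_dec f : charon S7 f -> exists2 a : nat -> nat, (forall k : 'I_15, (a k)%:R = dotf S7 f (chi7 k)) &
  forall g, 6%:R * f g = (\sum_(k < 15) (a k)%:Z * nth 0 (irr7 (pctype g)) k)%:~R.
Proof.
move=> Nf; have t1 : pctype (1%g : {perm 'I_7}) = (7, 7, 7, false).
  by rewrite /pctype images1 odd_perm1.
have irr k : exists i, {in S7, chi7 k =1 'chi[S7]_i}.
  apply: vcharon_irr; [exact: chi7_vchar | by rewrite chi7_dot eqxx |].
  rewrite /chi7 t1 divr_gt0 ?ltr0n // ltr0z.
  have /allP/(_ (val k)) : all (fun j => 0 < nth 0 (irr7 (7, 7, 7, false)) j) (iota 0 15) by vm_compute.
  by rewrite mem_iota ltn_ord; apply.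
have orth k l : k != l -> dotf S7 (chi7 k) (chi7 l) = 0 by move=> /negbTE kl; rewrite chi7_dot kl.
have degs : \sum_k chi7 k 1%g ^+ 2 = #|S7|%:R.
  have -> : #|S7|%:R = 36%:R^-1 * (36 * 7`!)%:R :> algC.
    by rewrite cardsT card_Sn natrM mulKf ?pnatr_eq0.
  have <- : (foldr +%R 0 [seq nth 0 (irr7 (7, 7, 7, false)) k ^+ 2 | k <- iota 0 15] : int)%:~R
      = (36 * 7`!)%:R :> algC.
    have /eqP-> : (foldr +%R 0 [seq nth 0 (irr7 (7, 7, 7, false)) k ^+ 2 | k <- iota 0 15] : int)
      == (36 * 7`!)%N by vm_compute.
    by [].
  rewrite foldrE big_map -[iota 0 15]/(index_iota 0 15) big_mkord rmorph_sum mulr_sumr.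
  by apply: eq_bigr => k _; rewrite /chi7 t1 rmorphXn /=; field.
have [a [aE fE]] := dot_irr_basis irr orth degs Nf.
exists (fun k => if insub k is Some i then a i else 0%N) => [k|g]; first by rewrite valK.
rewrite fE ?in_setT // mulr_sumr rmorph_sum; apply: eq_bigr => k _ /=.
by rewrite valK rmorphM /= /chi7; field.
Qed.

Local Notation word := (foldr (fun u l => map (swapn u.1 u.2) l) (iota 0 7)).

Lemma pctype_tperm (w : seq ('I_7 * 'I_7)) :
  pctype (\prod_(u <- rev w) tperm u.1 u.2)%g =
  ctype 7 (word [seq (val u.1, val u.2) | u <- w], odd (count (fun u => u.1 != u.2) w)).
Proof.
rewrite /pctype; congr (ctype 7 (_, _)).
  elim: w => [|u w IH] /=; first by rewrite big_nil images1.
  by rewrite rev_cons -cats1 big_cat big_seq1 images_tperm IH.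
elim: w => [|u w IH] /=; first by rewrite big_nil odd_perm1.
by rewrite rev_cons -cats1 big_cat big_seq1 odd_permM IH odd_tperm addbC oddD oddb.
Qed.

Section Values.

Variables (f : {perm 'I_7} -> algC) (a : nat -> nat).
Hypothesis fE : forall g, 6%:R * f g = (\sum_(k < 15) (a k)%:Z * nth 0 (irr7 (pctype g)) k)%:~R.

Lemma chi7_value (w : seq ('I_7 * 'I_7)) t (r : seq int) :
  ctype 7 (word [seq (val u.1, val u.2) | u <- w], odd (count (fun u => u.1 != u.2) w)) = t ->
  irr7 t = map (fun x => 6 * x) r ->
  f (\prod_(u <- rev w) tperm u.1 u.2)%g = (\sum_(k < 15) (a k)%:Z * nth 0 r k)%:~R.
Proof.
move=> tE rE; apply: (@mulfI _ 6%:R); rewrite ?pnatr_eq0 // fE pctype_tperm tE rE.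
transitivity ((6 * \sum_(k < 15) (a k)%:Z * nth 0 r k)%:~R : algC); last by rewrite rmorphM.
rewrite mulr_sumr; congr (intr _); apply: eq_bigr => k _.
rewrite mulrCA; congr (_ * _); have [lt|le] := ltnP k (size r); first by rewrite (nth_map 0).
by rewrite !nth_default ?size_map ?mulr0.
Qed.

Local Notation o i := (Ordinal (isT : i < 7)%N).
Local Notation row := (fun s : seq int => (\sum_(k < 15) (a k)%:Z * nth 0 s k)%:~R).

(** Columns of the character table at the cycle types 1, 2, 2^2, 3, and then 3^2, 4, 4.2. *)
Lemma values7 :
  [/\ f 1%g = row [:: 1; 6; 14; 15; 14; 35; 21; 20; 1; 6; 14; 15; 14; 35; 21],
      f (tperm (o 0%N) (o 1%N)) = row [:: 1; 4; 6; 5; 4; 5; 1; 0; (-1); (-4); (-6); (-5); (-4); (-5); (-1)],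
      f (dtr (o 0%N) (o 1%N) (o 2%N) (o 3%N)) = row [:: 1; 2; 2; (-1); 2; (-1); 1; (-4); 1; 2; 2; (-1); 2; (-1); 1],
      f (cyc3 (o 0%N) (o 1%N) (o 2%N)) = row [:: 1; 3; 2; 3; (-1); (-1); (-3); 2; 1; 3; 2; 3; (-1); (-1); (-3)] &
      [/\ f (cyc3 (o 0%N) (o 1%N) (o 2%N) * cyc3 (o 3%N) (o 4%N) (o 5%N))%g = row [:: 1; 0; (-1); 0; 2; (-1); 0; 2; 1; 0; (-1); 0; 2; (-1); 0],
      f (tperm (o 0%N) (o 1%N) * (tperm (o 0%N) (o 2%N) * tperm (o 0%N) (o 3%N)))%g = row [:: 1; 2; 0; 1; (-2); (-1); (-1); 0; (-1); (-2); 0; (-1); 2; 1; 1] &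
      f (tperm (o 0%N) (o 1%N) * (tperm (o 0%N) (o 2%N) * (tperm (o 0%N) (o 3%N) * tperm (o 4%N) (o 5%N))))%g
        = row [:: 1; 0; 0; (-1); 0; 1; (-1); 0; 1; 0; 0; (-1); 0; 1; (-1)]]].
Proof.
have v w t r g (gE : (\prod_(u <- rev w) tperm u.1 u.2)%g = g) :
    ctype 7 (word [seq (val u.1, val u.2) | u <- w], odd (count (fun u => u.1 != u.2) w)) = t ->
    irr7 t = map (fun x => 6 * x) r -> f g = row r.
  by move=> tE rE; rewrite -gE; apply: chi7_value tE rE.
split; last split.
- by apply: (v [::] (7, 7, 7, false)) => //; rewrite ?big_nil //; apply/eqP; vm_compute.
- by apply: (v [:: (o 0%N, o 1%N)] (5, 7, 5, true)); rewrite ?unlock /= ?mulg1 //; apply/eqP; vm_compute.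
- by apply: (v [:: (o 2%N, o 3%N); (o 0%N, o 1%N)] (3, 7, 3, false)); rewrite ?unlock /= ?mulg1 //; apply/eqP; vm_compute.
- by apply: (v [:: (o 0%N, o 2%N); (o 0%N, o 1%N)] (4, 4, 7, false)); rewrite ?unlock /= ?mulg1 //; apply/eqP; vm_compute.
- by apply: (v [:: (o 3%N, o 5%N); (o 3%N, o 4%N); (o 0%N, o 2%N); (o 0%N, o 1%N)] (1, 1, 7, false)); rewrite ?unlock /= ?mulg1 ?mulgA //; apply/eqP; vm_compute.
- by apply: (v [:: (o 0%N, o 3%N); (o 0%N, o 2%N); (o 0%N, o 1%N)] (3, 3, 3, true)); rewrite ?unlock /= ?mulg1 //; apply/eqP; vm_compute.
- by apply: (v [:: (o 4%N, o 5%N); (o 0%N, o 3%N); (o 0%N, o 2%N); (o 0%N, o 1%N)] (1, 3, 1, false)); rewrite ?unlock /= ?mulg1 //; apply/eqP; vm_compute.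
Qed.

End Values.

Lemma sfix_cyc3 (T : finType) (S : {set T}) a b c : uniq [:: a; b; c] ->
  {subset [:: a; b; c] <= S} -> (sfix S (cyc3 a b c) + 3 = #|S|)%N.
Proof.
move=> u3 s3; rewrite -(cardsID [set x in [:: a; b; c]] S) addnC; congr (_ + _)%N.
  rewrite -[LHS](card_uniqP u3); apply: eq_card => x; rewrite !inE andbC.
  by have := s3 x; rewrite !inE; case: (x == a) => [->|] //; case: (x == b) => [->|] //; case: (x == c) => [->|].
apply: eq_card => x; rewrite 2!in_set; case: (boolP (x \in [:: a; b; c])) => [|nx]; last first.
  by rewrite [in RHS]in_set (negbTE nx) cyc3_D // eqxx andbT.
have [/negbTE ab /negbTE ac /negbTE bc] := uniq3 u3.
rewrite [in RHS]in_set => xs; rewrite xs /=; apply/negbTE; rewrite negb_and; apply/orP; right.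
move: xs; rewrite !in_cons in_nil orbF => /or3P[]/eqP->.
- by rewrite cyc3_1 // eq_sym ab.
- by rewrite cyc3_2 // eq_sym bc.
by rewrite cyc3_3 // ac.
Qed.

Section SmallOdd.

Local Notation o i := (Ordinal (isT : i < 7)%N).

Lemma ind2E (T : finType) (tau : {perm T}) f g : ~~ odd_perm g ->
  ind2 tau f g = f g + f (g ^ tau)%g.
Proof. by rewrite /ind2 => /negbTE->. Qed.

Lemma ind2_odd (T : finType) (tau : {perm T}) f g : odd_perm g -> ind2 tau f g = 0.
Proof. by rewrite /ind2 => ->. Qed.

Lemma intr_nat (x : int) (n : nat) : x%:~R = n%:R :> algC -> x = n%:Z.
Proof. by move/eqP; rewrite -[n%:R]/(n%:Z%:~R) eqr_int => /eqP. Qed.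

(** Inducing to Sym(7) doubles both the degree and [zval]. The induced character has degree at most
    18 and vanishes at transpositions and 4-cycles; these are linear conditions on fifteen
    nonnegative multiplicities, and they force [zval] to vanish. *)
Lemma alt7_zval (f : {perm 'I_7} -> algC) (a b c d e k : 'I_7) :
  charon (altS setT) f -> f 1%g <= 9%:R ->
  uniq [:: a; b; c; d; e; k] -> zval f a b c d e k = 0.
Proof.
move=> Nf f9 u6; have sT (s : seq 'I_7) : {subset s <= [set: 'I_7]} by move=> x _; rewrite inE.
pose o0 := o 0%N; pose o1 := o 1%N; pose o2 := o 2%N; pose o3 := o 3%N.
pose o4 := o 4%N; pose o5 := o 5%N; pose o6 := o 6%N.
have u5 : uniq [:: o0; o1; o2; o3; o4; o5] by [].
rewrite (zval_const Nf u6 u5) //.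
have odt : odd_perm (tperm o5 o6) by rewrite odd_tperm.
have NF := ind2_char odt Nf; have [n _ FE] := chi7_dec NF.
set F := ind2 _ f in NF FE.
have ec (i j l : 'I_7) : i != j -> i != l -> ~~ odd_perm (cyc3 i j l).
  by move=> ij il; rewrite odd_permM !odd_tperm ij il.
have ecc : ~~ odd_perm (cyc3 o0 o1 o2 * cyc3 o3 o4 o5)%g.
  by rewrite (odd_permM (cyc3 o0 o1 o2)) !(negbTE (ec _ _ _ _ _)).
have zF : zval F o0 o1 o2 o3 o4 o5 = 2%:R * zval f o0 o1 o2 o3 o4 o5.
  have u' : uniq [:: o0; o1; o2; o3; o4; o6] by [].
  transitivity (zval f o0 o1 o2 o3 o4 o5 + zval f o0 o1 o2 o3 o4 o6); last first.
    by rewrite (zval_const Nf u' u5) //; ring.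
  have D i : i != o5 -> i != o6 -> tperm o5 o6 i = i by move=> i5 i6; rewrite tpermD // eq_sym.
  rewrite /zval /F (ind2E _ _ ecc) (ind2E _ _ (ec o0 o1 o2 isT isT)) ind2E ?odd_perm1 //.
  by rewrite conj1g (conjMg (cyc3 o0 o1 o2)) !cyc3J tpermL !D //; ring.
have /natrP[D fD] := charon1_nat Nf.
have F1 : F 1%g = (2 * D)%:R.
  by rewrite /F ind2E ?odd_perm1 // conj1g fD natrM; ring.
have [v1 v2 _ v3 [v33 v4 _]] := values7 FE.
have F2 : F (tperm o0 o1) = 0 by rewrite /F ind2_odd // odd_tperm.
have F4 : F (tperm o0 o1 * (tperm o0 o2 * tperm o0 o3))%g = 0.
  by rewrite /F ind2_odd // !odd_permM !odd_tperm.
apply: (@mulfI _ 2%:R); rewrite ?pnatr_eq0 // mulr0 -zF /zval v1 v3 v33.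
have D9 : (D <= 9)%N by rewrite -(ler_nat algC) -fD.
have E1 := intr_nat (etrans (esym v1) F1).
have E2 := intr_nat (n := 0) (etrans (esym v2) F2).
have E4 := intr_nat (n := 0) (etrans (esym v4) F4).
rewrite -[2%:R]/(2%:~R) -rmorphM -rmorphB -rmorphD /= -[RHS]/(0%:~R); congr intr.
clear -E1 E2 E4 D9; move: E1 E2 E4; rewrite !big_ord_recl !big_ord0 /= /bump /=; lia.
Qed.

(** Degree 9 forces the form A + B (fixed points - 1). Then A + 6B = 9 and A + 3B = 0 with A, B
    natural. *)
Lemma no_alt7 (f : {perm 'I_7} -> algC) : charon (altS setT) f -> f 1%g = 9%:R ->
  (forall a b c, uniq [:: a; b; c] -> f (cyc3 a b c) = 0) -> False.
Proof.
move=> Nf f9 fc; have sT (s : seq 'I_7) : {subset s <= [set: 'I_7]} by move=> x _; rewrite inE.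
have u5 : uniq [:: o 0%N; o 1%N; o 2%N; o 3%N; o 4%N; o 5%N] by [].
have le9 : f 1%g <= 9%:R by rewrite f9.
have [A [B fE]] := nonstar_form u5 (sT _) Nf (alt7_zval Nf le9 u5).
have u3 : uniq [:: o 0%N; o 1%N; o 2%N] by [].
have := fE 1%g (group1 _); rewrite f9 sfix1 cardsT card_ord.
have := fE _ (cyc3_alt u3 (sT _)); rewrite fc //.
have -> : sfix setT (cyc3 (o 0%N) (o 1%N) (o 2%N)) = 4.
  by apply: (@addIn 3); rewrite sfix_cyc3 // cardsT card_ord.
move=> E0 E9; have AB0 : (A + 3 * B = 0)%N.
  by apply/eqP; rewrite -(eqr_nat algC) natrD natrM mulr0n E0; apply/eqP; ring.
have /eqP := E9; have -> : A%:R + B%:R * (7%:R - 1) = (A + 6 * B)%:R :> algC by rewrite natrD natrM; ring.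
by rewrite eqr_nat => /eqP; lia.
Qed.

(** Sym(7) embeds in Alt(9) through [h], which multiplies odd permutations by the transposition of
    the two extra points. Two pairs of classes of Sym(7) fuse in Alt(9): the types 2 with 2^2, and 4
    with 4.2. With the degree and the two zeros this gives five equations without solution in
    natural multiplicities. *)
Lemma no_alt9 (f : {perm 'I_9} -> algC) : charon (altS setT) f -> f 1%g = 81%:R ->
  (forall a b c, uniq [:: a; b; c] -> f (cyc3 a b c) = 0) ->
  (forall a b c d e k, uniq [:: a; b; c; d; e; k] -> f (cyc3 a b c * cyc3 d e k)%g = 0) -> False.
Proof.
move=> Nf f81 fc fcc; have sT (s : seq 'I_9) : {subset s <= [set: 'I_9]} by move=> x _; rewrite inE.
pose e := widen_ord (isT : 7 <= 9)%N; have eI : injective e by move=> x y /(congr1 val)/= /val_inj.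
pose u : 'I_9 := Ordinal (isT : 7 < 9)%N; pose v : 'I_9 := Ordinal (isT : 8 < 9)%N.
have eC g : commute (tperm u v) (pext eI g).
  apply/commgP/conjg_fixP; rewrite tpermJ !pext_out //; apply/codomP=> -[x /(congr1 val)/= E].
    by have := ltn_ord x; rewrite -E.
  by have := ltn_ord x; rewrite -E.
pose h (g : {perm 'I_7}) : {perm 'I_9} := (pext eI g * tperm u v ^+ odd_perm g)%g.
have hM : {in [set: {perm 'I_7}] &, {morph h : x y / x * y}%g}.
  move=> x y _ _; rewrite /h pextM odd_permM -!mulgA; congr (_ * _)%g.
  rewrite mulgA -(commuteX (odd_perm x) (commute_sym (eC y))).
  rewrite -!mulgA; congr (_ * _)%g; rewrite -expgD.
  by case: (odd_perm x); case: (odd_perm y); rewrite ?addn0 // (expgS _ 1) expg1 tperm2.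
have hA : {in [set: {perm 'I_7}], forall x, h x \in altS setT}.
  move=> x _; rewrite in_altT odd_permM pext_odd.
  by case: (odd_perm x); rewrite ?odd_perm1 ?odd_tperm.
have [n _ FE] := chi7_dec (charon_morph hM hA Nf).
have [v1 v2 v22 v3 [v33 v4 v42]] := values7 FE.
have hE (g : {perm 'I_7}) : ~~ odd_perm g -> h g = pext eI g by rewrite /h => /negbTE->; rewrite mulg1.
have hO (g : {perm 'I_7}) : odd_perm g -> h g = (pext eI g * tperm u v)%g by rewrite /h => ->.
have ec (i j l : 'I_7) : i != j -> i != l -> ~~ odd_perm (cyc3 i j l).
  by move=> ij il; rewrite odd_permM !odd_tperm ij il.
have E1 : f (h 1%g) = 81%:R by rewrite hE ?odd_perm1 // pext1.
have E3 : f (h (cyc3 (o 0%N) (o 1%N) (o 2%N))) = 0%:R.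
  by rewrite hE ?ec // pext_cyc3 fc.
have E33 : f (h (cyc3 (o 0%N) (o 1%N) (o 2%N) * cyc3 (o 3%N) (o 4%N) (o 5%N))%g) = 0%:R.
  rewrite hE; first by rewrite pextM !pext_cyc3 fcc.
  by rewrite (odd_permM (cyc3 _ _ _)) !(negbTE (ec _ _ _ _ _)).
have E2 : f (h (tperm (o 0%N) (o 1%N))) = f (h (dtr (o 0%N) (o 1%N) (o 2%N) (o 3%N))).
  rewrite hO ?odd_tperm // hE; last by rewrite odd_permM !odd_tperm.
  rewrite pextM !pext_tperm.
  by apply: (const_dtr Nf (a := e (o 0%N)) (b := e (o 1%N)) (c := u) (d := v)).
have E4 : f (h (tperm (o 0%N) (o 1%N) * (tperm (o 0%N) (o 2%N) * tperm (o 0%N) (o 3%N)))%g) =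
  f (h (tperm (o 0%N) (o 1%N) * (tperm (o 0%N) (o 2%N) * (tperm (o 0%N) (o 3%N) * tperm (o 4%N) (o 5%N))))%g).
  rewrite hO; last by rewrite !odd_permM !odd_tperm.
  rewrite hE; last by rewrite !odd_permM !odd_tperm.
  rewrite !pextM !pext_tperm.
  have [||||||x Sx] := @alt_to _ setT [:: e (o 0%N); e (o 1%N); e (o 2%N); e (o 3%N); u; v]
    [:: e (o 0%N); e (o 1%N); e (o 2%N); e (o 3%N); e (o 4%N); e (o 5%N)] => //.
    by rewrite cardsT card_ord.
  case=> x0 x1 x2 x3 x4 x5.
  have Aw : (tperm (e (o 0%N)) (e (o 1%N)) * (tperm (e (o 0%N)) (e (o 2%N)) *
      tperm (e (o 0%N)) (e (o 3%N))) * tperm u v)%g \in altS setT.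
    have := hA (tperm (o 0%N) (o 1%N) * (tperm (o 0%N) (o 2%N) * tperm (o 0%N) (o 3%N)))%g (in_setT _).
    rewrite hO; last by rewrite !odd_permM !odd_tperm.
    by rewrite !pextM !pext_tperm.
  by rewrite -(charonJ Nf Aw Sx) !conjMg !tpermJ x0 x1 x2 x3 x4 x5 !mulgA.
have I1 := intr_nat (etrans (esym v1) E1).
have I3 := intr_nat (etrans (esym v3) E3).
have I33 := intr_nat (etrans (esym v33) E33).
have I2 : _ = _ :> int := @intr_inj algC _ _ (etrans (esym v2) (etrans E2 v22)).
have I4 : _ = _ :> int := @intr_inj algC _ _ (etrans (esym v4) (etrans E4 v42)).
clear -I1 I3 I33 I2 I4; move: I1 I3 I33 I2 I4.
rewrite !big_ord_recl !big_ord0 /= /bump /=.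
lia.
Qed.

End SmallOdd.

(** * Restriction to a cyclic group of order p *)

Section Translations.

Variables (p : nat) (w : algC).
Hypotheses (pr : prime p) (pw : p.-primitive_root w) (p2 : odd p).
Implicit Types (a b j s : 'F_p) (f : {perm 'F_p} -> algC).

Definition tr a : {perm 'F_p} := perm (@addrI _ a).

Lemma trE a y : tr a y = a + y. Proof. by rewrite permE. Qed.

Lemma trD a b : tr (a + b) = (tr a * tr b)%g.
Proof. by apply/permP=> y; rewrite permM !trE addrCA addrA. Qed.

Lemma two_neq0 : (2%:R : 'F_p) != 0.
Proof.
rewrite -(dvdn_pcharf (pchar_Fp pr)); apply/negP=> /(dvdn_leq (ltn0Sn 1)) le.
by move: le p2 (prime_gt1 pr); case: (p) => [|[|[|?]]].
Qed.

(** Halving a writes the translation as a square. *)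
Lemma tr_alt a : tr a \in altS setT.
Proof.
have {1}-> : a = a / 2%:R + a / 2%:R by rewrite -mulr2n -[_ *+ 2]mulr_natr divfK ?two_neq0.
by rewrite in_altT trD odd_permM addbb.
Qed.

Lemma tr0 : tr 0 = 1%g. Proof. by apply/permP=> y; rewrite trE add0r perm1. Qed.

Definition dil s (s0 : s != 0) : {perm 'F_p} := perm (mulfI s0).

Lemma tr_dil s (s0 : s != 0) a : (tr a ^ dil s0)%g = tr (s * a).
Proof.
have dE y : dil s0 y = s * y by rewrite permE.
apply/permP=> y; rewrite -{1}[y](permKV (dil s0)) permJ trE dE mulrDr -dE.
by rewrite -dE permKV trE dE.
Qed.

(** A dilation may be odd, but its square is even; hence only multiplication by squares is
    available. *)
Lemma tr_square f a s : charon (altS setT) f -> s != 0 -> f (tr (s * (s * a))) = f (tr a).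
Proof.
move=> Nf s0; rewrite -!(tr_dil s0) -conjgM (charonJ Nf) ?tr_alt //.
by rewrite in_altT odd_permM addbb.
Qed.

Lemma cent_tr a g : a != 0 -> commute g (tr a) -> g = tr (g 0).
Proof.
move=> a0 ga; have gk (k : nat) : g (a *+ k) = a *+ k + g 0.
  elim: k => [|k IH]; first by rewrite add0r.
  by rewrite mulrS -[X in g X]trE -permM -ga permM trE IH addrA.
apply/permP=> y; rewrite trE addrC.
have yE : y = a *+ (y / a : 'F_p) by rewrite -[_ *+ _]mulr_natr natr_Zp mulrCA divff ?mulr1.
by rewrite [in LHS]yE gk -yE addrC.
Qed.

Lemma card_cent_tr a : a != 0 -> #|'C_(altS setT)[tr a]| = p.
Proof.
move=> a0; have -> : 'C_(altS setT)[tr a] = tr @: 'F_p.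
  apply/setP=> g; apply/setIP/imsetP => [[_ /cent1P ga]|[b _ ->]].
    by exists (g 0) => //; exact: (cent_tr a0).
  split; first exact: tr_alt.
  by apply/cent1P; rewrite /commute -!trD addrC.
rewrite card_imset ?card_Fp // => b c /(congr1 (fun g : {perm 'F_p} => g 0)).
by rewrite !trE !addr0.
Qed.

Definition ew a : algC := w ^+ (a : nat).

Lemma ewD a b : ew (a + b) = ew a * ew b.
Proof. by rewrite /ew /= -exprD [X in (_ %% X)%N](Fp_cast pr) (prim_expr_mod pw). Qed.

Lemma ew0 : ew 0 = 1. Proof. by []. Qed.

Lemma ewV a : ew (- a) = (ew a)^*.
Proof.
have n1 : `|ew a| = 1.
  apply: (@pexpIrn _ p); rewrite ?nnegrE ?prime_gt0 //.
  by rewrite -normrX /ew exprAC (prim_expr_order pw) expr1n normr1 expr1n.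
have e0 : ew a != 0 by rewrite -normr_eq0 n1 oner_eq0.
by apply: (mulfI e0); rewrite -ewD subrr ew0 -normCK n1 expr1n.
Qed.

Lemma sum_ew a : \sum_j ew (j * a) = p%:R * (a == 0)%:R.
Proof.
have [->|a0] := eqVneq a 0.
  under eq_bigr do rewrite mulr0 ew0.
  by rewrite sumr_const card_Fp // mulr1.
rewrite mulr0 (reindex_inj (mulIf (invr_neq0 a0))) /=.
under eq_bigr do rewrite divfK //.
apply: (@mulfI _ (ew 1 - 1)).
  rewrite subr_eq0 /ew -(prim_order_dvd pw) /= modn_small ?dvdn1; last by rewrite ?Fp_cast ?prime_gt1.
  by rewrite neq_ltn prime_gt1 ?orbT.
rewrite mulr0 mulrBl mul1r mulr_sumr; apply/eqP; rewrite subr_eq0; apply/eqP.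
rewrite [RHS](reindex_inj (addrI 1)) /=.
by apply: eq_bigr => j _; rewrite ewD.
Qed.

(** The multiplicity of the additive character with index j in the restriction to the translations,
    that is, a Fourier coefficient. *)
Definition dl f j : algC := dotf [set: 'F_p] (fun a => f (tr a)) (fun a => ew (j * a)).

Lemma dl_nat f j : charon (altS setT) f -> dl f j \in Num.nat.
Proof.
move=> Nf; apply: charon_nat.
  apply: (charon_morph (G := [group of altS setT]) (h := tr)) Nf; last by move=> a _; apply: tr_alt.
  by move=> a b _ _; rewrite -trD.
apply: charon_lin; first by rewrite mulr0 ew0.
by move=> a b _ _; rewrite mulrDr ewD.
Qed.

Lemma dlE f a : f (tr a) = \sum_j dl f j * ew (j * a).
Proof.
under eq_bigr => j _ do rewrite /dl /dotf -mulrA mulr_suml.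
rewrite -mulr_sumr exchange_big /= cardsT card_Fp //.
rewrite (bigD1 a) ?inE //= [X in _ * (_ + X)]big1 ?addr0 => [|b /andP[_ ba]].
  under eq_bigr => j _ do rewrite -mulrA -ewV -ewD addNr ew0 mulr1.
  rewrite sumr_const card_Fp // -[f (tr a) *+ _]mulr_natl mulKf // pnatr_eq0 -lt0n prime_gt0 //.
under eq_bigr => j _ do rewrite -mulrA -ewV -ewD -mulrN -mulrDr.
rewrite -mulr_sumr sum_ew [- b + a]addrC subr_eq0 eq_sym (negbTE ba) mulr0 mulr0 //.
Qed.

Lemma dl_parseval f : p%:R * \sum_j `|dl f j| ^+ 2 = \sum_a `|f (tr a)| ^+ 2.
Proof.
under [RHS]eq_bigr => a _ do rewrite normCK {1}dlE mulr_suml.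
rewrite exchange_big mulr_sumr; apply: eq_bigr => j _ /=.
rewrite normCK mulrCA; under eq_bigr => a _ do rewrite -mulrA.
rewrite -mulr_sumr; congr (_ * _).
rewrite /dl /dotf cardsT card_Fp // rmorphM fmorphV rmorph_nat mulVKf; last first.
  by rewrite pnatr_eq0 -lt0n prime_gt0.
rewrite rmorph_sum; apply: eq_big => [a|a _]; first by rewrite inE.
by rewrite rmorphM /= conjCK mulrC.
Qed.

Lemma dl_square f s j : charon (altS setT) f -> s != 0 -> dl f (s * (s * j)) = dl f j.
Proof.
move=> Nf s0; rewrite /dl /dotf; congr (_ * _).
rewrite [RHS](reindex_inj (mulfI s0)) [RHS](reindex_inj (mulfI s0)) /=.
apply: eq_big => [a|a _]; first by rewrite !inE.
by rewrite tr_square // !mulrA -[s * s * j]mulrC -[j * s]mulrC; congr (_ * (ew _)^*); ring.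
Qed.

Lemma dl_sum f : f 1%g = \sum_j dl f j.
Proof. by rewrite -tr0 dlE; under eq_bigr do rewrite mulr0 ew0 mulr1. Qed.

End Translations.

Lemma alt_p7_zval p (f : {perm 'F_p} -> algC) (a b c d e k : 'F_p) : p = 7 ->
  charon (altS setT) f -> f 1%g <= 9%:R ->
  uniq [:: a; b; c; d; e; k] -> zval f a b c d e k = 0.
Proof. by move=> pE; subst p; apply: alt7_zval. Qed.

Section Letters.

Variables (p : nat) (w : algC).
Hypotheses (pr : prime p) (pw : p.-primitive_root w) (p2 : odd p) (p5 : (4 < p)%N).
Local Notation A := (altS [set: 'F_p]).
Implicit Types (i : Iirr A) (j a : 'F_p).

Variable st : Iirr A.
Hypothesis st0 : st != 0.
Hypothesis stE : {in A, forall g, (sfix setT g)%:R = 1 + 'chi_st g}.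

Lemma std_tr a : a != 0 -> 'chi_st (tr a) = -1.
Proof.
move=> a0; have := stE (tr_alt pr p2 a); rewrite (_ : sfix _ _ = 0%N).
  by move/eqP; rewrite mulr0n eq_sym addrC addr_eq0 => /eqP.
apply/eqP; rewrite cards_eq0; apply/eqP/setP=> y; rewrite !inE trE -[RHS]/false.
by rewrite -subr_eq0 addrK (negbTE a0).
Qed.

Lemma sum_tr a : a != 0 -> \sum_(i : Iirr A) `|'chi_i (tr a)| ^+ 2 = p%:R.
Proof.
move=> a0; have Aa := tr_alt pr p2 a.
have := second_orthogonality_relation (tr a) Aa.
rewrite class_refl card_cent_tr // mulr1n => <-.
by apply: eq_bigr => i _; rewrite normCK.
Qed.

Definition dn i j : nat := Num.truncn (dl w 'chi_i j).

Lemma dnE i j : (dn i j)%:R = dl w 'chi_i j.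
Proof. by rewrite /dn truncnK // dl_nat //; apply: charon_irr. Qed.

Lemma dn0 j : dn 0 j = (j == 0).
Proof.
apply/eqP; rewrite -(eqr_nat algC) dnE; apply/eqP.
rewrite /dl /dotf cardsT card_Fp //.
rewrite (eq_bigr (fun a => ew w (j * - a))) => [|a _]; last first.
  by rewrite irr0 cfun1E tr_alt // mul1r -(ewV pr pw) mulrN.
rewrite (eq_bigl xpredT) => [|a]; last by rewrite inE.
rewrite (reindex_inj oppr_inj) /=; under eq_bigr do rewrite opprK mulrC.
by rewrite (sum_ew pr pw) mulKf // pnatr_eq0 -lt0n prime_gt0.
Qed.

(** The permutation character restricts to the regular character of the translations, and [st] is
    what remains after removing 1. *)
Lemma dn_st j : dn st j = (j != 0).
Proof.
apply/eqP; rewrite -(eqr_nat algC) dnE; apply/eqP.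
rewrite /dl /dotf cardsT card_Fp // (bigD1 0) ?inE //= mulr0 ew0 conjC1 mulr1 tr0.
rewrite (eq_bigr (fun a => - ew w (- a * j))) => [|a /andP[_ a0]]; last first.
  by rewrite std_tr // -(ewV pr pw) mulN1r mulNr mulrC.
have := sum_ew pr pw j; rewrite (reindex_inj oppr_inj) /= (bigD1 0) //= oppr0 mul0r ew0.
have -> : 'chi_st 1%g = p%:R - 1.
  by have := stE (group1 _); rewrite sfix1 cardsT card_Fp // => ->; rewrite addrC addKr.
rewrite sumrN [X in _ - X](eq_bigl (fun i : 'F_p => i != 0)); last by move=> i; rewrite inE.
set X := \sum_(i < _ | _) _.
have p0 : p%:R != 0 :> algC by rewrite pnatr_eq0 -lt0n prime_gt0.
move: X p0 => X p0; case: eqP => _ /=; rewrite ?mulr1 ?mulr0 => E; apply: (mulfI p0); rewrite mulVKf // ?mulr0 ?mulr1.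
  by rewrite -E; ring.
by rewrite -addrA -opprD E subr0.
Qed.

(** The centraliser of a p-cycle in Alt(p) has order p, so by second orthogonality the squared
    values sum to p; the characters 1 and [st] each take 1 of it. *)
Lemma star_tr i a : i != 0 -> i != st -> a != 0 -> `|'chi_i (tr a)| ^+ 2 <= (p - 2)%:R.
Proof.
move=> i0 ist a0; have := sum_tr a0.
rewrite (bigD1 (0 : Iirr A)) // (bigD1 st) //= (bigD1 i) /=; last by rewrite i0.
have -> : 'chi[A]_0 (tr a) = 1 by rewrite irr0 cfun1E tr_alt.
rewrite std_tr // normrN normr1 expr1n.
set R := \sum_(i0 < _ | _) _ => E; have R0 : 0 <= R by apply: sumr_ge0 => ? _; rewrite exprn_ge0.
have <- : p%:R - 2%:R = (p - 2)%:R :> algC by rewrite natrB // ltnW // ltnW // ltnW.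
move: E; move: (`|'chi_i (tr a)| ^+ 2) => x E; rewrite -E -subr_ge0.
by have -> : 1 + (1 + (x + R)) - 2%:R - x = R by ring.
Qed.

Lemma dn_sum i : 'chi_i 1%g = (\sum_j dn i j)%:R.
Proof. by rewrite (dl_sum pr pw) natr_sum; apply: eq_bigr => j _; rewrite dnE. Qed.

(** Parseval for the translations, with [star_tr] bounding each of the p - 1 nontrivial terms. *)
Lemma star_sq i : i != 0 -> i != st ->
  (p * \sum_j dn i j ^ 2 <= (\sum_j dn i j) ^ 2 + p.-1 * (p - 2))%N.
Proof.
move=> i0 ist; rewrite -(ler_nat algC) natrD natrX -dn_sum natrM natr_sum.
rewrite (eq_bigr (fun j => `|dl w 'chi_i j| ^+ 2)); last first.
  by move=> j _; rewrite -dnE natrX normr_nat.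
rewrite (dl_parseval pr pw) (bigD1 0) //= tr0 lerD //.
  by rewrite dn_sum normr_nat.
rewrite natrM mulr_natl -[p.-1](_ : #|[pred a : 'F_p | a != 0]| = _); last first.
  by rewrite -[RHS](congr1 predn (card_Fp pr)) -(cardC1 0); apply: eq_card.
by rewrite -sumr_const; apply: ler_sum => a a0; apply: star_tr.
Qed.

Lemma dn_square i s j : s != 0 -> dn i (s * (s * j)) = dn i j.
Proof. by move=> s0; rewrite /dn dl_square //; apply: charon_irr. Qed.

(* A vanishing multiplicity vanishes on a whole class of squares, about half of the
   eigenvalues, and the Cauchy-Schwarz inequality then makes the degree small. *)
Lemma dn_pos i j : i != 0 -> i != st -> j != 0 ->
  (p.+1 * (p - 2) < (\sum_j dn i j) ^ 2)%N -> (0 < dn i j)%N.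
Proof.
move=> i0 ist j0 Dlt; rewrite lt0n; apply: contraL Dlt => /eqP dj0; rewrite -leqNgt.
set D := (\sum_j dn i j)%N; set Q := (\sum_j dn i j ^ 2)%N.
pose Z := [set j : 'F_p | dn i j == 0%N].
(* The map sending s to s^2 j takes the nonzero elements into [Z], and each fibre has at most two
   elements. *)
have Zbig : (p.-1 <= #|Z| * 2)%N.
  pose sqj (s : 'F_p) := s * (s * j).
  have -> : p.-1 = #|[set s : 'F_p | s != 0]|.
    by rewrite -[p in LHS](card_Fp pr) -(cardC1 (0 : 'F_p)) cardsE; apply: eq_card => x; rewrite !inE.
  rewrite -sum1_card (partition_big sqj (fun z => z \in Z)) /= => [|s]; last first.
    by rewrite !inE /sqj => s0; rewrite dn_square // dj0.
  rewrite -sum_nat_const; apply: leq_sum => z _; rewrite sum1_card.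
  case: (pickP (mem [pred s | (s \in [set s | s != 0]) && (sqj s == z)])) => [t /=|e0]; last by rewrite eq_card0.
  rewrite !inE => /andP[t0 /eqP tz]; apply: (@leq_trans #|[set t; - t]|).
    apply: subset_leq_card; apply/subsetP=> s; rewrite !inE -tz /sqj => /andP[_].
    by rewrite !mulrA (inj_eq (mulIf j0)) -!expr2 eqf_sqr.
  by rewrite cards2; case: (_ != _).
pose n := #|~: Z|; have nZ : (n + #|Z| = p)%N by rewrite /n addnC cardsC card_Fp.
have DZ : D = (\sum_(j in ~: Z) dn i j)%N.
  rewrite /D (bigID (mem Z)) /= big1 => [|k]; last by rewrite inE => /eqP.
  by rewrite add0n; apply: eq_bigl => k; rewrite in_setC.
have QZ : (\sum_(j in ~: Z) dn i j ^ 2 <= Q)%N.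
  by rewrite /Q [X in (_ <= X)%N](bigID (mem (~: Z))) /= leq_addr.
have CS : (D ^ 2 <= n * Q)%N.
  rewrite -(leq_pmul2l (isT : 0 < 2)%N) -mulnn {1}DZ big_distrl /= big_distrr /=.
  apply: (@leq_trans (\sum_(k in ~: Z) \sum_(l in ~: Z) (dn i k ^ 2 + dn i l ^ 2))).
    apply: leq_sum => k _; rewrite DZ big_distrr /= big_distrr /=.
    by apply: leq_sum => l _; apply: nat_Cauchy.
  under eq_bigr => k _ do rewrite big_split /= sum_nat_const.
  rewrite big_split /= sum_nat_const -big_distrr /= -/n -mulnDr addnn -mul2n mulnCA.
  by rewrite leq_pmul2l // leq_mul2l QZ orbT.
have := star_sq i0 ist; rewrite -/D -/Q => SQ.
have p0 : (0 < p.-1)%N by have := p5; clear; lia.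
rewrite -(leq_pmul2l p0).
have pE : (p = p.-1 + 1)%N by have := p5; clear; lia.
have n2 : (2 * n <= p.+1)%N by have := p5; move: Zbig nZ; clear; lia.
have h1 : (p * (2 * D ^ 2) <= p * (p.+1 * Q))%N.
  rewrite leq_mul2l; apply/orP; right; apply: leq_trans (_ : 2 * (n * Q) <= _)%N.
    by rewrite leq_mul2l CS orbT.
  by rewrite mulnA leq_mul2r n2 orbT.
have h2 : (p.+1 * (p * Q) <= p.+1 * (D ^ 2 + p.-1 * (p - 2)))%N by rewrite leq_mul2l SQ orbT.
clear -h1 h2 pE; move: pE h1 h2; move: (D ^ 2)%N (p - 2)%N p.-1 Q => x y m q ->; nia.
Qed.

(** If all multiplicities off 0 were 1, the degree would be D = d + p - 1 with d the multiplicity at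
    0, and [star_sq] would reduce to (d - 1)^2 <= p - 2, where d - 1 = D - p. *)
Lemma dn_big i : i != 0 -> i != st -> (forall j, j != 0 -> (0 < dn i j)%N) ->
  (p + 2 < \sum_j dn i j)%N -> (p - 2 < (\sum_j dn i j - p) ^ 2)%N ->
  exists2 j, j != 0 & (1 < dn i j)%N.
Proof.
move=> i0 ist pos Dp Dsq.
have [/existsP[j /andP[j0 j1]]|/existsPn no] := boolP [exists j, (j != 0) && (1 < dn i j)%N].
  by exists j.
have one j : j != 0 -> dn i j = 1%N.
  by move=> j0; apply/eqP; rewrite eqn_leq pos // leqNgt andbT; have := no j; rewrite j0.
have cardn : #|[pred j : 'F_p | j != 0]| = p.-1.
  by rewrite -[RHS](congr1 predn (card_Fp pr)) -(cardC1 0); apply: eq_card.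
have := star_sq i0 ist; move: Dp Dsq.
have sumE e : (\sum_j dn i j ^ e.+1 = dn i 0%R ^ e.+1 + p.-1)%N.
  rewrite (bigD1 0) //=; congr (_ + _)%N; rewrite -cardn -sum1_card.
  by apply: eq_bigr => j j0; rewrite one // exp1n.
have -> : (\sum_j dn i j = dn i 0%R + p.-1)%N by rewrite -[dn i 0%R]expn1 -sumE.
rewrite (sumE 1%N) => lt1 lt2 le3; exfalso; move: lt1 lt2 le3.
move: (dn i 0%R) => d; have pE : (p = p.-1 + 1)%N by have := p5; clear; lia.
move: pE p5; clear; move: p.-1 => m -> m4 d3 lt le.
have dE : (d = (d - 1) + 1)%N by move: d3; clear; lia.
have eE : (d + m - (m + 1) = d - 1)%N by clear; lia.
rewrite eE in lt; move: dE lt le; move: (d - 1)%N => e -> lt le.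
have : (m * e ^ 2 <= m * (m - 1))%N by move: m4 le; clear; nia.
by rewrite leq_pmul2l; move: m4 lt; clear; lia.
Qed.

Lemma star_zval i a b c d e k : (7 <= p)%N -> i != 0 -> i != st -> uniq [:: a; b; c; d; e; k] ->
  zval 'chi_i a b c d e k != 0.
Proof.
move=> p7 i0 ist u6; apply: contraTneq isT => z0.
have sT : {subset [:: a; b; c; d; e; k] <= [set: 'F_p]} by move=> x _; rewrite inE.
have [x [y xy]] := nonstar_form u6 sT (charon_irr i) z0.
have iE : 'chi_i = x%:R *: 'chi[A]_0 + y%:R *: 'chi_st.
  apply/cfun_inP=> g Ag; rewrite xy // stE // !cfunE irr0 cfun1E Ag mulr1.
  by rewrite [1 + _]addrC addrK.
have := cfnorm_irr i; rewrite {1}iE cfdotDl !cfdotZl !cfdot_irr.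
rewrite ![_ == i]eq_sym (negbTE i0) (negbTE ist) !mulr0 addr0 => /eqP.
by rewrite eq_sym oner_eq0.
Qed.

(** From p = 11 on, the degree bound 3(p - 4) is large enough for [dn_pos] and [dn_big]. At p = 7 it
    gives only 9, and the character table of Sym(7) raises it to 10. *)
Lemma star_dn i : (7 <= p)%N -> i != 0 -> i != st ->
  (forall j, j != 0 -> (0 < dn i j)%N) /\ exists2 j, j != 0 & (1 < dn i j)%N.
Proof.
move=> p7 i0 ist; have cp : #|[set: 'F_p]| = p by rewrite cardsT card_Fp.
have c6 : (6 <= #|[set: 'F_p]|)%N by rewrite cp ltnW.
have [a [b [c [d [e [k [u6 s6]]]]]]] := sextuple c6.
have z0 := star_zval p7 i0 ist u6; have Ni := charon_irr i.
have [D2 [D3 D4]] : (p.+1 * (p - 2) < (\sum_j dn i j) ^ 2)%N /\ ((p + 2 < \sum_j dn i j)%N /\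
    (p - 2 < (\sum_j dn i j - p) ^ 2)%N).
  have [p9|p9] := leqP 9 p; last first.
    have pE : p = 7 by move: p2 p7 p9; clear; case: (p) => [|[|[|[|[|[|[|[|[|q]]]]]]]]].
    have : (9 < \sum_j dn i j)%N.
      rewrite ltnNge; apply: contra_neqN z0; rewrite -(ler_nat algC) -dn_sum.
      by move=> le9; apply: (alt_p7_zval pE Ni le9 u6).
    by move: (\sum_j dn i j)%N => D; rewrite pE; clear; nia.
  have := star_degree Ni u6 s6 z0; rewrite cp => /(_ _ p9) D3.
  have /D3 : forall (S' : {set 'F_p}) (g : {perm 'F_p} -> algC) (x y z : 'F_p),
     (#|S'| < p)%N -> (6 <= #|S'|)%N -> charon (altS S') g -> uniq [:: x; y; z] ->
     {subset [:: x; y; z] <= S'} -> g (cyc3 x y z) != g 1%g -> (#|S'|.-1)%:R <= g 1%g.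
    by move=> S' g x y z _ S6 Ng; apply: alt_min_degree.
  have p11 : (11 <= p)%N.
    move: p9; rewrite leq_eqVlt => /orP[/eqP p9|]; first by move: pr; rewrite -p9.
    by rewrite leq_eqVlt => /orP[/eqP p10|//]; move: p2; rewrite -p10.
  rewrite dn_sum ler_nat; move: (\sum_j dn i j)%N => D D3'.
  by clear -p11 D3'; split; [nia | split; nia].
have pos j : j != 0 -> (0 < dn i j)%N by move=> j0; apply: dn_pos.
by split=> //; apply: dn_big.
Qed.

End Letters.

(** * Products of alternating groups *)

Section Blocks.

Variables (I X : finType).
Local Notation A := (altS [set: X]).
Implicit Types (x y : {ffun I -> {perm X}}) (l : I) (b : {ffun I -> Iirr A}).

Definition blk_fun x (t : I * X) : I * X := (t.1, x t.1 t.2).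

Lemma blk_inj x : injective (blk_fun x).
Proof. by move=> [l a] [l' a'] [<- /perm_inj ->]. Qed.

Definition blk x : {perm I * X} := perm (@blk_inj x).

Lemma blkE x l a : blk x (l, a) = (l, x l a).
Proof. by rewrite permE. Qed.

Definition K : {group {dffun forall i : I, {perm X}}} := [group of setXn (fun=> A : {set _})].

Lemma KP x : reflect (forall l, x l \in A) (x \in K).
Proof. exact: setXnP. Qed.

Lemma mulKE (x y : {dffun forall i : I, {perm X}}) l : (x * y)%g l = (x l * y l)%g.
Proof. by rewrite ffunE. Qed.

Lemma blkM : {in K &, {morph blk : x y / (x * y)%g}}.
Proof. by move=> x y _ _; apply/permP=> -[l a]; rewrite permM !blkE mulKE permM. Qed.

Lemma pair_inj l : injective (fun a : X => (l, a)). Proof. by move=> a a' []. Qed.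

Definition emb l (g : {perm X}) : {perm I * X} := pext (@pair_inj l) g.

Lemma embE l g l' a : emb l g (l', a) = (l', if l' == l then g a else a).
Proof.
case: eqP => [->|ne]; first exact: (pextE (@pair_inj l)).
by rewrite /emb pext_out //; apply/codomP=> -[a' []].
Qed.

Lemma blk_prod x : blk x = (\prod_l emb l (x l))%g.
Proof.
suffices prodE s l a : uniq s ->
    (\prod_(l <- s) emb l (x l))%g (l, a) = (l, if l \in s then x l a else a).
  by apply/permP=> -[l a]; rewrite blkE prodE ?index_enum_uniq ?mem_index_enum.
elim: s a => [|l' s IH] a /=; first by rewrite big_nil perm1.
case/andP=> ns us; rewrite big_cons permM embE IH // in_cons.
by case: eqP ns => [->|_ _]; case: (l' \in s); case: (l \in s).
Qed.

Lemma odd_blk x : odd_perm (blk x) = \big[addb/false]_l odd_perm (x l).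
Proof.
rewrite blk_prod (big_morph _ (@odd_permM _) (odd_perm1 _)).
by apply: eq_bigr => l _; rewrite /emb pext_odd.
Qed.

Lemma blk_alt x : x \in K -> blk x \in altS setT.
Proof.
move/KP=> xA; rewrite in_altT odd_blk big1 // => l _.
by apply/negbTE; rewrite -in_altT.
Qed.

Definition tens b (x : {ffun I -> {perm X}}) : algC := \prod_l 'chi_(b l) (x l).

Lemma sum_K (F : I -> {perm X} -> algC) :
  \sum_(x in K) \prod_l F l (x l) = \prod_l \sum_(g in A) F l g.
Proof.
rewrite bigA_distr_big_dep /=; apply: eq_bigl => x.
by apply/KP/familyP.
Qed.

Lemma card_K : #|K| = (#|A| ^ #|I|)%N.
Proof. by rewrite /K /= cardsXn prod_nat_const. Qed.

Lemma tens_char b : charon K (tens b).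
Proof.
apply: charon_prod => l; apply: (charon_morph (G := A) (h := fun x : {dffun forall i : I, {perm X}} => x l)).
- by move=> x y _ _; rewrite mulKE.
- by move=> x /KP.
exact: charon_irr.
Qed.

Lemma tens_dot b b' : dotf K (tens b) (tens b') = (b == b')%:R.
Proof.
rewrite /dotf; under eq_bigr => x _ do rewrite /tens rmorph_prod -big_split /=.
rewrite (sum_K (fun l g => 'chi_(b l) g * ('chi_(b' l) g)^*)) card_K natrX -exprVn.
rewrite -prodr_const -big_split /= (eq_bigr (fun l => (b l == b' l)%:R)) => [|l _]; last first.
  by rewrite -[LHS]/(dotf A 'chi_(b l) 'chi_(b' l)) dotfE cfdot_irr.
have [->|ne] := eqVneq b b'; first by rewrite big1 // => l _; rewrite eqxx.
have [l nl] : exists l, b l != b' l.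
  by apply/existsP; rewrite -negb_forall; apply: contra ne => /forallP e; apply/eqP/ffunP=> l; apply/eqP.
by rewrite (bigD1 l) //= (negbTE nl) mul0r.
Qed.

Section Multiplicities.

Variable f : {perm I * X} -> algC.
Hypothesis Nf : charon (altS setT) f.

Definition mult b : nat := Num.truncn (dotf K (fun x => f (blk x)) (tens b)).

Lemma blk_char : charon K (fun x => f (blk x)).
Proof. exact: (charon_morph blkM blk_alt Nf). Qed.

Lemma multE b : (mult b)%:R = dotf K (fun x => f (blk x)) (tens b).
Proof. by rewrite /mult truncnK // charon_nat //; [apply: blk_char | apply: tens_char]. Qed.

(** The tensor products are orthonormal and their squared degrees sum to the order of [K], so they
    are all the irreducible characters. *)
Lemma mult_dec x : x \in K -> f (blk x) = \sum_b (mult b)%:R * tens b x.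
Proof.
have irr b : exists i, {in K, tens b =1 'chi[K]_i}.
  apply: vcharon_irr; [exact: vcharon_charon (tens_char b) | by rewrite tens_dot eqxx |].
  by apply: prodr_gt0 => l _; rewrite ffunE irr1_gt0.
have orth b b' : b != b' -> dotf K (tens b) (tens b') = 0.
  by move=> ne; rewrite tens_dot (negbTE ne).
have degs : \sum_b tens b 1%g ^+ 2 = #|K|%:R.
  under eq_bigr => b _ do rewrite /tens -prodrXl.
  rewrite -(bigA_distr_bigA (fun l i => 'chi_i ((1 : {dffun forall i : I, {perm X}})%g l) ^+ 2)) /=.
  rewrite card_K natrX -prodr_const; apply: eq_bigr => l _.
  under eq_bigr do rewrite ffunE.
  by rewrite -(irr_sum_square A).
have [a [aE fE]] := dot_irr_basis irr orth degs blk_char.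
move=> Kx; rewrite fE //; apply: eq_bigr => b _; congr (_ * _).
by rewrite aE multE.
Qed.

Variable tau : {perm X}.
Hypotheses (odt : odd_perm tau) (oX : odd #|X|).

Definition tw (i : Iirr A) : Iirr A := conjg_Iirr i tau^-1.

Lemma twE i : {in A, forall g, 'chi_(tw i) g = 'chi_i (g ^ tau)%g}.
Proof.
move=> g Ag; rewrite conjg_IirrE cfConjgE ?invgK //.
by rewrite groupV; apply/normP/setP=> h; rewrite mem_conjg !in_altT odd_permJ.
Qed.

Lemma altJ g : g \in A -> (g ^ tau)%g \in A.
Proof. by rewrite !in_altT odd_permJ. Qed.

Definition permute_fun (s : {perm I}) (t : I * X) : I * X := (s t.1, t.2).

Lemma permute_inj s : injective (permute_fun s).
Proof. by move=> [l a] [l' a'] [/perm_inj-> ->]. Qed.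

Definition permute s : {perm I * X} := perm (@permute_inj s).

Lemma permuteE s l a : permute s (l, a) = (s l, a).
Proof. by rewrite permE. Qed.

Lemma row_inj (a : X) : injective (fun l : I => (l, a)). Proof. by move=> l l' []. Qed.

(** The permutation acts as s on each of the rows indexed by [X], and the number of rows is odd. *)
Lemma odd_permute s : odd_perm (permute s) = odd_perm s.
Proof.
have -> : permute s = (\prod_a pext (@row_inj a) s)%g.
  suffices prodE t l a : uniq t ->
      (\prod_(a <- t) pext (@row_inj a) s)%g (l, a) = (if a \in t then s l else l, a).
    by apply/permP=> -[l a]; rewrite permuteE prodE ?index_enum_uniq ?mem_index_enum.
  elim: t l => [|a' t IH] l /=; first by rewrite big_nil perm1.
  case/andP=> nt ut; rewrite big_cons permM in_cons.
  have [E|ne] := eqVneq a a'.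
    by rewrite -E (pextE (@row_inj a) s l) IH // E (negbTE nt).
  by rewrite pext_out ?IH //; apply/codomP=> -[l' [_ E]]; rewrite E eqxx in ne.
rewrite (big_morph _ (@odd_permM _) (odd_perm1 _)).
under eq_bigr do rewrite pext_odd.
have iterE (b : bool) n : iter n (addb b) false = odd n && b.
  by elim: n => [|n IH] //=; rewrite IH {IH}; case: b; case: (odd n).
by rewrite big_const iterE oX.
Qed.

(** The permutation s of the blocks followed by [tau] in the blocks of [D] is even exactly when the
    two parities agree. It then normalises [K] and preserves f. *)
Lemma mult_move b (s : {perm I}) (D : {set I}) : odd_perm s = odd #|D| ->
  mult [ffun l => if s l \in D then tw (b (s l)) else b (s l)] = mult b.
Proof.
move=> sD; apply/eqP; rewrite -(eqr_nat algC) !multE; apply/eqP.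
pose y : {ffun I -> {perm X}} := [ffun l => if l \in D then tau else 1%g].
pose h := (permute s * blk y)%g.
have eh : h \in altS setT.
  rewrite in_altT odd_permM odd_permute odd_blk sD.
  rewrite (eq_bigr (fun l => l \in D)) => [|l _]; last by rewrite ffunE; case: ifP; rewrite ?odd_perm1.
  suffices -> : \big[addb/false]_l (l \in D) = odd #|D| by rewrite addbb.
  by rewrite -sum1_card (big_morph _ oddD (erefl _)) [RHS]big_mkcond; apply: eq_bigr => l _; case: ifP.
pose phi (x : {dffun forall i : I, {perm X}}) : {dffun forall i : I, {perm X}} :=
  [ffun l => (x ((s^-1)%g l) ^ y l)%g].
have phiE x : blk (phi x) = (blk x ^ h)%g.
  apply: (mulgI h); rewrite -conjgC; apply/permP=> -[l a].
  by rewrite !permM permuteE !blkE permuteE !blkE [phi x _]ffunE permK permJ.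
have phiI : injective phi.
  move=> x x' E; apply/ffunP=> l.
  have /ffunP/(_ (s l)) : phi x = phi x' by [].
  by rewrite !ffunE permK => /conjg_inj.
have phiK x : (phi x \in K) = (x \in K).
  apply/KP/KP=> xA l.
    have := xA (s l); rewrite ffunE permK ffunE.
    by case: ifP; rewrite ?conjg1 // !in_altT odd_permJ.
  by rewrite !ffunE; case: ifP; rewrite ?conjg1 ?altJ.
rewrite /dotf [in RHS](reindex_inj phiI) /=; congr (_ * _).
apply: eq_big => [x|x]; first by rewrite phiK.
move=> Kx; rewrite phiE (charonJ Nf) ?blk_alt //; congr (_ * _^*).
rewrite /tens [RHS](reindex_inj (@perm_inj _ s)) /=; apply: eq_bigr => l _.
move/KP: Kx => /(_ l) Al; rewrite !ffunE permK.
by case: ifP => _; rewrite ?conjg1 ?twE.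
Qed.

End Multiplicities.

End Blocks.

Section PairSlices.

Variables (I X : finType) (f : {perm I * X} -> algC).
Hypothesis Nf : charon (altS setT) f.
Local Notation A := (altS [set: X]).
Local Notation gfun := {dffun forall i : I, {perm X}}.
Implicit Types (b : {ffun I -> Iirr A}) (i j l : I) (u v : {perm X}).

Definition pt i j u v : gfun := [ffun l => if l == i then u else if l == j then v else 1%g].

Lemma pt_K i j u v : u \in A -> v \in A -> pt i j u v \in K I X.
Proof. by move=> Au Av; apply/KP=> l; rewrite ffunE; do 2?case: ifP => _ //; apply: group1. Qed.

Definition rest i j : {group gfun} :=
  [group of setXn (fun l => (if (l == i) || (l == j) then 1%G else A : {group {perm X}}) : {set _})].

Lemma restP i j (y : gfun) :
  reflect (forall l, y l \in (if (l == i) || (l == j) then 1%G else A : {group {perm X}})) (y \in rest i j).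
Proof. exact: setXnP. Qed.

Lemma rest_K i j (y : gfun) : y \in rest i j -> y \in K I X.
Proof.
move/restP=> yr; apply/KP=> l; have := yr l.
by case: ifP => // _ /set1P->; apply: group1.
Qed.

Definition rtens i j b (y : gfun) : algC :=
  \prod_(l | ~~ ((l == i) || (l == j))) 'chi_(b l) (y l).

(** The factors of b outside blocks i and j are split off. What is left is a character of the
    alternating group on the union of the two blocks, where cycles can be moved from one block to
    the other. *)
Definition pslice i j b (g : {perm I * X}) : algC :=
  dotf (rest i j) (fun y => f (g * blk y)%g) (rtens i j b).

Definition pair_set i j : {set I * X} := [set t | (t.1 == i) || (t.1 == j)].

Lemma pslice_char i j b : charon (altS (pair_set i j)) (pslice i j b).
Proof.
have Nr : charon (rest i j) (rtens i j b).
  apply: (charon_ext (f := fun y : gfun => \prod_l (if (l == i) || (l == j) then 1 else 'chi_(b l) (y l)))).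
    by move=> y _; rewrite /rtens [RHS]big_mkcond; apply: eq_bigr => l _; case: ifP.
  apply: (charon_prod (F := fun l (y : gfun) => if (l == i) || (l == j) then 1 else 'chi_(b l) (y l))) => l.
  case lij: ((l == i) || (l == j)); first exact: charon_1.
  apply: (charon_morph (G := A) (h := fun x : gfun => x l)); [|move=> y /restP/(_ l); rewrite lij //|exact: charon_irr].
  by move=> x y _ _; rewrite mulKE.
have idM : {in altS (pair_set i j) &, {morph (@id {perm I * X}) : x y / (x * y)%g}} by [].
refine (charon_pair_slice idM _ _ _ _ Nf Nr).
- by move=> x y rx ry; apply: blkM; [apply: rest_K rx | apply: rest_K ry].
- move=> g y Sg /restP ry; apply/permP=> t; rewrite !permM.
  have stable : (g t \in pair_set i j) = (t \in pair_set i j) by apply: altS_stable.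
  have [t_in|t_out] := boolP (t \in pair_set i j).
    have blk1 t' : t' \in pair_set i j -> blk y t' = t'.
      case: t' => l a; rewrite inE /= blkE => lij.
      by have := ry l; rewrite lij => /set1P->; rewrite perm1.
    by rewrite !blk1 // stable.
  rewrite (altS_fix Sg t_out) (altS_fix Sg) //.
  by case: t t_out {stable} => l a; rewrite !inE blkE.
- by move=> g; apply: (subsetP (altSS (subsetT _))).
- by move=> y /rest_K; apply: blk_alt.
Qed.

Lemma sum_setXn (B : I -> {set {perm X}}) (F : I -> {perm X} -> algC) :
  \sum_(y in setXn (B : forall i : I, {set {perm X}})) \prod_l F l (y l) = \prod_l \sum_(g in B l) F l g.
Proof.
rewrite bigA_distr_big_dep /=; apply: eq_bigl => x.
by apply/setXnP/familyP.
Qed.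

Definition agree i j b b' := [forall l, (l == i) || (l == j) || (b' l == b l)].

Lemma pslice_blk i j b u v : i != j -> u \in A -> v \in A ->
  pslice i j b (blk (pt i j u v)) =
  \sum_(b' | agree i j b b') (mult f b')%:R * ('chi_(b' i) u * 'chi_(b' j) v).
Proof.
move=> ij Au Av; have Kpt := pt_K i j Au Av.
pose dd b' : algC := \prod_l if (l == i) || (l == j) then 'chi_(b' l) (pt i j u v l) else (b' l == b l)%:R.
transitivity (\sum_b' (mult f b')%:R * dd b').
  rewrite /pslice /dotf.
  transitivity (#|rest i j|%:R^-1 * \sum_(y in rest i j) \sum_b' (mult f b')%:R *
      \prod_l ('chi_(b' l) (pt i j u v l * y l)%g *
        (if (l == i) || (l == j) then 1 else ('chi_(b l) (y l))^*))).
    congr (_ * _); apply: eq_bigr => y ry; rewrite -(blkM Kpt (rest_K ry)).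
    have Kpy : (pt i j u v * y)%g \in K I X by exact: groupM Kpt (rest_K ry).
    rewrite (mult_dec Nf Kpy) mulr_suml; apply: eq_bigr => b' _.
    rewrite -mulrA; congr (_ * _); rewrite big_split /=; congr (_ * _).
      by apply: eq_bigr => l _; rewrite mulKE.
    by rewrite /rtens rmorph_prod big_mkcond; apply: eq_bigr => l _; case: (_ || _).
  rewrite exchange_big mulr_sumr; apply: eq_bigr => b' _ /=.
  rewrite -mulr_sumr mulrCA; congr (_ * _).
  rewrite (sum_setXn _ (fun l g => 'chi_(b' l) (pt i j u v l * g)%g *
    (if (l == i) || (l == j) then 1 else ('chi_(b l) g)^*))).
  rewrite /rest /= cardsXn natr_prod -prodfV -big_split /=; apply: eq_bigr => l _.
  case: ifP => lij; first by rewrite cards1 invr1 mul1r big_set1 mulg1 mulr1.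
  rewrite ffunE; move/negbT: lij; rewrite negb_or => /andP[/negbTE-> /negbTE->].
  under eq_bigr do rewrite mul1g.
  by rewrite -[LHS]/(dotf A 'chi_(b' l) 'chi_(b l)) dotfE cfdot_irr.
rewrite [RHS]big_mkcond; apply: eq_bigr => b' _; rewrite /dd.
case: ifP => [/forallP ag|/negbT]; last first.
  rewrite negb_forall => /existsP[l]; rewrite negb_or => /andP[/negbTE lij /negbTE ne].
  by rewrite (bigD1 l) //= lij ne mul0r mulr0.
rewrite (bigD1 i) // (bigD1 j) /=; last by rewrite eq_sym.
rewrite !ffunE !eqxx orbT [j == i]eq_sym (negbTE ij) big1 ?mulr1 // => l /andP[/negbTE li /negbTE lj].
by rewrite li lj; have := ag l; rewrite li lj /= => ->.
Qed.

Lemma blk_pt1 i j a c d : blk (pt i j (cyc3 a c d) 1%g) = cyc3 (i, a) (i, c) (i, d).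
Proof.
rewrite -(pext_cyc3 (@pair_inj I X i)) -/(emb i _); apply/permP=> -[l z].
by rewrite blkE embE ffunE; case: ifP => // _; case: ifP => _; rewrite perm1.
Qed.

Lemma blk_pt i j u v : i != j -> blk (pt i j u v) = (blk (pt i j u 1%g) * blk (pt i j 1%g v))%g.
Proof.
move=> ij; apply/permP=> -[l z]; rewrite permM !blkE !ffunE.
have [->|li] := eqVneq l i; first by rewrite perm1.
by case: (l == j); rewrite !perm1.
Qed.

Lemma pt_sym i j u v : i != j -> pt i j u v = pt j i v u.
Proof.
move=> ij; apply/ffunP=> l; rewrite !ffunE.
by case: eqP => [->|//]; rewrite (negbTE ij).
Qed.

Lemma chi_cyc3_le (r : Iirr A) a c d : (5 <= #|X|)%N -> uniq [:: a; c; d] ->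
  0 <= 'chi_r 1%g - 'chi_r (cyc3 a c d).
Proof.
move=> X5 u3; have sT : {subset [:: a; c; d] <= [set: X]} by move=> x _; rewrite inE.
have Nr := charon_irr r; have Ac := cyc3_alt u3 sT.
have cR : 'chi_r (cyc3 a c d) \is Num.real.
  by apply/CrealP; rewrite -(charonV Nr Ac) (const_cyc3V Nr) // cardsT.
by rewrite subr_ge0 (le_trans (real_ler_norm cR)) // (charon_norm Nr Ac).
Qed.

(* With one 3-cycle in each of two blocks, every tensor contributes a nonnegative amount to
   this value of zval. *)
Lemma pslice_zval i j b a c d a' c' d' : i != j -> (5 <= #|X|)%N ->
  uniq [:: a; c; d] -> uniq [:: a'; c'; d'] ->
  zval (pslice i j b) (i, a) (i, c) (i, d) (j, a') (j, c') (j, d') =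
  \sum_(b' | agree i j b b') (mult f b')%:R *
    (('chi_(b' i) 1%g - 'chi_(b' i) (cyc3 a c d)) * ('chi_(b' j) 1%g - 'chi_(b' j) (cyc3 a' c' d'))).
Proof.
move=> ij X5 u3 u3'; have ji : j != i by rewrite eq_sym.
have sT (s : seq X) : {subset s <= [set: X]} by move=> x _; rewrite inE.
have Ac := cyc3_alt u3 (sT _); have Ac' := cyc3_alt u3' (sT _).
have A1 : 1%g \in A by apply: group1.
have p1 : 1%g = blk (pt i j 1%g 1%g).
  by apply/permP=> -[l z]; rewrite blkE ffunE; case: ifP => _; [|case: ifP => _]; rewrite !perm1.
have pu : uniq [:: (i, a); (i, c); (i, d)] by move: u3; rewrite /= !inE !xpair_eqE !eqxx.
have pu' : uniq [:: (j, a'); (j, c'); (j, d')] by move: u3'; rewrite /= !inE !xpair_eqE !eqxx.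
have pS : {subset [:: (i, a); (i, c); (i, d)] <= pair_set i j}.
  by move=> t; rewrite !in_cons in_nil orbF => /or3P[]/eqP->; rewrite inE /= eqxx.
have pS' : {subset [:: (j, a'); (j, c'); (j, d')] <= pair_set i j}.
  by move=> t; rewrite !in_cons in_nil orbF => /or3P[]/eqP->; rewrite inE /= eqxx orbT.
have S5 : (5 <= #|pair_set i j|)%N.
  apply: leq_trans X5 _; rewrite -(card_imset predT (@pair_inj I X i)); apply: subset_leq_card.
  by apply/subsetP=> t /imsetP[x _ ->]; rewrite inE /= eqxx.
rewrite /zval mulr_natl mulr2n {2}(const_cyc3 (pslice_char i j b) S5 pu pu' pS pS').
rewrite -!(blk_pt1 i j) -(blk_pt1 j i) -(pt_sym 1%g _ ij) -blk_pt // p1.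
rewrite !pslice_blk // opprD -!sumrN -!big_split /=; apply: eq_bigr => b' _; ring.
Qed.

End PairSlices.

Section Words.

Variables (p : nat) (w : algC).
Hypotheses (pr : prime p) (pw : p.-primitive_root w) (p2 : odd p) (p5 : (4 < p)%N).
Local Notation A := (altS [set: 'F_p]).
Variable st : Iirr A.
Hypothesis st0 : st != 0.
Hypothesis stE : {in A, forall g, (sfix setT g)%:R = 1 + 'chi_st g}.

Variables (I : finType) (m : nat) (f : {perm I * 'F_p} -> algC).
Hypothesis Nf : charon (altS setT) f.
Hypothesis f1 : f 1%g = (m * p ^ #|I|)%:R.
Hypothesis f0 : forall a : {ffun I -> 'F_p}, a != [ffun=> 0] -> f (blk [ffun l => tr (a l)]) = 0.
Implicit Types (b : {ffun I -> Iirr A}) (l i j : I).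

Lemma cardFp : #|'F_p| = p. Proof. exact: card_Fp. Qed.

(** By [f0] and [f1] the restriction of f to the product of the translation groups is m times the
    regular character, so every tuple [lam] of characters has multiplicity m. *)
Lemma sum_weights (lam : I -> 'F_p) :
  (\sum_b mult f b * \prod_l dn w (b l) (lam l))%N = m.
Proof.
have p0 : p%:R != 0 :> algC by rewrite pnatr_eq0 -lt0n prime_gt0.
apply/eqP; rewrite -(eqr_nat algC) natr_sum; apply/eqP.
pose F (a : {ffun I -> 'F_p}) := f (blk [ffun l => tr (a l)]).
transitivity ((p ^ #|I|)%:R^-1 * \sum_(a : {ffun I -> 'F_p}) F a * (\prod_l ew w (lam l * a l))^*); last first.
  rewrite (bigD1 [ffun=> 0]) //= [X in _ * (_ + X)]big1 => [|a a0]; last by rewrite [F a](f0 a0) mul0r.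
  have -> : F [ffun=> 0] = f 1%g.
    rewrite /F; congr (f _); apply/permP=> -[l y].
    by rewrite blkE !ffunE tr0 perm1 perm1.
  rewrite big1 => [|l _]; last by rewrite ffunE mulr0 ew0.
  by rewrite conjC1 mulr1 addr0 f1 natrM mulrCA mulVf ?mulr1 // natrX expf_neq0.
transitivity ((p ^ #|I|)%:R^-1 * \sum_(a : {ffun I -> 'F_p}) \sum_b (mult f b)%:R *
    \prod_l ('chi_(b l) (tr (a l)) * (ew w (lam l * a l))^*)); last first.
  congr (_ * _); apply: eq_bigr => a _; rewrite /F (mult_dec Nf); last first.
    by apply/KP=> l; rewrite ffunE tr_alt.
  rewrite mulr_suml; apply: eq_bigr => b _; rewrite -mulrA; congr (_ * _).
  rewrite rmorph_prod -big_split /=; apply: eq_bigr => l _.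
  by rewrite ffunE.
rewrite exchange_big mulr_sumr; apply: eq_bigr => b _ /=.
rewrite -mulr_sumr mulrCA natrM natr_prod; congr (_ * _).
rewrite -(bigA_distr_bigA (fun l a => 'chi_(b l) (tr a) * (ew w (lam l * a))^*)) /=.
rewrite natrX -exprVn -prodr_const -big_split /=; apply: eq_bigr => l _.
rewrite dnE // /dl /dotf cardsT cardFp; congr (_ * _).
by apply: eq_bigl => a; rewrite inE.
Qed.

Lemma le_weights (lam : I -> 'F_p) (B : {set {ffun I -> Iirr A}}) :
  (\sum_(b in B) mult f b * \prod_l dn w (b l) (lam l) <= m)%N.
Proof. by rewrite -(sum_weights lam) [X in (_ <= X)%N](bigID (mem B)) /= leq_addr. Qed.

Let tau : {perm 'F_p} := tperm 0 1.

Lemma odd_tau : odd_perm tau.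
Proof. by rewrite odd_tperm eq_sym oner_eq0. Qed.

Lemma tw_0 : tw tau 0 = 0 :> Iirr A.
Proof.
apply: irr_inj; apply/cfun_inP=> g Ag; rewrite twE // !irr0 !cfun1E.
by rewrite altJ ?Ag.
Qed.

Lemma tw_st : tw tau st = st.
Proof.
apply: irr_inj; apply/cfun_inP=> g Ag; rewrite twE //.
apply: (addrI 1); rewrite -!stE ?altJ //; congr (_%:R).
rewrite /sfix -[RHS](card_imset _ (@perm_inj _ tau)); apply: eq_card => x.
rewrite in_set in_setT andTb; apply/eqP/imsetP => [gx|[y]].
  have ex : tau ((tau^-1)%g x) = x by apply: permKV.
  exists ((tau^-1)%g x) => //; rewrite in_set in_setT andTb; apply/eqP/(@perm_inj _ tau).
  by rewrite -(permJ g tau) ex.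
by rewrite in_set in_setT andTb => /eqP gy ->; rewrite permJ gy.
Qed.

(** Exchanging two blocks is odd; applying [tau] in block l0, whose factor is invariant under the
    twist, restores evenness. *)
Lemma mult_swap b i j l0 : i != j -> tw tau (b l0) = b l0 ->
  mult f [ffun l => b (tperm i j l)] = mult f b.
Proof.
move=> ij inv; have oF : odd #|'F_p| by rewrite cardFp.
rewrite -(mult_move Nf odd_tau oF b (s := tperm i j) (D := [set l0])); last first.
  by rewrite cards1 odd_tperm ij.
congr (mult f _); apply/ffunP=> l; rewrite !ffunE inE.
by case: eqP => // ->.
Qed.

(* The factors of a tensor product other than 1 and the character of degree p - 1. *)
Definition stars b := [set l | (b l != 0) && (b l != st)].
Definition stds b := [set l | b l == st].
Definition ones b := [set l | b l == 0].

Lemma card_word b : (#|stars b| + #|stds b| + #|ones b| = #|I|)%N.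
Proof.
rewrite /stars /stds /ones -!sum1dep_card -sum1_card.
rewrite [X in (X + _ + _)%N]big_mkcond [X in (_ + X + _)%N]big_mkcond [X in (_ + _ + X)%N]big_mkcond.
rewrite -!big_split /=; apply: eq_bigr => l _.
have [->|n0] := eqVneq (b l) 0; first by rewrite eq_sym (negbTE st0).
by case: (b l == st).
Qed.

(** A tensor product containing a tuple with no trivial entry has no factor 1. *)
Lemma no_ones : (0 < m)%N -> exists b, (0 < mult f b)%N /\ ones b = set0.
Proof.
move=> m0; have := sum_weights (fun=> 1) => E.
have [/existsP[b /andP[Mb /eqP ob]]|/existsPn no] :=
  boolP [exists b, (0 < mult f b)%N && (ones b == set0)]; first by exists b.
move: m0; rewrite -E big1 // => b _; have := no b; rewrite negb_and -eqn0Ngt.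
case/orP=> [/eqP->|]; first by rewrite mul0n.
case/set0Pn=> l; rewrite inE => /eqP bl.
by rewrite (bigD1 l) //= bl dn0 // oner_eq0 mul0n muln0.
Qed.

(** What moving two 3-cycles into one block gives. It is kept as a predicate because its proofs for
    p >= 7 and for p = 5 differ. *)
Definition two_std := forall b i j, (0 < mult f b)%N -> i != j -> b i = st -> b j = st ->
  exists2 b', agree i j b b' & (0 < mult f b')%N && ((i \in stars b') || (j \in stars b')).

Lemma two_std_step b : two_std -> (0 < mult f b)%N -> (1 < #|stds b|)%N ->
  exists2 b', (0 < mult f b')%N &
    (#|stars b| < #|stars b'|)%N /\ (#|ones b'| <= #|ones b|.+1)%N /\ (#|stds b| <= #|stds b'|.+2)%N.
Proof.
move=> tst Mb /card_gt1P[i [j []]]; rewrite !inE => /eqP bi /eqP bj ij.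
have [b' ag /andP[Mb' sij]] := tst b i j Mb ij bi bj.
have agE l : l != i -> l != j -> b' l = b l.
  by move=> li lj; have /forallP/(_ l) := ag; rewrite (negbTE li) (negbTE lj) => /eqP.
exists b' => //.
have [k kij ks] : exists2 k, k \in [:: i; j] & k \in stars b'.
  by case/orP: sij => ks; [exists i | exists j] => //; rewrite !inE eqxx ?orbT.
have out b'' l : b'' l != st -> b'' = b -> (l != i) && (l != j).
  by move=> bl E; move: bl; rewrite E; apply: contraR; rewrite negb_and !negbK => /orP[]/eqP->; rewrite ?bi ?bj.
split; last split.
- apply: proper_card; apply/properP; split.
    apply/subsetP=> l; rewrite !inE => /andP[l0 ls].
    by have /andP[li lj] := out b l ls erefl; rewrite agE // l0.
  exists k => //; rewrite inE negb_and !negbK; apply/orP; right.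
  by move: kij; rewrite !inE => /orP[]/eqP->; rewrite ?bi ?bj.
- have k1 : b' k != 0 by move: ks; rewrite inE => /andP[].
  apply: (@leq_trans #|(if k == i then j else i) |: ones b|); last first.
    by rewrite cardsU1 -add1n leq_add2r; case: (_ \notin _).
  apply: subset_leq_card; apply/subsetP=> l; rewrite !inE => /eqP l0.
  have [li|li] := eqVneq l i.
    move: kij; rewrite !inE; case: eqP => [ki|_ /eqP kj]; last by rewrite li eqxx.
    by move: k1; rewrite ki -li l0 eqxx.
  have [lj|lj] := eqVneq l j; last by rewrite -agE // l0 eqxx orbT.
  move: kij; rewrite !inE; case: eqP => [ki|_ /eqP kj]; first by rewrite lj eqxx.
  by move: k1; rewrite kj -lj l0 eqxx.
have : stds b \subset [set i; j] :|: stds b'.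
  apply/subsetP=> l; rewrite !inE; have [//|li] := eqVneq l i; have [//|lj] := eqVneq l j.
  by rewrite agE.
move/subset_leq_card => /leq_trans; apply; apply: leq_trans (leq_card_setU _ _) _.
by rewrite cards2 ij.
Qed.

(** A word without factors 1 and with at most one star has at least four standard factors. Each step
    uses at most two of them, adds a star and creates at most one factor 1, so two steps are
    possible and suffice. *)
Lemma many_stars : two_std -> (0 < m)%N -> (4 < #|I|)%N ->
  exists2 b, (0 < mult f b)%N & (1 < #|stars b|)%N && (#|ones b| <= 2)%N.
Proof.
move=> tst m0 I5; have [b [Mb ob]] := no_ones m0.
have cb := card_word b; rewrite ob cards0 addn0 in cb.
have [c2|c1] := ltnP 1 #|stars b|; first by exists b => //; rewrite c2 ob cards0.
have s4 : (4 <= #|stds b|)%N by move: cb c1 I5; clear; lia.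
have [b1 Mb1 [lt1 [o1 s1]]] := two_std_step tst Mb (leq_trans (isT : 1 < 4)%N s4).
rewrite ob cards0 in o1.
have [c2|c1'] := ltnP 1 #|stars b1|; first by exists b1; rewrite ?c2 ?(leq_trans o1).
have s2 : (1 < #|stds b1|)%N by move: s4 s1; clear; lia.
have [b2 Mb2 [lt2 [o2 _]]] := two_std_step tst Mb1 s2.
exists b2 => //; rewrite (leq_trans _ lt2) ?(leq_trans o2) //.
by rewrite ltnS (leq_ltn_trans (leq0n _) lt1).
Qed.

End Words.

Lemma sfix_cyc33 (T : finType) (S : {set T}) a b c d e k : uniq [:: a; b; c; d; e; k] ->
  {subset [:: a; b; c; d; e; k] <= S} -> (sfix S (cyc3 a b c * cyc3 d e k)%g + 6 = #|S|)%N.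
Proof.
move=> u6 s6.
have /and3P[u3 dis u3'] : [&& uniq [:: a; b; c], ~~ has [in [:: a; b; c]] [:: d; e; k] & uniq [:: d; e; k]].
  by move: u6; rewrite -[X in uniq X]/([:: a; b; c] ++ [:: d; e; k]) cat_uniq.
have s3 : {subset [:: a; b; c] <= S}.
  by move=> x xs; apply: s6; rewrite -[X in x \in X]/([:: a; b; c] ++ [:: d; e; k]) mem_cat xs.
have s3' : {subset [:: d; e; k] <= S}.
  by move=> x xs; apply: s6; rewrite -[X in x \in X]/([:: a; b; c] ++ [:: d; e; k]) mem_cat xs orbT.
have nin x : x \in [:: d; e; k] -> x \notin [:: a; b; c] by move=> xs; move/hasPn: dis => /(_ x xs).
rewrite -(sfix_cyc3 u3 s3) (addnA _ 3 3); congr (_ + _)%N.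
rewrite {2}/sfix -(cardsID [set x in [:: d; e; k]]) addnC; congr (_ + _)%N.
  rewrite -[LHS](card_uniqP u3'); apply: eq_card => x; rewrite in_setI !in_set.
  have [xs|//] := boolP (x \in [:: d; e; k]); last by rewrite andbF.
  by rewrite s3' // (cyc3_D (nin x xs)) eqxx.
apply: eq_card => x; rewrite in_setD !in_set.
have [xs|nx] := boolP (x \in [:: d; e; k]).
  rewrite s3' // (permM _ (cyc3 d e k)) (cyc3_D (nin x xs)) /=; move: xs.
  have [/negbTE de /negbTE dk /negbTE ek] := uniq3 u3'.
  rewrite !in_cons in_nil orbF => /or3P[]/eqP->.
  - by rewrite cyc3_1 // eq_sym de.
  - by rewrite cyc3_2 // eq_sym ek.
  by rewrite cyc3_3 // dk.
rewrite (permM _ (cyc3 d e k)) cyc3_D //=.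
apply: contra nx => cx; have [cxE|ncx] := boolP (x \in [:: a; b; c]); last first.
  by move: cx; rewrite cyc3_D.
have := nin _ cx; move: cxE; rewrite !in_cons !in_nil !orbF => /or3P[]/eqP->.
- by rewrite cyc3_1 // eqxx orbT.
- by rewrite cyc3_2 // eqxx !orbT.
by rewrite cyc3_3 // eqxx.
Qed.

(** * Primes greater than 5 *)

Section LargePrime.

Variables (p : nat) (w : algC).
Hypotheses (pr : prime p) (pw : p.-primitive_root w) (p2 : odd p) (p7 : (7 <= p)%N).
Local Notation A := (altS [set: 'F_p]).
Variable st : Iirr A.
Hypothesis st0 : st != 0.
Hypothesis stE : {in A, forall g, (sfix setT g)%:R = 1 + 'chi_st g}.

Variables (I : finType) (m : nat) (f : {perm I * 'F_p} -> algC).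
Hypothesis Nf : charon (altS setT) f.
Hypothesis f1 : f 1%g = (m * p ^ #|I|)%:R.
Hypothesis f0 : forall a : {ffun I -> 'F_p}, a != [ffun=> 0] -> f (blk [ffun l => tr (a l)]) = 0.
Implicit Types (b : {ffun I -> Iirr A}) (l i j : I).

Let p5 : (4 < p)%N. Proof. exact: leq_trans p7. Qed.

(* If no star occurred in block i, putting both 3-cycles into that block would make zval of
   the slice vanish, against the contribution of the two standard characters. *)
Lemma two_std_large : two_std st f.
Proof.
move=> b i j Mb ij bi bj.
have [/existsP[b' /and3P[ag Mb' sb']]|/existsPn no] :=
  boolP [exists b', [&& agree i j b b', (0 < mult f b')%N & i \in stars st b']].
  by exists b'; rewrite ?Mb' ?sb'.
have X5 : (5 <= #|'F_p|)%N by rewrite card_Fp.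
have c6 : (6 <= #|[set: 'F_p]|)%N by rewrite cardsT card_Fp // ltnW.
have [a [c [d [a' [c' [d' [u6 _]]]]]]] := sextuple c6.
have sT (T : finType) (s : seq T) : {subset s <= [set: T]} by move=> x _; rewrite inE.
have u3 : uniq [:: a; c; d] by move: u6; rewrite -[X in uniq X]/([:: a; c; d] ++ _) cat_uniq => /andP[].
have u3' : uniq [:: a'; c'; d'].
  by move: u6; rewrite -[X in uniq X]/([:: a; c; d] ++ _) cat_uniq => /and3P[].
have := pslice_zval Nf b ij X5 u3 u3'; set Z := zval _ _ _ _ _ _ _ => ZE.
have Zpos : 0 < Z.
  rewrite ZE (bigD1 b) /=; last by apply/forallP=> l; rewrite eqxx orbT.
  apply: ltr_wpDr.
    by apply: sumr_ge0 => b' _; rewrite mulr_ge0 // mulr_ge0 // chi_cyc3_le.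
  have gen x y z : uniq [:: x; y; z] -> 'chi_st 1%g - 'chi_st (cyc3 x y z) = 3%:R.
      move=> u; have E := stE (cyc3_alt u (sT _ _)); have E1 := stE (group1 _).
      have := sfix_cyc3 u (sT _ _); rewrite -(sfix1 setT) => /(congr1 (fun n => n%:R : algC)).
      rewrite natrD E E1 => /eqP; rewrite -addrA (inj_eq (addrI 1)) => /eqP <-; ring.
  by rewrite bi bj !gen // !mulr_gt0 ?ltr0n.
suffices Z0 : Z = 0 by rewrite Z0 ltxx in Zpos.
have Sin l (s : seq 'F_p) : l \in [:: i; j] -> {subset [seq (l, x) | x <- s] <= pair_set 'F_p i j}.
  by rewrite !inE => lij t /mapP[x _ ->]; rewrite inE.
have us l (s : seq 'F_p) : uniq s -> uniq [seq (l, x) | x <- s].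
  by move=> us; rewrite map_inj_uniq // => x y [].
have u6i := us i _ u6; have S6i := Sin i [:: a; c; d; a'; c'; d'] (mem_head _ _).
rewrite /Z (zval_const (pslice_char Nf i j b) (a' := (i, a)) (b' := (i, c)) (c' := (i, d))
  (d' := (i, a')) (e' := (i, c')) (k' := (i, d'))) //; last first.
- move=> t; rewrite -[X in t \in X]/([seq (i, x) | x <- [:: a; c; d]] ++ [seq (j, x) | x <- [:: a'; c'; d']]).
  by rewrite mem_cat => /orP[]; apply: Sin; rewrite !inE eqxx ?orbT.
- rewrite -[X in uniq X]/([seq (i, x) | x <- [:: a; c; d]] ++ [seq (j, x) | x <- [:: a'; c'; d']]).
  rewrite cat_uniq !us //= andbT !inE !xpair_eqE ![j == i]eq_sym (negbTE ij) //.
have Ac := cyc3_alt u3 (sT _ _); have Ac' := cyc3_alt u3' (sT _ _).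
have zE : zval (pslice f i j b) (i, a) (i, c) (i, d) (i, a') (i, c') (i, d') =
   \sum_(b' | agree i j b b') (mult f b')%:R * (zval 'chi_(b' i) a c d a' c' d' * 'chi_(b' j) 1%g).
  have p1 : 1%g = blk (pt i j (1%g : {perm 'F_p}) 1%g).
    by apply/permP=> -[l z]; rewrite blkE ffunE; case: ifP => _; [|case: ifP => _]; rewrite !perm1.
  have p2' : (blk (pt i j (cyc3 a c d) 1) * blk (pt i j (cyc3 a' c' d') 1))%g =
      blk (pt i j (cyc3 a c d * cyc3 a' c' d')%g 1%g).
    rewrite -blkM ?pt_K ?group1 //; congr blk; apply/ffunP=> l; rewrite !ffunE.
    by case: ifP => // _; case: ifP => _; rewrite mulg1.
  rewrite /zval -!(blk_pt1 i j) p2' p1 !pslice_blk ?group1 ?(groupM Ac Ac') //.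
  rewrite mulr_sumr -sumrN -!big_split /=; apply: eq_bigr => b' _; rewrite /zval; ring.
rewrite zE big1 // => b' ag.
have := no b'; rewrite ag /= negb_and -eqn0Ngt => /orP[/eqP->|]; first by rewrite mul0r.
rewrite inE negb_and !negbK; suffices z0 : (b' i == 0) || (b' i == st) -> zval 'chi_(b' i) a c d a' c' d' = 0.
  by move/z0->; rewrite mul0r mulr0.
case/orP=> /eqP->.
  by rewrite /zval irr0 !cfun1E group1 Ac (groupM Ac Ac'); ring.
have E1 := stE (group1 _); have Ec := stE Ac; have Ecc := stE (groupM Ac Ac').
have F1 := sfix_cyc3 u3 (sT _ _); have F2 := sfix_cyc33 u6 (sT _ _).
rewrite /zval; have g2 (x y : algC) (n q : nat) : n%:R = 1 + x -> y = x -> (n + q = #|[set: 'F_p]|)%N ->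
    y = #|[set: 'F_p]|%:R - q%:R - 1.
  by move=> nE -> <-; rewrite natrD nE; ring.
rewrite (g2 _ _ _ 0%N E1 erefl) ?addn0 ?sfix1 // (g2 _ _ _ _ Ec erefl F1) (g2 _ _ _ _ Ecc erefl F2).
by ring.
Qed.

(** Exchanging a star with a standard factor gives that many further tensor products, all with the
    multiplicity of b. For one tuple [lam] each of them weighs at least 1 and b itself at least 2 to
    the number of stars. *)
Lemma swap_count b : (0 < mult f b)%N ->
  (#|stars st b| * #|stds st b| + 2 ^ #|stars st b| <= m)%N.
Proof.
move=> Mb; have sd (i : Iirr A) := star_dn pr pw p2 p5 st0 stE (i := i) p7.
pose d2 (i : Iirr A) : 'F_p := odflt 1 [pick j | (j != 0) && (1 < dn w i j)%N].
have d20 (i : Iirr A) : d2 i != 0.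
  by rewrite /d2; case: pickP => [j /andP[]|_] //=; apply: oner_neq0.
have d22 (i : Iirr A) : i != 0 -> i != st -> (1 < dn w i (d2 i))%N.
  move=> i0 ist; rewrite /d2; case: pickP => [j /andP[]|/= no] //=.
  by have [_ [j j0 j1]] := sd i i0 ist; have := no j; rewrite j0 j1.
(* At a star this is a nontrivial character of multiplicity at least two. The exchanged words keep
   positive weight because stars and [st] contain every nontrivial character. *)
pose lam l := if b l == 0 then 0 else d2 (b l).
pose sw (u : I * I) : {ffun I -> Iirr A} := [ffun l => b (tperm u.1 u.2 l)].
pose P := setX (stars st b) (stds st b).
have swI : {in P &, injective sw}.
  move=> [i j] [i' j'] /setXP[si sj] /setXP[si' sj'] /= /ffunP E.
  have star_neq l l' : l \in stars st b -> l' \in stds st b -> b l != b l'.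
    by rewrite !inE => /andP[_ ls] /eqP->.
  have ii : i = i'.
    have := E i; rewrite !ffunE /= tpermL; case: tpermP => [->//|ij _|_ _ bij].
      by move: sj' si; rewrite -ij !inE => ->; rewrite andbF.
    by have := star_neq i j si sj; rewrite -bij eqxx.
  have := E j; rewrite ii !ffunE /= tpermR; case: tpermP => [ji|-> //|_ _ bij].
    by move: si' sj; rewrite -ji !inE => /andP[_ /negbTE->].
  by have := star_neq i' j si' sj; rewrite bij eqxx.
have swb : b \notin sw @: P.
  apply/imsetP=> -[[i j] /setXP[si sj] /ffunP/(_ i)]; rewrite ffunE /= tpermL => bij.
  by move: si sj; rewrite !inE bij => /andP[_ /negbTE->].
apply: leq_trans (le_weights pr pw p2 Nf f1 f0 lam (b |: sw @: P)).
rewrite big_setU1 //= addnC leq_add //.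
  apply: leq_trans (_ : 1 * 2 ^ #|stars st b| <= _)%N; first by rewrite mul1n.
  apply: leq_mul => //; rewrite -prod_nat_const big_mkcond; apply: leq_prod => l _.
  rewrite inE /lam; have [->|b0] /= := eqVneq (b l) 0; first by rewrite dn0 // eqxx.
  have [->|bs] /= := eqVneq (b l) st; first by rewrite dn_st // d20.
  exact: d22.
rewrite big_imset //= -cardsX -sum1_card; apply: leq_sum => -[i j] /setXP[si sj].
have ij : i != j by apply: contraTneq si => ->; move: sj; rewrite !inE => ->; rewrite andbF.
have bj : b j = st by apply/eqP; move: sj; rewrite inE.
have -> : mult f (sw (i, j)) = mult f b.
  by apply: (mult_swap pr p2 Nf ij (l0 := j)); rewrite bj (tw_st stE).
rewrite muln_gt0 Mb /=.
apply/prodn_gt0 => l; rewrite ffunE /=.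
have [bi0 bis] : b i != 0 /\ b i != st by move: si; rewrite inE => /andP[].
case: tpermP => [->|->|_ _].
- by rewrite bj dn_st // /lam (negbTE bi0) d20.
- by rewrite /lam bj (negbTE st0); have [pos _] := sd _ bi0 bis; apply: pos.
rewrite /lam; have [->|b0] /= := eqVneq (b l) 0; first by rewrite dn0 // eqxx.
have [->|bs] /= := eqVneq (b l) st; first by rewrite dn_st // d20.
exact: ltnW (d22 _ b0 bs).
Qed.

(** One star already weighs 2, so there is none; but some word has no factor 1, hence both factors
    standard, and [two_std] then produces a star. *)
Lemma large_pair : #|I| = 2 -> m = 1%N -> False.
Proof.
move=> I2 m1; have nostar b : (0 < mult f b)%N -> stars st b = set0.
  move=> Mb; apply/eqP; rewrite -cards_eq0; move: (swap_count Mb); rewrite m1.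
  case: #|stars st b| => // c; rewrite expnS; have := expn_gt0 2 c; clear; nia.
have m0 : (0 < m)%N by rewrite m1.
have [b [Mb ob]] := no_ones pr pw p2 Nf f1 f0 m0.
have := card_word st0 b; rewrite (nostar b) // ob !cards0 addn0 add0n I2 => s2.
have s1 : (1 < #|stds st b|)%N by rewrite s2.
have [b' Mb' [lt _]] := two_std_step two_std_large Mb s1.
by move: lt; rewrite (nostar b') // cards0.
Qed.

Lemma large_square : #|I| = p -> m = p -> False.
Proof.
move=> Ip mp; have m0 : (0 < m)%N by rewrite mp ltnW // prime_gt1.
have I5 : (4 < #|I|)%N by rewrite Ip.
have [b Mb /andP[c2 o2]] := many_stars pr pw p2 st0 Nf f1 f0 two_std_large m0 I5.
have := swap_count Mb; have := card_word st0 b; rewrite Ip mp; move: c2 o2 p7.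
move: #|stars st b| #|stds st b| #|ones b| => c s o; clear.
move=> c2 o2 p7 E; apply/negP; rewrite -ltnNge.
(* With o <= 2 the count cs + 2^c exceeds p as soon as (c - 1)p > c^2 + 2c - 2^c. This is the case p
   = 7, and it implies the larger ones. *)
have e (c' : nat) : (c'.+2 * c'.+2 + 2 * c'.+2 + 7 < 2 ^ c'.+2 + 7 * c'.+2)%N.
  elim: c' => // n; have := ltn_expl n (isT : 1 < 2)%N; rewrite !expnS; lia.
have cE : (c - 2).+2 = c by move: c2; clear; lia.
have {e} := e (c - 2)%N; rewrite cE => e.
have h : (c * s + c * c + c * o = c * p)%N by rewrite -!mulnDr -E; congr (_ * _)%N; lia.
have h1 : (c * o <= c * 2)%N by rewrite leq_mul2l o2 orbT.
have h2 : ((c - 1) * 7 <= (c - 1) * p)%N by rewrite leq_mul2l p7 orbT.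
have h3 : ((c - 1) * p = c * p - p)%N by rewrite mulnBl mul1n.
have h4 : (p <= c * p)%N by rewrite leq_pmull // ltnW.
clear -e h h1 h2 h3 h4 c2; move: (2 ^ c)%N (c * s)%N (c * o)%N (c * p)%N ((c - 1) * p)%N (c * c)%N e h h1 h2 h3 h4 => z x y u v q; lia.
Qed.

End LargePrime.

(** * The prime 5 *)

(* Twice the values, in terms of the fixed points of g and g ^+ 2, of four characters of Alt(5):
   the degrees are 1, 4, 5 and 6, the last one being the exterior square of the second. *)
Definition vals5 (t : nat * nat * nat * bool) : seq int :=
  let: (c1, c2, _, _) := t in let x := c1%:Z in let y := c2%:Z in
  [:: 2; 2 * (x - 1); x * x + y - 4 * x; x * x - y - 2 * x + 2].

Definition val5 (k : nat) (g : {perm 'I_5}) : algC := (nth 0 (vals5 (pctype g)) k)%:~R / 2%:R.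

Lemma vals5_orth : all (fun k => all (fun l =>
  foldr +%R 0 [seq (if b.1.2 then 0 else b.2%:Z * (nth 0 (vals5 b.1) k * nth 0 (vals5 b.1) l)) | b <- table5] ==
   (if k == l then (if k == 3 then 480 else 240) else 0)) (iota 0 4)) (iota 0 4).
Proof. by vm_compute. Qed.

Local Notation A5 := (altS [set: 'I_5]).

Lemma card_A5 : #|A5| = 60%N.
Proof.
have := @card_altS _ [set: 'I_5]; rewrite cardsT card_ord => /(_ isT) E.
by apply/eqP; rewrite -(@eqn_pmul2l 2) // E.
Qed.

Lemma val5_dot (k l : nat) : (k < 4)%N -> (l < 4)%N ->
  dotf A5 (val5 k) (val5 l) = (if k == l then (if k == 3 then 2%:R else 1) else 0).
Proof.
move=> k4 l4.
pose F (t : nat * nat * nat * bool) : algC := (if t.2 then 0 else nth 0 (vals5 t) k * nth 0 (vals5 t) l)%:~R / 4%:R.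
rewrite /dotf card_A5.
have -> : \sum_(g in A5) val5 k g * (val5 l g)^* = \sum_(g in [set: {perm 'I_5}]) F (pctype g).
  rewrite big_mkcond [RHS]big_mkcond; apply: eq_bigr => g _; rewrite in_altT inE /F.
  have -> : (pctype g).2 = odd_perm g by [].
  case: (odd_perm g); first by rewrite mulr0z mul0r.
  rewrite /val5 /F fmorph_div /= rmorph_int rmorph_nat rmorphM /=; by field.
rewrite sum_ctype table5E.
have -> : \sum_(b <- table5) b.2%:R * F b.1 =
    (foldr +%R 0 [seq (if b.1.2 then 0 else b.2%:Z * (nth 0 (vals5 b.1) k * nth 0 (vals5 b.1) l)) | b <- table5])%:~R / 4%:R.
  elim: table5 => [|b s IH]; first by rewrite big_nil mul0r.
  rewrite big_cons IH /= /F rmorphD mulrDl; congr (_ + _).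
  by case: ifP => _; rewrite ?mulr0z ?mul0r ?mulr0 // rmorphM /= mulrA.
have /allP/(_ k) := vals5_orth; rewrite mem_iota => /(_ k4)/allP/(_ l).
rewrite mem_iota => /(_ l4)/eqP->.
case: eqP => _; last by rewrite mul0r mulr0.
have n60 : 60%:R != 0 :> algC by rewrite pnatr_eq0.
have n4 : 4%:R != 0 :> algC by rewrite pnatr_eq0.
by case: eqP => _; rewrite [_%:~R](rmorph_nat intr) ?(natrM _ 60 8) ?(natrM _ 60 4) mulrA mulKf // ?divff // (natrM _ 4 2) [4%:R * _]mulrC mulfK.
Qed.

Lemma val5E g : [/\ val5 0 g = 1, val5 1 g = (pfix g)%:R - 1,
  val5 2 g = ((pfix g ^ 2)%:R + (pfix (g ^+ 2)%g)%:R) / 2%:R - (pfix g)%:R - (pfix g)%:R &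
  val5 3 g = (pfix g)%:R * (pfix g)%:R - ((pfix g ^ 2)%:R + (pfix (g ^+ 2)%g)%:R) / 2%:R - (pfix g)%:R + 1].
Proof.
rewrite /val5 pctypeE /= !natrX; split.
- by rewrite divff // pnatr_eq0.
- by rewrite rmorphM rmorphB /= rmorph1; field.
- by rewrite !(rmorphD, rmorphM, rmorphB, rmorphN) /=; field.
by rewrite !(rmorphD, rmorphM, rmorphB, rmorphN) /=; field.
Qed.

(** The two characters of degree 3 have irrational values and are not described separately: only
    their sum, the exterior square [val5 3] of norm two, is computed. *)
Lemma irr5 : exists F a b : Iirr A5, exists st : Iirr A5,
  [/\ uniq [:: 0; st; F; a; b] , forall i, i \in [:: 0; st; F; a; b],
      {in A5, 'chi_st =1 val5 1},
      {in A5, 'chi_F =1 val5 2} &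
      [/\ 'chi_a 1%g = 3%:R, 'chi_b 1%g = 3%:R & {in A5, forall g, 'chi_a g + 'chi_b g = val5 3 g}]].
Proof.
have p1 : pfix (1%g : {perm 'I_5}) = 5.
  by rewrite /pfix (_ : [set x | _] = setT) ?cardsT ?card_ord //; apply/setP=> x; rewrite !inE perm1 eqxx.
have V1 : vcharon A5 (fun=> 1) by apply: vcharon_charon; apply: charon_1.
have VX : vcharon A5 (fun g => (pfix g)%:R) by apply: vcharon_charon; apply: charon_pfix.
have VH := vcharon_charon (charon_sym2 A5).
have Vs : vcharon A5 (val5 1).
  by apply: vcharon_ext (vcharonB VX V1) => g _; have [_ -> _ _] := val5E g.
have VF : vcharon A5 (val5 2).
  by apply: vcharon_ext (vcharonB (vcharonB VH VX) VX) => g _; have [_ _ -> _] := val5E g.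
have VL : vcharon A5 (val5 3).
  by apply: vcharon_ext (vcharonD (vcharonB (vcharonB (vcharonM VX VX) VH) VX) V1) => g _; have [_ _ _ ->] := val5E g.
have [_ s1 F1 L1] := val5E 1%g.
rewrite !expg1n p1 in s1 F1 L1.
have {}s1 : val5 1 1%g = 4%:R by rewrite s1; ring.
have {}F1 : val5 2 1%g = 5%:R by rewrite F1; field.
have {}L1 : val5 3 1%g = 6%:R by rewrite L1; field.
have [st stE] := vcharon_irr Vs (val5_dot (isT : (1 < 4)%N) (isT : (1 < 4)%N)) (ltac:(by rewrite s1 ltr0n)).
have [F FE] := vcharon_irr VF (val5_dot (isT : (2 < 4)%N) (isT : (2 < 4)%N)) (ltac:(by rewrite F1 ltr0n)).
have [phi Zphi LE] := VL.
have zE : {in A5, val5 0 =1 'chi[A5]_0}.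
  by move=> g Ag; have [-> _ _ _] := val5E g; rewrite irr0 cfun1E Ag.
have neq k l i j : (k < 4)%N -> (l < 4)%N -> (k != l)%N -> {in A5, val5 k =1 'chi_i} -> {in A5, val5 l =1 'chi[A5]_j} -> i != j.
  move=> k4 l4 kl kE lE; have := val5_dot k4 l4; rewrite (eq_dotf kE lE) dotfE cfdot_irr (negbTE kl).
  by case: (i == j) => // /eqP; rewrite oner_eq0.
have n0s : 0 != st by apply: (neq 0%N 1%N).
have n0F : 0 != F by apply: (neq 0%N 2%N).
have nsF : st != F by apply: (neq 1%N 2%N).
have cphi k i : (k < 3)%N -> {in A5, val5 k =1 'chi_i} -> '[phi, 'chi_i] = 0.
  move=> k3 kE; rewrite -dotfE -(eq_dotf LE kE) val5_dot //; first by case: k k3 {kE} => [|[|[|]]].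
  exact: ltn_trans k3 _.
have c0 := cphi 0%N 0 isT zE; have cs := cphi 1%N st isT stE; have cF := cphi 2%N F isT FE.
pose c i := '[phi, 'chi_i]; pose D i := 'chi[A5]_i 1%g.
pose R := [pred i : Iirr A5 | [&& i != 0, i != st & i != F]].
have split_R (G : Iirr A5 -> algC) : \sum_i G i = G 0 + G st + G F + \sum_(i | R i) G i.
  rewrite (bigD1 0) // (bigD1 st) 1?eq_sym //= (bigD1 F) /=; last by rewrite eq_sym n0F eq_sym.
  by rewrite !addrA; congr (_ + _); apply: eq_bigl => i; rewrite /= andbA.
have cZ i : c i \in Num.int by apply: Cint_cfdot_vchar_irr.
have SD : \sum_(i | R i) D i ^+ 2 = 18%:R.
  have := irr_sum_square A5; rewrite split_R card_A5 -!(zE, stE, FE) ?group1 // s1 F1.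
  have [-> _ _ _] := val5E 1%g => E; apply: (addrI (1 ^+ 2 + 4%:R ^+ 2 + 5%:R ^+ 2)).
  by rewrite E expr1n -!natrX -[1]/(1%:R) -!natrD.
have ScD : \sum_(i | R i) c i * D i = 6%:R.
  have := cfun_sum_cfdot phi => /cfunP/(_ 1%g); rewrite -LE ?group1 // L1 sum_cfunE.
  rewrite (eq_bigr (fun i => c i * D i)) => [|i _]; last by rewrite cfunE.
  by rewrite split_R /c c0 cs cF !mul0r !add0r.
have Sc : \sum_(i | R i) c i ^+ 2 = 2%:R.
  have := val5_dot (isT : (3 < 4)%N) (isT : (3 < 4)%N); rewrite (eq_dotf LE LE) dotfE => E.
  have <- : '[phi] = 2%:R by exact: E.
  rewrite cfdot_sum_irr split_R c0 cs cF !mul0r !add0r; apply: eq_bigr => i _.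
  by rewrite -/(c i) (conj_intr (cZ i)) expr2.
(* For the remaining irreducibles, 60 - 1 - 16 - 25 = 18 is the sum of squared degrees, 6 the degree
   and 2 the norm of the exterior square, so the squares of D - 3c sum to 18 - 36 + 18 = 0. *)
have D3c : forall i, R i -> D i = 3%:R * c i.
  have /eqP : \sum_(i | R i) (D i - 3%:R * c i) ^+ 2 = 0.
    rewrite (eq_bigr (fun i => D i ^+ 2 - 6%:R * (c i * D i) + 9%:R * c i ^+ 2)) => [|i _]; last by ring.
    by rewrite big_split sumrB -!mulr_sumr SD ScD Sc /=; ring.
  rewrite psumr_eq0 => [/allP all0 i Ri|i Ri]; last first.
    rewrite real_exprn_even_ge0 // rpredB //; first by rewrite ger0_real // ltW // irr1_gt0.
    by rewrite rpredM ?rpred_nat // Rreal_int // cZ.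
  by have /implyP/(_ Ri) := all0 i (mem_index_enum i); rewrite expf_eq0 /= subr_eq0 => /eqP.
have c1 i : R i -> c i = 1.
  move=> Ri; have ci0 : 0 < c i.
    by have := irr1_gt0 i; rewrite -/(D i) D3c // pmulr_rgt0 // ltr0n.
  have /natrP[m mE] : c i \in Num.nat by rewrite natrEint cZ ltW.
  have : c i ^+ 2 <= 2%:R.
    rewrite -Sc (bigD1 i) //= lerDl sumr_ge0 // => j /andP[Rj _].
    by rewrite real_exprn_even_ge0 // Rreal_int //; apply: cZ.
  move: ci0; rewrite mE -natrX ltr0n ler_nat; case: m {mE} => [|[|m]] // _; clear; nia.
have R2 : #|[set i | R i]| = 2.
  apply/eqP; rewrite -(eqr_nat algC) -Sc -sum1_card natr_sum; apply/eqP/esym.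
  by apply: eq_big => i; rewrite ?inE // => Ri; rewrite c1 // expr1n.
have /cards2P[a [b [nab ab]]] := introT eqP R2.
have Rab i : R i = (i == a) || (i == b) by have := in_set R i; rewrite ab !inE => <-.
have Ra : R a by rewrite Rab eqxx.
have Rb : R b by rewrite Rab eqxx orbT.
exists F, a, b, st; split=> [|i|||] //.
- have [/and3P[a0 as_ aF] /and3P[b0 bs bF]] := (Ra, Rb).
  by rewrite /= !inE !negb_or n0s n0F nsF nab ![_ == a]eq_sym ![_ == b]eq_sym a0 as_ aF b0 bs bF.
- rewrite !inE; have := Rab i; rewrite /=.
  by case: eqP => //= _; case: eqP => //= _; case: eqP.
- by move=> g Ag; rewrite stE.
- by move=> g Ag; rewrite FE.
split=> [||g Ag]; rewrite -?/(D _) ?D3c ?c1 ?mulr1 //.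
have := cfun_sum_cfdot phi => /cfunP/(_ g); rewrite -LE // => ->; rewrite sum_cfunE.
rewrite (eq_bigr (fun i => c i * 'chi_i g)) => [|i _]; last by rewrite cfunE.
rewrite split_R /c c0 cs cF !mul0r !add0r -/(c _).
rewrite (bigD1 a) //= (bigD1 b); last by rewrite [X in X && _]Rb eq_sym.
rewrite big1 => [|i /andP[/andP[Ri ia] ib]]; last by have E : R i := Ri; rewrite Rab (negbTE ia) (negbTE ib) in E.
by rewrite -!/(c _) !c1 // !mul1r /= addr0.
Qed.

Section LettersFive.

Variables (w : algC).
Hypothesis pw : 5.-primitive_root w.
Local Notation A := (altS [set: 'F_5]).
Variable st : Iirr A.
Hypothesis stE : {in A, forall g, (sfix setT g)%:R = 1 + 'chi_st g}.
Implicit Types (i : Iirr A) (j x : 'F_5).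

Let pr : prime 5. Proof. by []. Qed.

Lemma sum_F5 (V : nmodType) (G : 'F_5 -> V) : \sum_j G j = G 0 + G 1 + G 2%:R + G 3%:R + G 4%:R.
Proof.
have e : index_enum 'F_5 = [:: 0; 1; 2%:R; 3%:R; 4%:R].
  apply: (inj_map val_inj); rewrite -[LHS]/(map val (index_enum 'I_5)).
  by rewrite /index_enum unlock -enumT val_enum_ord.
by rewrite e !big_cons big_nil addr0 !addrA.
Qed.

Lemma odd_dil2 (n0 : (2%:R : 'F_5) != 0) : odd_perm (dil n0).
Proof.
have -> : dil n0 = (tperm (1%R : 'F_5) (2%:R : 'F_5) * tperm (1%R : 'F_5) (4%:R : 'F_5) * tperm (1%R : 'F_5) (3%:R : 'F_5))%g.
  apply/permP=> x; rewrite !permM [LHS]permE !permE /=.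
  by apply/eqP; case: x => [[|[|[|[|[|x]]]]] lx] //=; apply/eqP/val_inj; vm_compute.
by rewrite !odd_permM !odd_tperm.
Qed.

Lemma pfix_tr x : x != 0 -> pfix (tr x) = 0%N.
Proof.
move=> x0; apply/eqP; rewrite cards_eq0; apply/eqP/setP=> y.
by rewrite !inE trE -subr_eq0 addrK (negbTE x0).
Qed.

Lemma val5_tr x : x != 0 -> val5 2 (tr x) = 0 /\ val5 3 (tr x) = 1.
Proof.
move=> x0; have [_ _ -> ->] := val5E (tr x : {perm 'I_5}).
rewrite (pfix_tr x0) (_ : pfix ((tr x : {perm 'I_5}) ^+ 2)%g = 0%N).
  by split; field.
have -> : ((tr x : {perm 'I_5}) ^+ 2 = tr (x + x))%g by rewrite trD.
by apply: pfix_tr; case: x x0 => [[|[|[|[|[|x]]]]]].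
Qed.

Lemma dl_const (f : {perm 'F_5} -> algC) j (y z : algC) :
  f 1%g = y -> (forall x, x != 0 -> f (tr x) = z) ->
  dl w f j = (y - z) / 5%:R + z * (j == 0)%:R.
Proof.
move=> f1 fx; rewrite /dl /dotf cardsT card_Fp //.
rewrite (eq_bigr (fun a => z * ew w (- a * j) + (if a == 0 then y - z else 0))) => [|a _]; last first.
  rewrite -(ewV pr pw) mulNr [a * j]mulrC; have [->|a0] := eqVneq a 0.
    by rewrite mulr0 oppr0 ew0 tr0 f1; ring.
  by rewrite fx // addr0.
rewrite (eq_bigl xpredT) => [|a]; last by rewrite inE.
rewrite big_split /= -mulr_sumr -(big_mkcond (fun a => a == 0)) big_pred1_eq.
rewrite (reindex_inj oppr_inj) /=; under eq_bigr do rewrite opprK.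
by rewrite (sum_ew pr pw); move: ((j == 0)%:R : algC) => b; field.
Qed.

(** On the translations [F] is regular, while [a] and [b] consist of the trivial character and the
    two characters indexed by one coset of squares, {1, 4} for [a]. An odd permutation exchanges [a]
    and [b]. *)
Definition letters (F a b : Iirr A) : Prop :=
  [/\ uniq [:: 0; st; F; a; b], forall i, i \in [:: 0; st; F; a; b],
      {in A, forall g, 'chi_F g = val5 2 g},
      [/\ forall j, dn w F j = 1%N, dn w a 0 = 1%N, dn w b 0 = 1%N & dn w a 1 = 1%N /\ dn w b 1 = 0%N] &
      [/\ tw (tperm 0 1 : {perm 'F_5}) a = b, tw (tperm 0 1 : {perm 'F_5}) b = a &
          tw (tperm 0 1 : {perm 'F_5}) F = F]].

Lemma irrF5 : exists F a b st' : Iirr A,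
  [/\ uniq [:: 0; st'; F; a; b], forall i : Iirr A, i \in [:: 0; st'; F; a; b],
      {in A, forall g, 'chi_st' g = val5 1 g}, {in A, forall g, 'chi_F g = val5 2 g} &
      [/\ 'chi_a 1%g = 3%:R, 'chi_b 1%g = 3%:R & {in A, forall g, 'chi_a g + 'chi_b g = val5 3 g}]].
Proof. exact: irr5. Qed.

Lemma letters_exist : exists F a b, letters F a b.
Proof.
have [F [a [b [st' [u all5 sE FE [a1 b1 abE]]]]]] := irrF5.
have p1 : pfix (1%g : {perm 'F_5}) = 5%N.
  by rewrite /pfix (_ : [set x | _] = setT) ?cardsT ?card_Fp //; apply/setP=> x; rewrite !inE perm1 eqxx.
have ss : st' = st.
  apply: irr_inj; apply/cfun_inP=> g Ag; rewrite sE //.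
  have [_ -> _ _] := val5E g; rewrite (_ : pfix g = sfix setT g) ?stE; [ring|by []|].
  by apply: eq_card => x; rewrite !inE.
subst st'.
have [_ _ F1 L1] := val5E (1%g : {perm 'I_5}).
rewrite !expg1n p1 in F1 L1.
have {}F1 : 'chi_F 1%g = 5%:R by rewrite FE ?group1 // F1; field.
have dF j : dn w F j = 1%N.
  apply/eqP; rewrite -(eqr_nat algC) (dnE pr pw isT); apply/eqP.
  rewrite (dl_const j F1 (z := 0)) => [|x x0]; first by rewrite subr0 mul0r addr0 divff ?pnatr_eq0.
  by rewrite FE ?tr_alt // (val5_tr x0).1.
have dab j : (dn w a j + dn w b j = 1 + (j == 0%R))%N.
  apply/eqP; rewrite -(eqr_nat algC) !natrD !(dnE pr pw isT); apply/eqP.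
  rewrite /dl /dotf -mulrDr -big_split /=.
  transitivity (dl w (fun g => 'chi_a g + 'chi_b g) j).
    by congr (_ * _); apply: eq_bigr => x _; rewrite mulrDl.
  rewrite (dl_const j (y := 6%:R) (z := 1)) ?mul1r.
  - by congr (_ + _); field.
  - by rewrite abE ?group1 // L1; field.
  by move=> x x0; rewrite abE ?tr_alt // (val5_tr x0).2.
have n2 : (2%:R : 'F_5) != 0 by [].
have deg (c : Iirr A) : 'chi_c 1%g = 3%:R -> (dn w c 0%R + 2 * dn w c 1%R + 2 * dn w c 2%:R%R = 3)%N.
  have e4 : 2%:R * (2%:R * 1) = 4%:R :> 'F_5 by apply: val_inj.
  have e3 : 2%:R * (2%:R * 2%:R) = 3%:R :> 'F_5 by apply: val_inj.
  have := dn_square w pr isT c 1 n2; have := dn_square w pr isT c 2%:R n2; rewrite e3 e4.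
  rewrite (dn_sum pr pw isT) => E3 E4 /eqP; rewrite eqr_nat sum_F5 E3 E4 => /eqP.
  by clear; rewrite /=; lia.
have da := deg a a1; have db := deg b b1.
have dab0 := dab 0; have dab1 := dab 1; have dab2 := dab 2%:R; rewrite eqxx in dab0.
rewrite oner_eq0 addn0 in dab1; rewrite (negbTE n2) addn0 in dab2.
have [a0 [b0 na]] : dn w a 0 = 1%N /\ dn w b 0 = 1%N /\ dn w a 1 != dn w a 2%:R.
  by move: da db dab0 dab1 dab2; clear; lia.
pose tau : {perm 'F_5} := tperm 0 1.
have otau : odd_perm tau by apply: odd_tau.
have tw1 i : 'chi_(tw tau i) 1%g = 'chi_i 1%g by rewrite twE // conj1g.
have twF : tw tau F = F.
  apply: irr_inj; apply/cfun_inP=> g Ag; rewrite twE // !FE ?altJ //.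
  have [_ _ -> _] := val5E (g : {perm 'I_5}); have [_ _ -> _] := val5E ((g ^ tau)%g : {perm 'I_5}).
  have pJ (h : {perm 'I_5}) : pfix (h ^ tau)%g = pfix h.
    rewrite /pfix -[RHS](card_imset _ (@perm_inj _ tau)); apply: eq_card => x.
    rewrite in_set; apply/eqP/imsetP => [hx|[y]].
      exists ((tau^-1)%g x); last by rewrite permKV.
      by rewrite in_set; apply/eqP/(@perm_inj _ tau); rewrite -(permJ h tau) permKV.
    by rewrite in_set => /eqP hy ->; rewrite permJ hy.
  by rewrite -conjXg !pJ.
have tw3 (c : Iirr A) : 'chi_c 1%g = 3%:R -> tw tau c \in [:: a; b].
  move=> c1; have := all5 (tw tau c); rewrite !inE.
  have T1 := tw1 c; rewrite c1 in T1; case: eqP => [E|_].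
    by move/eqP: T1; rewrite E irr0 cfun11 (eqr_nat _ 1 3).
  case: eqP => [E|_].
    move/eqP: T1; rewrite E; have := stE (group1 A); rewrite sfix1 cardsT card_Fp //.
    by move/eqP; rewrite addrC -subr_eq -(natrB _ (isT : (1 <= 5)%N)) => /eqP <-; rewrite eqr_nat.
  case: eqP => [E|_] //.
  by move/eqP: T1; rewrite E F1 eqr_nat.
have twK i : tw tau (tw tau i) = i.
  by apply: irr_inj; apply/cfun_inP=> g Ag; rewrite !twE ?altJ // -conjgM tperm2 conjg1.
(* Multiplication by 2 is an odd permutation of the five points. A twist-invariant character would
   be invariant under it and have equal multiplicities at 1 and 2, against [na]. *)
have nfix : tw tau a != a.
  apply: contra na => /eqP taa; rewrite -(eqr_nat algC) !(dnE pr pw isT); apply/eqP.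
  have trx x : 'chi_a (tr (2%:R * x)) = 'chi_a (tr x).
    pose h := (dil n2 * tau^-1)%g.
    have Ah : h \in A by rewrite in_altT odd_permM odd_permV otau odd_dil2.
    have Ax : (tr x ^ h)%g \in A by rewrite groupJ ?tr_alt.
    rewrite -(tr_dil n2) (_ : dil n2 = h * tau)%g; last by rewrite mulgKV.
    rewrite conjgM -twE // taa.
    by rewrite (charonJ (charon_irr a)) ?tr_alt.
  rewrite /dl /dotf [in LHS](reindex_inj (mulfI n2)) /=; congr (_ * _).
  apply: eq_big => [x|x _]; first by rewrite !inE.
  by rewrite trx mul1r.
have twa : tw tau a = b.
  by have := tw3 a a1; rewrite !inE (negbTE nfix) => /eqP.
have twb : tw tau b = a by rewrite -twa twK.
have [da1|da1] : (dn w a 1 = 1%N /\ dn w b 1 = 0%N) \/ (dn w b 1 = 1%N /\ dn w a 1 = 0%N).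
- by move: dab1; clear; lia.
- by exists F, a, b; split.
exists F, b, a; split=> // [|i]; last by have := all5 i; rewrite !inE => /or4P[->|->|->|/orP[]->]; rewrite ?orbT.
rewrite -(perm_uniq (s1 := [:: 0; st; F] ++ [:: a; b])) //.
by rewrite -[X in perm_eq _ X]/([:: 0; st; F] ++ [:: b; a]) perm_cat2l (perm_catC [:: a] [:: b]).
Qed.

End LettersFive.

Lemma odd_card (T : finType) (P : pred T) : odd #|[set l | P l]| = \big[addb/false]_l P l.
Proof.
rewrite -sum1_card (big_morph _ oddD (erefl _)) [LHS]big_mkcond.
by apply: eq_bigr => l _; rewrite inE; case: ifP.
Qed.

(* The letters of the alternating group of degree five are coded as 0 (trivial), 1 (degree 4),
   2 (degree 5) and 3, 4 (degree 3, swapped by odd permutations). A letter restricted to a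
   5-cycle contains the trivial character iff it is in [:: 0; 2; 3; 4], and a fixed nontrivial
   one iff it is in [:: 1; 2; 3]. *)
Fixpoint codes (k z : nat) : seq (seq nat) :=
  if k is k'.+1 then [seq c :: x | c <- if (0 < z)%N then [:: 0; 2; 3; 4] else [:: 1; 2; 3],
                                   x <- codes k' z.-1]%N
  else [:: [::]].

Lemma codesP k z x : x \in codes k z ->
  size x = k /\ forall l, (l < k)%N -> nth 0%N x l \in (if l < z then [:: 0; 2; 3; 4] else [:: 1; 2; 3])%N.
Proof.
elim: k z x => [|k IH] z x; first by rewrite inE => /eqP->.
case/allpairsP=> -[c y] [cz /IH[sy yz] ->] /=; split; first by rewrite sy.
by case=> [|l] lk //=; have := yz l lk; case: (z).
Qed.

Lemma codes_uniq k z : uniq (codes k z).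
Proof.
elim: k z => // k IH z; apply: (@allpairs_uniq _ _ _ cons) => //; first by case: ifP.
by move=> [c x] [c' x'] _ _ [-> ->].
Qed.

(** The two letters of degree 3 are counted together, because an odd permutation inside a block
    exchanges them. *)
Definition key (x : seq nat) : seq nat :=
  [:: count_mem 0 x; count_mem 1 x; count_mem 2 x; count (leq 3) x]%N.

Definition key_tables (k : nat) : seq (seq (seq nat)) :=
  [seq map key (codes k z) | z <- iota 0 k.+1].

Definition all_keys (k : nat) : seq (seq nat) :=
  [seq q <- [seq [:: c.1.1; c.1.2; c.2; (k - c.1.1 - c.1.2 - c.2)%N]
    | c <- [seq (u, l) | u <- [seq (i, j) | i <- iota 0 k.+1, j <- iota 0 k.+1], l <- iota 0 k.+1]]
  | sumn q == k].

Lemma key_all k x : size x = k -> key x \in all_keys k.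
Proof.
move=> <-; have e : (count_mem 0 x + count_mem 1 x + count_mem 2 x + count (leq 3) x)%N = size x.
  elim: x => // c x IH; rewrite -[size (c :: x)]/((size x).+1) -IH /=.
  by case: c => [|[|[|c]]] /=; lia.
have io P : count P x \in iota 0 (size x).+1 by rewrite mem_iota ltnS count_size.
rewrite mem_filter; apply/andP; split; first by rewrite /key /= addn0 !addnA e.
apply/mapP; exists (count_mem 0%N x, count_mem 1%N x, count_mem 2%N x); last first.
  by congr [:: _; _; _; _]; rewrite /= -e -!subnDA addnA addKn.
apply/allpairsP; exists (count_mem 0%N x, count_mem 1%N x, count_mem 2%N x); split; [| exact: io | by []].
by apply/allpairsP; exists (count_mem 0%N x, count_mem 1%N x); split; [exact: io | exact: io |].
Qed.

(* More than m tensor products with key q contain a common tuple of characters of the 5-cycles. *)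
Definition refuted (t : seq (seq (seq nat))) (m : nat) (q : seq nat) : bool :=
  has (fun s => m < count_mem q s)%N t.

(** Among words with a star, counting leaves only the square of the letter of degree 5. *)
Lemma refuted2 : let t := key_tables 2 in
  all (fun q => (0 < nth 0 q 2 + nth 0 q 3)%N ==> (refuted t 1 q || (q == [:: 0; 0; 2; 0]%N))) (all_keys 2).
Proof. by vm_compute. Qed.

(* Keys of the tensor products with at least two stars and at most two factors 1, and one more
   key that occurs in the slice of a tensor product 2, 2, 2, 2, 0. *)
Definition weak5 (q : seq nat) : bool :=
  ((1 < nth 0 q 2 + nth 0 q 3) && (nth 0 q 0 <= 2))%N || (q == [:: 3; 0; 2; 0]%N).

Lemma refuted5 : let t := key_tables 5 in all (fun q => weak5 q ==>
    (refuted t 5 q || (q \in [:: [:: 0; 0; 5; 0]; [:: 0; 1; 4; 0]; [:: 1; 0; 4; 0]]%N))) (all_keys 5).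
Proof. by vm_compute. Qed.

Section FiveWords.

Variables (w : algC).
Hypothesis pw : 5.-primitive_root w.
Local Notation A := (altS [set: 'F_5]).
Variable st : Iirr A.
Hypothesis st0 : st != 0.
Hypothesis stE : {in A, forall g, (sfix setT g)%:R = 1 + 'chi_st g}.
Variables F a b : Iirr A.
Hypothesis L : letters w st F a b.
Variables (k m : nat) (f : {perm 'I_k * 'F_5} -> algC).
Hypothesis k1 : (1 < k)%N.
Hypothesis Nf : charon (altS setT) f.
Hypothesis f1 : f 1%g = (m * 5 ^ #|'I_k|)%:R.
Hypothesis f0 : forall x : {ffun 'I_k -> 'F_5}, x != [ffun=> 0] -> f (blk [ffun l => tr (x l)]) = 0.
Implicit Types (v : {ffun 'I_k -> Iirr A}) (l : 'I_k) (x : seq nat).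

Let tau : {perm 'F_5} := tperm 0 1.
Let pr : prime 5. Proof. by []. Qed.
Local Notation ls := [:: 0; st; F; a; b].

Let in_ls i : i \in ls. Proof. by have [_ all5 _ _ _] := L; apply: all5. Qed.
Let ls_uniq : uniq ls. Proof. by have [u _ _ _ _] := L. Qed.

Lemma tw_ls i : tw tau i = i \/ i \in [:: a; b].
Proof.
have [_ all5 _ _ [_ _ twF]] := L; have := all5 i; rewrite !inE.
case/or4P=> [/eqP->|/eqP->|/eqP->|->]; [left | left | by left; exact: twF | by right].
- exact: tw_0.
- exact: tw_st.
Qed.

Lemma tw_ab i : i \in [:: a; b] -> tw tau i \in [:: a; b].
Proof.
have [_ _ _ _ [twa twb _]] := L.
by rewrite !inE => /orP[]/eqP->; rewrite ?twa ?twb eqxx ?orbT.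
Qed.

(** [mult_move] applies when the parity of s matches the number of twisted blocks. If it does not,
    either some letter is invariant under the twist and its block can be toggled, or all letters are
    [a] or [b]. In the latter case the parity of the number of twists depends only on the two words,
    so composing s with a transposition repairs it. *)
Lemma mult_same v1 v2 (s : {perm 'I_k}) :
  (forall l, v2 l = v1 (s l) \/ v2 l = tw tau (v1 (s l))) -> mult f v2 = mult f v1.
Proof.
have oF : odd #|'F_5| by rewrite card_Fp.
have ot : odd_perm tau by apply: odd_tau.
have move_s (s' : {perm 'I_k}) (D : {set 'I_k}) :
    (forall l, v2 l = if s' l \in D then tw tau (v1 (s' l)) else v1 (s' l)) ->
    odd_perm s' = odd #|D| -> mult f v2 = mult f v1.
  move=> vE oD; rewrite -(mult_move Nf ot oF v1 oD); congr (mult f _).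
  by apply/ffunP=> l; rewrite ffunE vE.
move=> s12; pose D (s' : {perm 'I_k}) := [set l | v2 ((s'^-1)%g l) != v1 l].
have DE (s' : {perm 'I_k}) : (forall l, v2 l = v1 (s' l) \/ v2 l = tw tau (v1 (s' l))) ->
    forall l, v2 l = if s' l \in D s' then tw tau (v1 (s' l)) else v1 (s' l).
  by move=> E l; rewrite inE permK; case: eqP => [//|ne] /=; case: (E l).
have [oE|oN] := eqVneq (odd_perm s) (odd #|D s|); first by apply: move_s (DE s s12) oE.
have [/existsP[l0 /eqP inv]|/existsPn no] := boolP [exists l, tw tau (v1 l) == v1 l].
  pose D' := if l0 \in D s then D s :\ l0 else l0 |: D s.
  apply: (move_s s D') => [l|].
    rewrite /D'; case: (l0 \in D s); rewrite !inE; have [E|ne] := eqVneq (s l) l0;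
      by rewrite (DE s s12) ?E ?inv ?if_same // ?inE.
  move: oN; rewrite /D'; case: (boolP (l0 \in D s)) => l0D; last by rewrite cardsU1 l0D add1n oddS; case: (odd_perm s); case: (odd _).
  by rewrite (cardsD1 l0 (D s)) l0D add1n oddS; case: (odd_perm s); case: (odd _).
have ab1 l : v1 l \in [:: a; b].
  by have [E|] := tw_ls (v1 l); [have := no l; rewrite E eqxx|].
have ab2 l : v2 l \in [:: a; b] by have [->|->] := s12 l; [exact: ab1 | apply: tw_ab; exact: ab1].
have nab : a != b by move: ls_uniq; rewrite /= !inE; case: (a == b); rewrite ?andbF.
have ab12 (s' : {perm 'I_k}) l : v2 l = v1 (s' l) \/ v2 l = tw tau (v1 (s' l)).
  have [_ _ _ _ [twa twb _]] := L; move: (ab1 (s' l)) (ab2 l); rewrite !inE.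
  by move=> /orP[]/eqP-> /orP[]/eqP->; rewrite ?twa ?twb; [left|right|right|left].
have oD (s' : {perm 'I_k}) : odd #|D s'| = (\big[addb/false]_l (v2 l == a)) (+) (\big[addb/false]_l (v1 l == a)).
  rewrite odd_card [X in _ = X (+) _](reindex_inj (@perm_inj _ (s'^-1)%g)) -big_split /=.
  apply: eq_bigr => l _; move: (ab1 l) (ab2 ((s'^-1)%g l)); rewrite !inE.
  by move=> /orP[]/eqP-> /orP[]/eqP->; rewrite ?eqxx ?(negbTE nab) // eq_sym (negbTE nab).
pose i0 : 'I_k := Ordinal (ltnW k1); pose i1 : 'I_k := Ordinal k1.
apply: (move_s (s * tperm i0 i1)%g) (DE _ (ab12 _)) _.
have n01 : i0 != i1 by [].
by rewrite odd_permM odd_tperm n01 oD -(oD s); move: oN; case: (odd_perm s); case: (odd _).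
Qed.

Definition code v : seq nat := [seq index (v l) ls | l <- enum 'I_k].

Definition tensor_word x : {ffun 'I_k -> Iirr A} := [ffun l : 'I_k => nth 0 ls (nth 0%N x l)].

Lemma size_code v : size (code v) = k. Proof. by rewrite size_map size_enum_ord. Qed.

Lemma nth_code v l : nth 0%N (code v) l = index (v l) ls.
Proof. by rewrite (nth_map l) ?size_enum_ord // nth_ord_enum. Qed.

Lemma code_word x : size x = k -> (forall l, nth 0%N x l < 5)%N -> code (tensor_word x) = x.
Proof.
move=> sx x5; apply: (@eq_from_nth _ 0%N); rewrite size_code // => i ik.
by rewrite (nth_code _ (Ordinal ik)) ffunE index_uniq.
Qed.

(** Equal keys mean that the codes agree up to order once 3 and 4 are merged, which is the situation
    of [mult_same]. *)
Lemma mult_key v1 v2 : key (code v1) = key (code v2) -> mult f v1 = mult f v2.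
Proof.
move=> kE; pose mrg (c : nat) := minn c 3.
have pe : perm_eq (map mrg (code v1)) (map mrg (code v2)).
  apply/allP => c _; apply/eqP; case: kE => e0 e1 e2 e3.
  have cm (y : seq nat) (P : pred nat) : (forall d, (mrg d == c) = P d) -> count_mem c (map mrg y) = count P y.
    by move=> cP; rewrite count_map; apply: eq_count => d; rewrite -cP.
  have [c3|c4] := leqP c 2.
    have eqc d : (mrg d == c) = pred1 c d by rewrite /mrg /=; apply/eqP/eqP; lia.
    by rewrite !(cm _ _ eqc); case: c c3 {cm eqc} => [|[|[|c]]].
  have [c3|c5] := eqVneq c 3.
    have eqc d : (mrg d == c) = leq 3 d by rewrite /mrg c3; apply/eqP/idP; lia.
    by rewrite !(cm _ _ eqc).
  have eqc d : (mrg d == c) = pred0 d by rewrite /mrg /=; apply/eqP; lia.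
  by rewrite !(cm _ _ eqc) !count_pred0.
have st' v : size (map mrg (code v)) == k by rewrite size_map size_code.
have : perm_eq (Tuple (st' v1)) (Tuple (st' v2)) by [].
move/tuple_permP => [s E]; apply/esym/(@mult_same _ _ (s^-1)%g) => l.
have Et : Tuple (st' v1) = [tuple tnth (Tuple (st' v2)) (s i) | i < k] by apply: val_inj.
have := congr1 (fun t => tnth t ((s^-1)%g l)) Et.
rewrite tnth_mktuple permKV !(tnth_nth 0%N) /=.
rewrite !(nth_map 0%N) ?size_code // !nth_code => e.
have [u _ _ _ [twa twb _]] := L.
move: (in_ls (v1 ((s^-1)%g l))) (in_ls (v2 l)) e; rewrite /mrg.
have idx : [/\ index 0 ls = 0%N, index st ls = 1%N, index F ls = 2, index a ls = 3 & index b ls = 4].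
  by split; [have := @index_uniq _ 0 0 ls|have := @index_uniq _ 0 1 ls|have := @index_uniq _ 0 2 ls|
    have := @index_uniq _ 0 3 ls|have := @index_uniq _ 0 4 ls]; apply.
have [x0 x1 x2 x3 x4] := idx.
rewrite !in_cons !in_nil !orbF => /or4P[|||/orP[]]/eqP-> /or4P[|||/orP[]]/eqP->;
  by rewrite ?x0 ?x1 ?x2 ?x3 ?x4 // => _; rewrite ?twa ?twb; (left + right).
Qed.

(** The words with the key of v that fit z entries 0 followed by entries 1 all have the multiplicity
    of v and positive weight, so by [le_weights] there are at most m of them. *)
Lemma not_refuted v : (0 < mult f v)%N -> ~~ refuted (key_tables k) m (key (code v)).
Proof.
move=> Mv; apply/negP => /hasP[s /mapP[z _ ->]].
rewrite count_map; set P := preim _ _ => lt.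
have [_ _ _ [dF da0 db0 [da1 db1]] _] := L.
pose xs := [seq x <- codes k z | P x].
have xsP x : x \in xs -> key x = key (code v) /\
    (size x = k /\ forall l, nth 0%N x l \in (if l < z then [:: 0; 2; 3; 4] else [:: 1; 2; 3])%N).
  rewrite mem_filter => /andP[/eqP kx /codesP[sx xz]]; split=> //; split=> // l.
  exact: xz (ltn_ord l).
have cw x : x \in xs -> code (tensor_word x) = x.
  move=> /xsP[_ [sx xz]]; apply: code_word => // l; have := xz l.
  by case: ifP => _; rewrite !inE; [case/or4P | case/or3P] => /eqP->.
pose B := [set y in map tensor_word xs].
pose lam (l : 'I_k) : 'F_5 := if (l < z)%N then 0 else 1.
have := le_weights pr pw isT Nf f1 f0 lam B; apply/negP; rewrite -ltnNge.
apply: (leq_trans lt); rewrite -size_filter -/xs -(size_map tensor_word).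
have uB : uniq (map tensor_word xs).
  rewrite map_inj_in_uniq ?filter_uniq ?codes_uniq // => x y xx yy E.
  by rewrite -(cw x xx) E cw.
rewrite -(card_uniqP uB) -cardsE -sum1_card; apply: leq_sum => y.
rewrite inE => /mapP[x xx ->]; have [kx [sx xz]] := xsP x xx.
rewrite muln_gt0 (@mult_key _ v) ?cw // Mv /=; apply: prodn_gt0 => l.
rewrite ffunE /lam; have := xz l; case: ifP => _; rewrite !in_cons in_nil orbF.
  case/or4P => /eqP-> /=; rewrite ?dF ?da0 ?db0 // (dn0 pr pw isT) //.
by case/or3P => /eqP-> /=; rewrite ?dF ?da1 // (dn_st pr pw isT stE).
Qed.

End FiveWords.

Lemma charon_avg3 (gT : finGroupType) (G M : {group gT}) f (c : gT) :
  charon G f -> c \in G -> c != 1%g -> (c ^+ 3 = 1)%g -> M \subset G -> M \subset 'N(<[c]>) ->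
  charon M (fun x => 3%:R^-1 * (f x + f (x * c)%g + f (x * c^-1)%g)).
Proof.
move=> Nf Gc c1 c3 sMG nM; have o3 : #[c] = 3 by apply: nt_prime_order.
have scG : <[c]>%G \subset G by rewrite cycle_subG.
have cc : (c ^+ 2 = c^-1)%g by apply: (mulIg c); rewrite -expgSr c3 mulVg.
apply: charon_ext (charon_avg scG sMG nM Nf) => x _ /=.
have e3 : <[c]> =i [:: 1; c; c^-1]%g by move=> q; rewrite cycle_traject o3 /= mulg1 -cc.
have nV : (c^-1 != 1)%g by rewrite invg_eq1.
have nc : (c != c^-1)%g.
  apply: contra c1 => /eqP E; have cc1 : (c * c = 1)%g by rewrite {2}E mulgV.
  by rewrite -c3 expgSr expgS expg1 cc1 mul1g.
rewrite -[#|_|]/#[c] o3; congr (_ * _); rewrite (eq_bigl _ _ e3) -big_uniq /=.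
  by rewrite !big_cons big_nil mulg1 addr0 addrA.
by rewrite !inE negb_or ![(1 == _)%g]eq_sym c1 nV nc.
Qed.

Lemma inverted_conj (gT : finGroupType) (e q : gT) : (q ^ e = q^-1)%g -> (q ^+ 3 = 1)%g ->
  (e * q = e ^ q^-1)%g.
Proof.
move=> qe q3; rewrite conjgE invgK mulgA; have -> : (q * e = e * q^-1)%g by rewrite -qe -conjgC.
rewrite -mulgA; congr (_ * _)%g; rewrite -invMg; apply: (mulIg (q * q)%g).
by rewrite mulVg; exact: q3.
Qed.

(** The involution t = (a b)(d e) inverts both 3-cycles, hence acts on the vectors fixed by the
    group of order nine which they generate. Each product of t with an element of this group is
    conjugate to t, so the trace of t there is f(t), bounded by the dimension, one ninth of the
    right-hand side. *)
Lemma dtr_invert (T : finType) (S : {set T}) f (a b c d e k : T) : charon (altS S) f ->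
  uniq [:: a; b; c; d; e; k] -> {subset [:: a; b; c; d; e; k] <= S} ->
  9%:R * `|f (dtr a b d e)| <= f 1%g + 4%:R * f (cyc3 a b c) + 4%:R * f (cyc3 a b c * cyc3 d e k)%g.
Proof.
move=> Nf u6 s6; have [u1 u2 s1 s2' _] := sext_facts u6 s6.
have s2 : {subset [:: d; e; k] <= S} by move=> x /s2'; rewrite inE => /andP[].
set s := cyc3 a b c; set s' := cyc3 d e k; set t := dtr a b d e.
have [sV s'E s'V C [E1 E2 E3]] := sext_inv Nf u6 s6.
have perm4 : perm_eq [:: a; b; c; d; e; k] ([:: a; b; d; e] ++ [:: c; k]).
  by rewrite !perm_cons -[X in perm_eq X _]/([:: c] ++ [:: d; e] ++ [:: k]) perm_catCA.
have u4 : uniq [:: a; b; d; e] by move: u6; rewrite (perm_uniq perm4) cat_uniq => /andP[].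
have s4 : {subset [:: a; b; d; e] <= S}.
  by move=> x xs; apply: s6; rewrite (perm_mem perm4) mem_cat xs.
have [ta tb td te] := dtrE u4.
have tc : t c = c.
  by apply: dtr_out; move: u6; rewrite (perm_uniq perm4) cat_uniq /= => /and3P[_ /norP[]].
have tk : t k = k.
  by apply: dtr_out; move: u6; rewrite (perm_uniq perm4) cat_uniq /= => /and3P[_ /norP[_ /norP[]]].
have rot x y z : uniq [:: x; y; z] -> cyc3 y x z = (cyc3 x y z)^-1%g.
  move=> u; have [xy xz yz] := uniq3 u; rewrite cyc3V // -(@cyc3_rot _ x z y).
    by rewrite -(@cyc3_rot _ z y x) //= !inE !negb_or [z == y]eq_sym [z == x]eq_sym [y == x]eq_sym xy xz yz.
  by rewrite /= !inE !negb_or [z == y]eq_sym xy xz yz.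
have st : (s ^ t = s^-1)%g by rewrite cyc3J ta tb tc rot.
have s't : (s' ^ t = s'^-1)%g by rewrite cyc3J td te tk rot.
have Ss : s \in altS S by apply: cyc3_alt.
have Ss' : s' \in altS S by apply: cyc3_alt.
have St : t \in altS S by apply: dtr_alt.
have Css' : commute s s'.
  apply: (altS_commute (A := [set x in [:: a; b; c]]) (B := S :\: [set x in [:: a; b; c]])).
  - by rewrite disjoints_subset; apply/subsetP=> x; rewrite !inE => ->.
  - by apply: cyc3_alt => // x; rewrite !inE.
  - exact: cyc3_alt.
have cyc_norm (x y : {perm T}) : (y ^ x \in <[y]>)%g -> x \in 'N(<[y]>)%g.
  by move=> yx; rewrite inE -cycleJ cycle_subG.
have N1 : <<[set t; s']>>%G \subset 'N(<[s]>).
  rewrite gen_subG; apply/subsetP=> x /set2P[]->; apply: cyc_norm.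
    by rewrite st groupV cycle_id.
  by rewrite conjgE Css' mulKg cycle_id.
have N2 : <[t]>%G \subset 'N(<[s']>) by rewrite cycle_subG; apply: cyc_norm; rewrite s't groupV cycle_id.
have sM1 : <<[set t; s']>>%G \subset altS S.
  by rewrite gen_subG; apply/subsetP=> x /set2P[]->.
have M1s' : s' \in <<[set t; s']>> by rewrite mem_gen // !inE eqxx orbT.
have M1t : <[t]>%G \subset <<[set t; s']>>%G by rewrite cycle_subG mem_gen // !inE eqxx.
have Nf1 := charon_avg3 Nf Ss (cyc3_neq1 u1) (cyc3_exp3 u1) sM1 N1.
have Nf2 := charon_avg3 Nf1 M1s' (cyc3_neq1 u2) (cyc3_exp3 u2) M1t N2.
have := charon_norm Nf2 (cycle_id t).
have conj_t q : q \in altS S -> (q ^ t = q^-1)%g -> (q ^+ 3 = 1)%g -> f (t * q)%g = f t.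
  by move=> Sq qt q3; rewrite (inverted_conj qt q3) (charonJ Nf) ?groupV.
have cq (x y : {perm T}) : commute x y -> (x ^+ 3 = 1)%g -> (y ^+ 3 = 1)%g -> ((x * y) ^+ 3 = 1)%g.
  by move=> xy x3 y3; rewrite expgMn // x3 y3 mulg1.
have s3 := cyc3_exp3 u1; have s'3 := cyc3_exp3 u2.
have sV3 : (s^-1 ^+ 3 = 1)%g by rewrite expgVn s3 invg1.
have s'V3 : (s'^-1 ^+ 3 = 1)%g by rewrite expgVn s'3 invg1.
have sVt : (s^-1 ^ t = s^-1^-1)%g by rewrite conjVg st.
have s'Vt : (s'^-1 ^ t = s'^-1^-1)%g by rewrite conjVg s't.
have pairs x y : (x \in [:: s'; s'^-1] -> y \in [:: s; s^-1] -> f (t * x * y) = f t)%g.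
  move=> xs ys; have [Sx xt x3] : [/\ x \in altS S, (x ^ t = x^-1)%g & (x ^+ 3 = 1)%g].
    have /orP[/eqP->|/eqP->] : (x == s') || (x == s'^-1%g) by move: xs; rewrite !inE.
      by [].
    by split; rewrite ?groupV.
  have [Sy yt y3] : [/\ y \in altS S, (y ^ t = y^-1)%g & (y ^+ 3 = 1)%g].
    have /orP[/eqP->|/eqP->] : (y == s) || (y == s^-1%g) by move: ys; rewrite !inE.
      by [].
    by split; rewrite ?groupV.
  have cxy : commute x y.
    move: xs ys; rewrite !inE => /orP[]/eqP-> /orP[]/eqP->; do ?[apply: commuteV];
      apply: commute_sym; do ?[apply: commuteV]; exact: Css'.
  by rewrite -mulgA conj_t ?groupM ?cq // conjMg xt yt -invMg cxy.
rewrite !mul1g !pairs ?inE ?eqxx ?orbT // !conj_t ?groupV //.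
rewrite C E1 E2 E3 sV s'E s'V; move: (f t) (f s) (f (s * s')%g) (f 1%g) => x y z v.
have n3 : 3%:R != 0 :> algC by rewrite pnatr_eq0.
have -> : 3%:R^-1 * (3%:R^-1 * (x + x + x) + 3%:R^-1 * (x + x + x) + 3%:R^-1 * (x + x + x)) = x by field.
have -> : 3%:R^-1 * (3%:R^-1 * (v + y + y) + 3%:R^-1 * (y + z + z) + 3%:R^-1 * (y + z + z)) =
  (v + 4%:R * y + 4%:R * z) / 9%:R by field.
by rewrite ler_pdivlMr ?ltr0n // mulrC.
Qed.

Lemma blk_pt_dtr (I X : finType) (i j : I) (a b c d : X) :
  blk (pt i j (dtr a b c d) 1%g) = dtr (i, a) (i, b) (i, c) (i, d).
Proof.
transitivity (emb i (dtr a b c d)); last by rewrite /emb pextM !pext_tperm.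
by apply/permP=> -[l z]; rewrite blkE embE ffunE; case: ifP => // _; case: ifP => _; rewrite perm1.
Qed.

(* In the tensor square of the character of degree 5, two 3-cycles in different blocks leave a
   one-dimensional fixed space, too small for the value 5 at an inverting involution. *)
Lemma no_tensor_square (F : Iirr (altS [set: 'F_5])) (I : finType) (i j : I) (g : {perm I * 'F_5} -> algC) n :
  {in altS [set: 'F_5], forall x, 'chi_F x = val5 2 x} -> i != j -> (0 < n)%N ->
  charon (altS (pair_set 'F_5 i j)) g ->
  {in altS [set: 'F_5] &, forall u v, g (blk (pt i j u v)) = n%:R * ('chi_F u * 'chi_F v)} -> False.
Proof.
move=> FE ij n0 Ng gE.
pose o (x : nat) : 'F_5 := x%:R.
have sT (s : seq 'F_5) : {subset s <= [set: 'F_5]} by move=> x _; rewrite inE.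
have u3 : uniq [:: o 0; o 1; o 2]%N by [].
have u4 : uniq [:: o 0; o 1; o 2; o 3]%N by [].
have Ac := cyc3_alt u3 (@sT _); have At := dtr_alt u4 (@sT _).
have tE := dtrE u4; have tO := @dtr_out _ (o 0%N) (o 1%N) (o 2%N) (o 3%N) (o 4%N) isT.
have enum5 (P : 'F_5 -> Prop) : P (o 0%N) -> P (o 1%N) -> P (o 2%N) -> P (o 3%N) -> P (o 4%N) -> forall x, P x.
  move=> p0 p1 p2 p3 p4; case=> [[|[|[|[|[|x]]]]] lx] //.
  - by rewrite (_ : Ordinal lx = o 0%N) //; apply: val_inj.
  - by rewrite (_ : Ordinal lx = o 1%N) //; apply: val_inj.
  - by rewrite (_ : Ordinal lx = o 2%N) //; apply: val_inj.
  - by rewrite (_ : Ordinal lx = o 3%N) //; apply: val_inj.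
  - by rewrite (_ : Ordinal lx = o 4%N) //; apply: val_inj.
have F1 : 'chi_F 1%g = 5%:R.
  have p1 : pfix (1%g : {perm 'F_5}) = 5%N.
    by rewrite /pfix (_ : [set x | _] = setT) ?cardsT ?card_Fp //; apply/setP=> x; rewrite !inE perm1 eqxx.
  rewrite FE ?group1 //; have [_ _ -> _] := val5E (1%g : {perm 'I_5}).
  by rewrite !expg1n p1; field.
have Fc : 'chi_F (cyc3 (o 0%N) (o 1%N) (o 2%N)) = -1.
  rewrite FE //; have [_ _ -> _] := val5E (cyc3 (o 0%N) (o 1%N) (o 2%N) : {perm 'I_5}).
  have pc x y z : uniq [:: x; y; z] -> pfix (cyc3 x y z : {perm 'F_5}) = 2.
    move=> u; have := sfix_cyc3 u (@sT _); rewrite cardsT card_Fp //.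
    rewrite (_ : sfix setT _ = pfix (cyc3 x y z)); first by move/eqP; rewrite (eqn_add2r 3 _ 2) => /eqP.
    by apply: eq_card => t; rewrite !inE.
  by rewrite expgS expg1 cyc3_sq // !pc //; field.
have Ft : 'chi_F (dtr (o 0%N) (o 1%N) (o 2%N) (o 3%N)) = 1.
  rewrite FE //; have [_ _ -> _] := val5E (dtr (o 0%N) (o 1%N) (o 2%N) (o 3%N) : {perm 'I_5}).
  rewrite expgS expg1 dtr2 //.
  have -> : pfix (1%g : {perm 'F_5}) = 5%N.
    by rewrite /pfix (_ : [set x | _] = setT) ?cardsT ?card_Fp //; apply/setP=> x; rewrite !inE perm1 eqxx.
  have -> : pfix (dtr (o 0%N) (o 1%N) (o 2%N) (o 3%N)) = 1%N.
    rewrite /pfix (_ : [set x | _] = [set o 4%N]) ?cards1 //; apply/setP=> x; rewrite in_set in_set1.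
    by have [t0 t1 t2 t3] := tE; elim/enum5: x; rewrite ?t0 ?t1 ?t2 ?t3 ?tO.
  by field.
have u6 : uniq [:: (i, o 0); (i, o 1); (i, o 2); (j, o 0); (j, o 1); (j, o 2)]%N.
  by rewrite /= !inE !xpair_eqE ?eqxx !(negbTE ij).
have S6 : {subset [:: (i, o 0); (i, o 1); (i, o 2); (j, o 0); (j, o 1); (j, o 2)]%N <= pair_set 'F_5 i j}.
  by move=> x; rewrite !inE => /or4P[|||/or3P[]] /eqP->; rewrite /= eqxx ?orbT.
have := dtr_invert Ng u6 S6; apply/negP.
have -> : g (dtr (i, o 0%N) (i, o 1%N) (j, o 0%N) (j, o 1%N)) = g (dtr (i, o 0%N) (i, o 1%N) (i, o 2%N) (i, o 3%N)).
  apply: (const_dtr Ng).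
  - by rewrite /= !inE !xpair_eqE ?eqxx !(negbTE ij).
  - by rewrite /= !inE !xpair_eqE ?eqxx.
  - by move=> x; rewrite !inE => /or4P[] /eqP->; rewrite /= eqxx ?orbT.
  - by move=> x; rewrite !inE => /or4P[] /eqP->; rewrite /= eqxx ?orbT.
have -> : 1%g = blk (pt i j (1%g : {perm 'F_5}) 1%g).
  by apply/permP=> -[l z]; rewrite blkE ffunE; case: ifP => _; [|case: ifP => _]; rewrite !perm1.
rewrite -(blk_pt1 i j) -(blk_pt1 j i) (pt_sym (i := j) (j := i)) 1?eq_sym // -blk_pt // -(blk_pt_dtr i j) !gE ?group1 // Ft Fc F1.
have -> : `|n%:R * (1 * 5%:R)| = 5%:R * n%:R :> algC.
  by rewrite mul1r mulrC normrM !normr_nat.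
rewrite lt_geF // -subr_gt0 (_ : _ - _ = 36%:R * n%:R); last by ring.
by rewrite mulr_gt0 ?ltr0n.
Qed.

Lemma std_zval (T : finType) (S : {set T}) (j : Iirr (altS S)) a b c d e k :
  uniq [:: a; b; c; d; e; k] -> {subset [:: a; b; c; d; e; k] <= S} ->
  {in altS S, forall g, (sfix S g)%:R = 1 + 'chi_j g} -> zval 'chi_j a b c d e k = 0.
Proof.
move=> u6 s6 jE; have [u1 u2 s1 s2' _] := sext_facts u6 s6.
have s2 : {subset [:: d; e; k] <= S} by move=> x /s2'; rewrite inE => /andP[].
have Sc := cyc3_alt u1 s1; have Sc' := cyc3_alt u2 s2.
have E1 := jE _ (group1 _); have Ec := jE _ Sc; have Ecc := jE _ (groupM Sc Sc').
have g2 (y : algC) (n q : nat) : n%:R = 1 + y -> (n + q = #|S|)%N -> y = #|S|%:R - q%:R - 1.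
  by move=> nE <-; rewrite natrD nE; ring.
rewrite /zval (g2 _ _ _ Ec (sfix_cyc3 u1 s1)) (g2 _ _ _ Ecc (sfix_cyc33 u6 s6)).
rewrite (g2 _ _ 0%N E1) ?addn0 ?sfix1 //; ring.
Qed.

Lemma disjoint_tperm (T : finType) (a b c d : T) : uniq [:: a; b; c; d] ->
  (tperm a b * tperm c d = tperm c d * tperm a b)%g.
Proof.
rewrite /= !inE !negb_or andbT => /andP[/and3P[ab ac ad] /andP[/andP[bc bd] cd]].
by rewrite conjgC tpermJ !tpermD // eq_sym.
Qed.

(** A copy of Alt(4) on six points: (a c e)(b d k) permutes cyclically the three products of two of
    the transpositions (a b), (c d), (e k). The difference of the two sides is twelve times the
    multiplicity of a nontrivial linear character. *)
Lemma dtr_cyc33 (T : finType) (S : {set T}) f (a b c d e k : T) : charon (altS S) f ->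
  uniq [:: a; b; c; d; e; k] -> {subset [:: a; b; c; d; e; k] <= S} ->
  4%:R * f (cyc3 a b c * cyc3 d e k)%g <= f 1%g + 3%:R * f (dtr a b c d).
Proof.
move=> Nf u6 s6; have := u6; rewrite /= !inE !negb_or andbT.
case/and5P=> /and5P[ab ac ad ae ak] /and4P[bc bd be bk] /and3P[cd ce ck] /andP[de dk] ek.
have sub (s : seq T) : all (mem [:: a; b; c; d; e; k]) s -> {subset s <= S}.
  by move=> /allP ss x xs; apply/s6/ss.
pose t := dtr a b c d; pose t' := dtr c d e k; pose s := (cyc3 a c e * cyc3 b d k)%g.
have ub : uniq [:: a; c; e; b; d; k].
  by rewrite /= !inE !negb_or andbT ac ae ab ad ak ce [c == b]eq_sym bc cd ck [e == b]eq_sym be [e == d]eq_sym de ek bd bk dk.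
have [v1 v2 _ _ _] := sext_facts ub (fun x _ => in_setT x).
have nin x : x \in [:: b; d; k] -> x \notin [:: a; c; e].
  have := ub; rewrite -[X in uniq X]/([:: a; c; e] ++ [:: b; d; k]) cat_uniq => /and3P[_ /hasPn dis _].
  by move/dis.
have nin' x : x \in [:: a; c; e] -> x \notin [:: b; d; k].
  by move=> xs; apply: contraL xs => /nin.
have [s_a s_c s_e] : [/\ s a = c, s c = e & s e = a].
  split; rewrite permM ?cyc3_1 ?cyc3_2 ?cyc3_3 // cyc3_D // nin' // !inE eqxx ?orbT //.
have [s_b s_d s_k] : [/\ s b = d, s d = k & s k = b].
  split; rewrite permM [X in cyc3 b d k X]cyc3_D ?cyc3_1 ?cyc3_2 ?cyc3_3 // nin // !inE eqxx ?orbT //.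
have ts : (t ^ s = t')%g by rewrite dtrJ s_a s_b s_c s_d.
have C1 : (tperm a b * tperm c d = tperm c d * tperm a b)%g.
  by apply: disjoint_tperm; rewrite /= !inE !negb_or ab ac ad bc bd cd.
have C2 : (tperm c d * tperm e k = tperm e k * tperm c d)%g.
  by apply: disjoint_tperm; rewrite /= !inE !negb_or cd ce ck de dk ek.
have C3 : (tperm a b * tperm e k = tperm e k * tperm a b)%g.
  by apply: disjoint_tperm; rewrite /= !inE !negb_or ab ae ak be bk ek.
have tt' : (t * t' = tperm a b * tperm e k)%g.
  by rewrite /t /t' /dtr -mulgA (mulgA (tperm c d)) tperm2 mul1g.
have t't : (t' * t = tperm a b * tperm e k)%g.
  by rewrite /t /t' /dtr C1 C2 -mulgA (mulgA (tperm c d)) tperm2 mul1g C3.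
have u4 : uniq [:: a; b; c; d] by rewrite /= !inE !negb_or ab ac ad bc bd cd.
have Ss : s \in altS S.
  by apply: groupM; apply: cyc3_alt => //; apply: sub; rewrite /= !inE !eqxx ?orbT.
have cs : commute (cyc3 a c e) (cyc3 b d k).
  apply: (altS_commute (A := [set x in [:: a; c; e]]) (B := [set x in [:: b; d; k]])).
  - by rewrite disjoints_subset; apply/subsetP=> x; rewrite !in_set => /nin'.
  - by apply: cyc3_alt => // x; rewrite !inE.
  - by apply: cyc3_alt => // x; rewrite !inE.
have s3 : (s ^+ 3 = 1)%g by rewrite expgMn // !cyc3_exp3 // mulg1.
have [w [w3 w1]] := omega_exists.
have St : t \in altS S by apply: dtr_alt => //; apply: sub; rewrite /= !inE !eqxx ?orbT.
have t's : (t' ^ s = t * t')%g by rewrite dtrJ s_c s_d s_e s_k tt' C3.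
have := charon_A4_ge0 Nf St Ss (dtr_neq1 u4) (dtr2 u4) (etrans tt' (esym t't)) ts t's s3 w3.
have [x [y [z [f1E fsE fssE]]]] := data6 Nf u6 s6.
have fs : f s = f (cyc3 a b c * cyc3 d e k)%g.
  apply: (const_cyc33 Nf ub u6 _ s6); apply: sub; by rewrite /= !inE !eqxx ?orbT.
have fr : (f s)^* = f s.
  by rewrite fs fssE rmorphB rmorphM /= !rmorph_nat.
rewrite (charonV Nf Ss) fr fs -/t => A4; rewrite -subr_ge0; apply: le_trans A4 _.
have wE : w^* + (w ^+ 2)^* = -1.
  by apply: (addrI 1); rewrite -[in LHS](rmorph1 Num.conj) -!rmorphD addrA w1 rmorph0 subrr.
move: (f 1%g) (f t) (f _) wE => p q v; move: (w^*) ((w ^+ 2)^*) => y1 y2 wE.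
by rewrite -addrA -mulrDr -mulrDr wE mulrN1 mulrN.
Qed.

(** If n is not 0, a point stabiliser has fixed vectors and the character is 1 or standard. If n =
    0, the restriction is m times an irreducible character, and its norm m^2 is at most the index
    6. *)
Lemma char6_zval (T : finType) (S : {set T}) (i : Iirr (altS S)) a b c d e k (n m : nat) :
  #|S| = 6%N -> uniq [:: a; b; c; d; e; k] -> {subset [:: a; b; c; d; e; k] <= S} ->
  {in altS (S :\ k), forall g, 'chi_i g = n%:R + m%:R * ((sfix (S :\ k) g)%:R - 1)} ->
  zval 'chi_i a b c d e k = 0.
Proof.
move=> S6 u6 s6 iE; have Nf := charon_irr i; have [u1 u2 s1 s2' _] := sext_facts u6 s6.
have s2 : {subset [:: d; e; k] <= S} by move=> x /s2'; rewrite inE => /andP[].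
have Sk : k \in S by apply: s6; rewrite !inE eqxx !orbT.
have S5 : #|S :\ k| = 5%N by have := cardsD1 k S; rewrite Sk S6 => -[].
have [j [j0 jE jP]] := @sfix_irr T S ltac:(by rewrite S6).
have [j' [j'0 j'E _]] := @sfix_irr T (S :\ k) ltac:(by rewrite S5).
have {}iE : {in altS (S :\ k), forall g, 'chi_i g = n%:R + m%:R * 'chi_j' g}.
  by move=> g Sg; rewrite iE // j'E // [1 + _]addrC addrK.
have dn : dotf (altS (S :\ k)) 'chi_i (fun=> 1) = n%:R.
  rewrite /dotf (eq_bigr (fun g => n%:R + m%:R * ('chi_j' g * 1^*))) => [|g Sg]; last first.
    by rewrite iE // conjC1 !mulr1.
  rewrite big_split mulrDr avg_const -mulr_sumr mulrCA.
  rewrite -[X in _ + m%:R * X]/(dotf (altS (S :\ k)) 'chi_j' (fun=> 1)).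
  have -> : dotf (altS (S :\ k)) 'chi_j' (fun=> 1) = '['chi_j', 'chi_0].
    rewrite -dotfE; apply: eq_dotf => // g Sg.
    by rewrite irr0 cfun1E Sg.
  by rewrite cfdot_irr (negbTE j'0) mulr0 addr0.
have [n0|n0] := eqVneq n 0%N; last first.
  case: (jP i k Sk); first by rewrite dn pnatr_eq0.
    move=> ->; rewrite /zval !irr0 !cfun1E group1 (cyc3_alt u1 s1).
    by rewrite (groupM (cyc3_alt u1 s1) (cyc3_alt u2 s2)); ring.
  by move=> ->; apply: std_zval jE.
have {}iE : {in altS (S :\ k), forall g, 'chi_i g = m%:R * 'chi_j' g}.
  by move=> g Sg; rewrite iE // n0 add0r.
have SE x : (x \in S) = (x \in [:: a; b; c; d; e; k]).
  apply/idP/idP => [Sx|]; last exact: s6.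
  have /subset_leqif_cards[_ /esym] : [set x in [:: a; b; c; d; e; k]] \subset S.
    by apply/subsetP=> y; rewrite inE => /s6.
  by rewrite cardsE (card_uniqP u6) S6 eqxx => /eqP/setP/(_ x); rewrite Sx inE.
have nk x : x \in [:: a; b; c; d; e] -> x != k.
  have := u6; rewrite -[X in uniq X]/([:: a; b; c; d; e] ++ [:: k]) cat_uniq /= orbF andbT => /andP[_ nk].
  by apply: contraTneq => ->; case/andP: nk.
have sub s : all (mem [:: a; b; c; d; e]) s -> {subset s <= S :\ k}.
  move=> /allP ss x /ss xs; rewrite !inE nk // SE; move: xs; rewrite !inE.
  by case/or4P=> [->|->|->|/orP[]->]; rewrite ?orbT.
have u4 : uniq [:: a; b; c; d] by move: u6; rewrite -[X in uniq X]/([:: a; b; c; d] ++ [:: e; k]) cat_uniq => /and3P[].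
have sc : {subset [:: a; b; c] <= S :\ k} by apply: sub; rewrite /= !inE !eqxx ?orbT.
have st : {subset [:: a; b; c; d] <= S :\ k} by apply: sub; rewrite /= !inE !eqxx ?orbT.
have m6 : (m ^ 2 <= 6)%N.
  have B0 : 0 < #|altS (S :\ k)|%:R :> algC by rewrite ltr0n cardG_gt0.
  rewrite -(ler_nat algC) -(ler_pM2r B0) -!natrM -{1}S6 -card_altS_point ?S6 //.
  have nrm (H : {group {perm T}}) (l : Iirr H) : \sum_(g in H) 'chi_l g * ('chi_l g)^* = #|H|%:R.
    have := cfnorm_irr l; rewrite -dotfE /dotf => E.
    by rewrite -[LHS](mulVKf (x := #|H|%:R)) ?E ?mulr1 // pnatr_eq0 -lt0n cardG_gt0.
  rewrite natrM -(nrm _ i) -(nrm _ j') mulr_sumr.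
  rewrite [leRHS](bigID (mem (altS (S :\ k)))) /=; apply: ler_wpDr.
    by apply: sumr_ge0 => g _; rewrite mul_conjC_ge0.
  rewrite le_eqVlt; apply/orP; left; apply/eqP; apply: eq_big => [g|g Sg].
    by have [Bg|_] := boolP (g \in altS (S :\ k)); rewrite ?andbF // (subsetP (altSS (subD1set S k)) _ Bg).
  rewrite iE // (rmorphM Num.conj) (rmorph_nat Num.conj) natrX; ring.
have [x [y [z [f1E fsE fssE]]]] := data6 Nf u6 s6.
have V1 : 'chi_i 1%g = (4 * m)%:R.
  rewrite iE ?group1 //; have := j'E _ (group1 _); rewrite sfix1 S5.
  by move/eqP; rewrite addrC -subr_eq => /eqP <-; rewrite natrM; ring.
have Vc : 'chi_i (cyc3 a b c) = m%:R.
  have Bc := cyc3_alt u1 sc; rewrite iE //; have := j'E _ Bc; have := sfix_cyc3 u1 sc.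
  rewrite S5 => /eqP; rewrite (eqn_add2r 3 _ 2) => /eqP-> /eqP; rewrite addrC -subr_eq => /eqP <-.
  by ring.
have Vt : 'chi_i (dtr a b c d) <= 0.
  have Bt := dtr_alt u4 st; rewrite iE //; have := j'E _ Bt => /eqP; rewrite addrC -subr_eq => /eqP <-.
  rewrite mulr_ge0_le0 ?ler0n // subr_le0 (ler_nat _ _ 1) -(cards1 e); apply: subset_leq_card.
  have [ta tb tc td] := dtrE u4; have /and3P[ab _ _] := u4.
  have [n1 [n2 [n3 n4]]] : b != a /\ a != b /\ d != c /\ c != d.
    by move: u4; rewrite /= !inE !negb_or ![_ == a]eq_sym [d == c]eq_sym andbT => /and3P[/and3P[-> _ _] _ ->].
  apply/subsetP=> q; rewrite in_set in_setD1 SE in_set1 => /andP[/andP[qk]].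
  rewrite !inE (negbTE qk) orbF => /or4P[|||/orP[]] /eqP->; rewrite ?ta ?tb ?tc ?td ?eqxx //.
  - by rewrite (negbTE n1).
  - by rewrite (negbTE n2).
  - by rewrite (negbTE n3).
  by rewrite (negbTE n4).
(* The values at 1 and at a 3-cycle give x = 4z and y = m - 2z; the inequality of [dtr_cyc33] then
   reads 3z <= m, while m <= 2. *)
have z0 : z = 0%N.
  have h1 : (4 * m = x + 4 * y + 4 * z)%N by apply/eqP; rewrite -(eqr_nat algC) -V1 f1E.
  have h2 : (m + 2 * z = x + y)%N.
    by apply/eqP; rewrite -(eqr_nat algC) natrD -Vc fsE natrM subrK.
  have h3 : (x + z <= m + 2 * y)%N.
    have := dtr_cyc33 Nf u6 s6; rewrite V1 fssE => le.
    have := le_trans le (_ : _ <= (4 * m)%:R); rewrite gerDl mulr_ge0_le0 ?ler0n // => /(_ isT).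
    by rewrite natrM ler_pM2l ?ltr0n // lerBlDr -natrM -natrD ler_nat.
  by move: h1 h2 h3 m6; clear; nia.
by rewrite /zval f1E fsE fssE z0 !natrD !natrM; ring.
Qed.

Section TwoStdFive.

Local Notation A := (altS [set: 'F_5]).
Variable st : Iirr A.
Hypothesis stE : {in A, forall g, (sfix setT g)%:R = 1 + 'chi_st g}.
Variables (I : finType) (f : {perm I * 'F_5} -> algC).
Hypothesis Nf : charon (altS setT) f.

Let block (i : I) : {set I * 'F_5} := [set t | t.1 == i].

Lemma block_alt i j (h : {perm I * 'F_5}) : h \in altS (block i) ->
  exists2 u, u \in A & h = blk (pt i j u 1%g) /\ sfix (block i) h = sfix setT u.
Proof.
move=> Sh; have h1 x : (h (i, x)).1 = i.
  by have := altS_stable (i, x) Sh; rewrite !inE eqxx => /eqP.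
have hI : injective (fun x => (h (i, x)).2).
  move=> x y E; have : h (i, x) = h (i, y) by apply/eqP; rewrite -pair_eqE /pair_eq !h1 E !eqxx.
  by move/perm_inj => -[].
pose u := perm hI; have hE : h = emb i u.
  apply/permP=> -[l x]; rewrite embE; case: eqP => [->|/eqP li].
    by rewrite permE [h _]surjective_pairing h1.
  by apply: (altS_fix Sh); rewrite inE.
exists u; first by rewrite in_altT -(pext_odd (@pair_inj I 'F_5 i)) -/(emb i u) -hE; move: Sh; rewrite altSE => /andP[].
split.
  by rewrite hE; apply/permP=> -[l x]; rewrite blkE embE ffunE; case: ifP => // _; case: ifP => _; rewrite perm1.
rewrite /sfix -(card_imset _ (@pair_inj I 'F_5 i)); apply: eq_card => -[l x].
rewrite !in_set /=; apply/andP/imsetP => [[/eqP->]|[y]].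
  by rewrite hE embE eqxx => /eqP[ux]; exists x => //; rewrite !inE ux eqxx.
by rewrite !in_set /= => /eqP uy [-> ->]; rewrite hE embE eqxx uy.
Qed.

(* On the five points of block i the slice only involves the two characters of the doubly
   transitive action, which forces zval to vanish on any six points. *)
Lemma two_std_five : two_std st f.
Proof.
move=> b i j Mb ij bi bj.
have [/existsP[b' /and3P[ag Mb' sb']]|/existsPn no] :=
  boolP [exists b', [&& agree i j b b', (0 < mult f b')%N & i \in stars st b']].
  by exists b'; rewrite ?Mb' ?sb'.
have X5 : (5 <= #|'F_5|)%N by rewrite card_Fp.
pose o (x : nat) : 'F_5 := x%:R.
have sT (T : finType) (s : seq T) : {subset s <= [set: T]} by move=> x _; rewrite inE.
have u3 : uniq [:: o 0; o 1; o 2]%N by [].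
have := pslice_zval Nf b ij X5 u3 u3; set Z := zval _ _ _ _ _ _ _ => ZE.
have Zpos : 0 < Z.
  rewrite ZE (bigD1 b) /=; last by apply/forallP=> l; rewrite eqxx orbT.
  apply: ltr_wpDr.
    by apply: sumr_ge0 => b' _; rewrite mulr_ge0 // mulr_ge0 // chi_cyc3_le.
  have gen x y z : uniq [:: x; y; z] -> 'chi_st 1%g - 'chi_st (cyc3 x y z) = 3%:R.
      move=> u; have E := stE (cyc3_alt u (sT _ _)); have E1 := stE (group1 _).
      have := sfix_cyc3 u (sT _ _); rewrite -(sfix1 setT) => /(congr1 (fun n => n%:R : algC)).
      rewrite natrD E E1 => /eqP; rewrite -addrA (inj_eq (addrI 1)) => /eqP <-; ring.
  by rewrite bi bj !gen // !mulr_gt0 ?ltr0n.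
suffices Z0 : Z = 0 by rewrite Z0 ltxx in Zpos.
have Ng := pslice_char Nf i j b; set g := pslice f i j b in Z ZE Zpos Ng *.
pose Q := [:: (i, o 0); (i, o 1); (i, o 2); (i, o 3); (i, o 4); (j, o 0)]%N.
have uQ : uniq Q by rewrite /Q /= !inE !xpair_eqE ?eqxx !(negbTE ij).
pose S6 := [set t in Q].
have sQ : {subset Q <= S6} by move=> t tQ; rewrite in_set.
have S6s : S6 \subset pair_set 'F_5 i j.
  by apply/subsetP=> t; rewrite /Q !inE => /or4P[|||/or3P[]]/eqP->; rewrite eqxx ?orbT.
have c6 : #|S6| = 6%N by rewrite cardsE (card_uniqP uQ).
have Ng6 := charon_res (altSS S6s) Ng.
have -> : Z = zval g (i, o 0%N) (i, o 1%N) (i, o 2) (i, o 3) (i, o 4) (j, o 0%N).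
  apply: (zval_const Ng) => //.
  - by rewrite /= !inE !xpair_eqE ?eqxx !(negbTE ij).
  - by move=> t; rewrite !inE => /or4P[|||/or3P[]]/eqP->; rewrite eqxx ?orbT.
  - by move=> t /sQ/(subsetP S6s).
have S5E : S6 :\ (j, o 0%N) = block i.
  apply/setP=> -[l x]; rewrite /S6 /Q !inE !xpair_eqE /=; have [->|li] := eqVneq l i; last first.
    by case: ((l == j) && _).
  rewrite (negbTE ij) /= ?orbF.
  by case: x => [[|[|[|[|[|x]]]]] lx].
have Qj : (j, o 0%N) \in Q by rewrite /Q !inE eqxx !orbT.
have c5 : #|S6 :\ (j, o 0%N)| = 5%N by have := cardsD1 (j, o 0%N) S6; rewrite c6 sQ // => -[].
have [j' [j'0 j'E _]] := @sfix_irr _ (S6 :\ (j, o 0%N)) ltac:(by rewrite c5).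
have [n [nE gE]] := charon_dec Ng6.
rewrite (zval_dec uQ sQ gE) big1 // => r _.
have [->|nr] := eqVneq (n r) 0%N; first by rewrite mul0r.
rewrite [zval _ _ _ _ _ _ _](_ : _ = 0) ?mulr0 //.
have Nr : charon (altS (S6 :\ (j, o 0%N))) 'chi_r := charon_res (altSS (subD1set _ _)) (charon_irr r).
pose alpha := \sum_(b' | agree i j b b' && (b' i == 0)) (mult f b')%:R * 'chi_(b' j) 1%g.
pose beta := \sum_(b' | agree i j b b' && (b' i != 0)) (mult f b')%:R * 'chi_(b' j) 1%g.
have g_blk : {in altS (S6 :\ (j, o 0%N)), forall h, g h = alpha * 'chi[altS (S6 :\ (j, o 0%N))]_0 h + beta * 'chi_j' h}.
  move=> h Sh; have Sh' : h \in altS (block i) by rewrite -S5E.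
  have [u Au [hE hf]] := block_alt j Sh'.
  have jh : 'chi_j' h = 'chi_st u.
    by apply: (addrI 1); rewrite -j'E // -stE // -hf S5E.
  rewrite jh irr0 cfun1E Sh {1}hE /g pslice_blk ?group1 // (bigID (fun b' : {ffun I -> Iirr A} => b' i == 0)) /=.
  congr (_ + _); rewrite mulr_suml; apply: eq_bigr => b' /andP[ag b0].
    have b'0 : b' i = (0 : Iirr A) := eqP b0.
    have e : 'chi[A]_0 u = 1 by rewrite irr0 cfun1E Au.
    have -> : 'chi_(b' i) u = 1 by rewrite b'0; exact: e.
    by rewrite mul1r mulr1.
  have := no b'; rewrite ag /= negb_and -eqn0Ngt => /orP[/eqP->|]; first by rewrite !mul0r.
  rewrite inE negb_and !negbK (negbTE b0) /= => /eqP->.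
  by rewrite -!mulrA ['chi_st u * _]mulrC.
(* On block i the whole slice [g] is a combination of 1 and the standard character. Multiplicities
   are nonnegative, so this passes to each constituent of [g]. *)
have dot0 l : l != 0 -> l != j' -> dotf (altS (S6 :\ (j, o 0%N))) 'chi_r 'chi_l = 0.
  move=> l0 lj.
  have S0 : \sum_r' (n r')%:R * dotf (altS (S6 :\ (j, o 0%N))) 'chi[altS S6]_r' 'chi_l = 0.
    transitivity (dotf (altS (S6 :\ (j, o 0%N))) g 'chi_l).
      rewrite /dotf; under eq_bigr => r' _ do rewrite mulrCA mulr_sumr.
      rewrite -mulr_sumr exchange_big; congr (_ * _); apply: eq_bigr => h Sh.
      rewrite gE ?(subsetP (altSS (subD1set _ _)) _ Sh) // mulr_suml.
      by apply: eq_bigr => r' _; rewrite mulrA.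
    transitivity ('[alpha *: 'chi_0 + beta *: 'chi_j', 'chi[altS (S6 :\ (j, o 0%N))]_l]).
      rewrite -dotfE; apply: eq_dotf => // h Sh; rewrite g_blk // !cfunE //.
    by rewrite cfdotDl !cfdotZl !cfdot_irr ![_ == l]eq_sym (negbTE l0) (negbTE lj) !mulr0 addr0.
  have ge r' : 0 <= (n r')%:R * dotf (altS (S6 :\ (j, o 0%N))) 'chi[altS S6]_r' 'chi_l.
    rewrite mulr_ge0 ?ler0n // natr_ge0 // charon_nat //; last exact: charon_irr.
    exact: charon_res (altSS (subD1set _ _)) (charon_irr r').
  move/eqP: S0; rewrite psumr_eq0 // => /allP/(_ r (mem_index_enum r)) /=.
  by rewrite mulf_eq0 pnatr_eq0 (negbTE nr) => /eqP.
have [q [qE rE]] := charon_dec Nr.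
apply: (@char6_zval _ _ _ _ _ _ _ _ _ (q 0) (q j')) => // h Sh.
rewrite rE // (bigD1 0) // (bigD1 j') //= big1 => [|l /andP[l0 lj]]; last first.
  by rewrite qE dot0 // mul0r.
have e : 'chi[altS (S6 :\ (j, o 0%N))]_0 h = 1 by rewrite irr0 cfun1E Sh.
rewrite j'E // [1 + _]addrC addrK addr0; congr (_ + _).
by rewrite -[RHS]mulr1; congr (_ * _); exact: e.
Qed.

End TwoStdFive.

(** If no other word of positive multiplicity agrees with v outside the two blocks, the slice there
    is a multiple of the tensor square of F, which [no_tensor_square] excludes when the multiple is
    positive. *)
Lemma tensor_square_alone (F : Iirr (altS [set: 'F_5])) (I : finType) (f : {perm I * 'F_5} -> algC)
    (v : {ffun I -> Iirr (altS [set: 'F_5])}) (i j : I) : charon (altS setT) f ->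
  {in altS [set: 'F_5], forall x, 'chi_F x = val5 2 x} -> i != j -> v i = F -> v j = F ->
  (forall v', agree i j v v' -> (0 < mult f v')%N -> v' = v) -> mult f v = 0%N.
Proof.
move=> Nf FE ij vi vj alone; apply/eqP; rewrite eqn0Ngt; apply/negP => Mv.
apply: (no_tensor_square (n := mult f v) FE ij Mv (pslice_char Nf i j v)) => x y Ax Ay.
rewrite pslice_blk // (bigD1 v) /=; last by apply/forallP=> l; rewrite eqxx orbT.
rewrite vi vj big1 ?addr0 // => v' /andP[ag nv].
suff -> : mult f v' = 0%N by rewrite mul0r.
by apply/eqP; rewrite eqn0Ngt; apply: contra nv => /(alone v' ag) ->.
Qed.

Section FiveFinal.

Variables (w : algC).
Hypothesis pw : 5.-primitive_root w.
Local Notation A := (altS [set: 'F_5]).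
Variable st : Iirr A.
Hypothesis st0 : st != 0.
Hypothesis stE : {in A, forall g, (sfix setT g)%:R = 1 + 'chi_st g}.
Variables F a b : Iirr A.
Hypothesis L : letters w st F a b.

Let pr : prime 5. Proof. by []. Qed.
Local Notation ls := [:: 0; st; F; a; b].

Let all_ls i : i \in ls. Proof. by have [_ all5 _ _ _] := L; apply: all5. Qed.
Let ls_uniq : uniq ls. Proof. by have [u _ _ _ _] := L. Qed.
Let FE : {in A, forall x, 'chi_F x = val5 2 x}. Proof. by have [_ _ FE _ _] := L. Qed.

Section Counts.

Variable k : nat.
Implicit Types (v : {ffun 'I_k -> Iirr A}).

Lemma count_code v (P : pred nat) : count P (code st F a b v) = #|[set l | P (index (v l) ls)]|.
Proof. by rewrite count_map -sum1_count big_enum_cond /= sum1dep_card. Qed.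

Lemma key_ones v : nth 0%N (key (code st F a b v)) 0 = #|ones v|.
Proof.
rewrite /= count_code; apply: eq_card => l; rewrite !in_set /=.
by rewrite [RHS]eq_sym; case: (0 == v l).
Qed.

Lemma key_stars v : (nth 0 (key (code st F a b v)) 2 + nth 0 (key (code st F a b v)) 3 = #|stars st v|)%N.
Proof.
rewrite /= -count_predUI [X in (_ + X)%N](eq_count (a2 := pred0)); last first.
  by move=> c /=; case: eqP => [->|].
rewrite count_pred0 addn0 count_code; apply: eq_card => l; rewrite !in_set /=.
rewrite [v l == 0]eq_sym [v l == st]eq_sym.
by case: (0 == v l) => //; case: (st == v l) => //; case: (F == v l).
Qed.

Lemma word_code v : tensor_word st F a b k (code st F a b v) = v.
Proof. by apply/ffunP=> l; rewrite ffunE nth_code nth_index. Qed.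

End Counts.

(** The surviving keys are represented by 2222c with c < 3. Each is excluded by
    [tensor_square_alone] in the first two blocks, with c = 1 and c = 0 treated before c = 2. *)
Lemma five_square (f : {perm 'I_5 * 'F_5} -> algC) : charon (altS setT) f ->
  f 1%g = (5 * 5 ^ #|'I_5|)%:R ->
  (forall x : {ffun 'I_5 -> 'F_5}, x != [ffun=> 0] -> f (blk [ffun l => tr (x l)]) = 0) -> False.
Proof.
move=> Nf f1 f0; pose W := tensor_word st F a b 5; pose C := code st F a b (k := 5).
pose three := [:: [:: 0; 0; 5; 0]; [:: 0; 1; 4; 0]; [:: 1; 0; 4; 0]]%N.
have key3 v : (0 < mult f v)%N -> weak5 (key (C v)) -> key (C v) \in three.
  move=> Mv wk; have /allP/(_ _ (key_all (size_code st F a b v))) := refuted5.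
  by rewrite wk (negbTE (not_refuted pw st0 stE L (isT : (1 < 5)%N) Nf f1 f0 Mv)).
have Wkey c v : (c < 3)%N -> key (C v) = key [:: 2; 2; 2; 2; c]%N -> mult f v = mult f (W [:: 2; 2; 2; 2; c]%N).
  move=> c3 kE; apply: (mult_key pw st0 stE L (isT : (1 < 5)%N) Nf) => //.
  rewrite -/(C v) kE (code_word L) //; move=> [[|[|[|[|[|l]]]]] ll] //=; exact: leq_trans c3 _.
(* Every word u y 2 2 c falls under [weak5], and if its key survives it is 2 2 2 2 c itself or, for
   c = 2, a word whose key has already been excluded. *)
pose ok c := all (fun u => all (fun y => let q := key [:: u; y; 2; 2; c]%N in weak5 q &&
   ((q \in three) ==> ((u == 2) && (y == 2) ||
      ((c == 2) && (q \in [:: key [:: 2; 2; 2; 2; 0]; key [:: 2; 2; 2; 2; 1]]%N)))))%N (iota 0 5)) (iota 0 5).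
pose o1 : 'I_5 := 1; have i01 : ord0 != o1 by [].
have M0 c : (c < 3)%N -> ok c -> (c == 2 -> mult f (W [:: 2; 2; 2; 2; 0]%N) = 0%N /\ mult f (W [:: 2; 2; 2; 2; 1]%N) = 0%N) ->
    mult f (W [:: 2; 2; 2; 2; c]%N) = 0%N.
  move=> c3 okc cE; apply: (tensor_square_alone Nf FE i01); rewrite ?ffunE // => v' ag Mv.
  have CE : C v' = [:: index (v' ord0) ls; index (v' o1) ls; 2; 2; c]%N.
    have agE (l : 'I_5) : (1 < l)%N -> index (v' l) ls = nth 0%N [:: 2; 2; 2; 2; c]%N l.
      move=> l2; have n0 : l != ord0 by rewrite -(inj_eq val_inj) gtn_eqF // ltnW.
      have n1 : l != o1 by rewrite -(inj_eq val_inj) gtn_eqF.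
      have /forallP/(_ l) := ag; rewrite (negbTE n0) (negbTE n1) => /orP[//|/eqP->].
      rewrite -nth_code (code_word L) // => -[[|[|[|[|[|q]]]]] lq] //=; exact: leq_trans c3 _.
    have sC : size (C v') = 5%N by apply: size_code.
    apply: (@eq_from_nth _ 0%N) => [|l]; first by rewrite sC.
    rewrite sC => l5.
    rewrite (nth_code _ _ _ _ _ (Ordinal l5)).
    case: l l5 => [|[|l]] l5; last exact: (agE (Ordinal l5)).
      by congr (index (v' _) ls); apply: val_inj.
    by congr (index (v' _) ls); apply: val_inj.
  have idx i : index i ls \in iota 0 5 by rewrite mem_iota leq0n add0n -[X in (_ < X)%N]/(size ls) index_mem all_ls.
  move: (idx (v' ord0)) (idx (v' o1)) CE; move: (index (v' ord0) ls) (index (v' o1) ls) => i0 i1 I0 I1 CE.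
  move/allP: okc => /(_ _ I0)/allP/(_ _ I1) /=; rewrite -CE => /andP[wk /implyP].
  move/(_ (key3 v' Mv wk)) => /orP[/andP[/eqP e0 /eqP e1]|/andP[c2]].
    by rewrite -[v']word_code -/(C v') CE e0 e1.
  have [z0 z1] := cE c2; rewrite !inE => /orP[]/eqP kE; move: Mv; rewrite (Wkey _ _ _ kE) //.
    by rewrite z0.
  by rewrite z1.
have M1 : mult f (W [:: 2; 2; 2; 2; 1]%N) = 0%N by apply: M0.
have M2 : mult f (W [:: 2; 2; 2; 2; 0]%N) = 0%N by apply: M0.
have M3 : mult f (W [:: 2; 2; 2; 2; 2]%N) = 0%N by apply: M0.
have [v Mv /andP[c2 o2]] := many_stars pr pw isT st0 Nf f1 f0 (two_std_five stE Nf) isT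
  ltac:(by rewrite card_ord).
have wk : weak5 (key (C v)) by rewrite /weak5 key_stars key_ones c2 o2.
have := key3 v Mv wk; rewrite !inE => /or3P[]/eqP kE; move: Mv.
- by rewrite (Wkey 2) // M3.
- by rewrite (Wkey 1%N) // M1.
by rewrite (Wkey 0%N) // M2.
Qed.

Lemma five_pair (f : {perm 'I_2 * 'F_5} -> algC) : charon (altS setT) f ->
  f 1%g = (1 * 5 ^ #|'I_2|)%:R ->
  (forall x : {ffun 'I_2 -> 'F_5}, x != [ffun=> 0] -> f (blk [ffun l => tr (x l)]) = 0) -> False.
Proof.
move=> Nf f1 f0; pose C := code st F a b (k := 2).
pose FF : {ffun 'I_2 -> Iirr A} := [ffun=> F].
have starFF v : (0 < mult f v)%N -> (0 < #|stars st v|)%N -> v = FF.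
  move=> Mv; rewrite -key_stars => sv.
  have /allP/(_ _ (key_all (size_code st F a b v))) := refuted2.
  rewrite sv (negbTE (not_refuted pw st0 stE L (isT : (1 < 2)%N) Nf f1 f0 Mv)) /=.
  case/eqP => _ _ + _; rewrite count_code => c2; apply/ffunP=> l; rewrite ffunE.
  have : l \in [set l | pred1 2 (index (v l) ls)].
    have /subset_leqif_cards[_ /esym] : [set l | pred1 2 (index (v l) ls)] \subset [set: 'I_2] by apply: subsetT.
    by rewrite c2 cardsT card_ord eqxx => /eqP->; rewrite inE.
  by rewrite in_set /= => /eqP E; rewrite -(nth_index 0 (all_ls (v l))) /= E.
have M_FF : mult f FF = 0%N.
  have i01 : (ord0 : 'I_2) != 1 by [].
  apply/eqP; rewrite eqn0Ngt; apply/negP => MFF; move: (MFF); rewrite lt0n => /eqP; apply.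
  apply: (tensor_square_alone Nf FE i01); rewrite ?ffunE // => v _ Mv.
  have [s0|] := posnP #|stars st v|; last exact: starFF.
  apply/eqP; apply: contraT => vF.
  have [_ _ _ [dF _ _ _] _] := L.
  (* A word of letters 1 and [st] shares this tuple with F F, since F contains every character;
     together they would weigh 2, above m = 1. *)
  have := le_weights pr pw isT Nf f1 f0 (fun l => if v l == 0 then 0 else 1) [set v; FF].
  rewrite big_setU1 ?inE // big_set1 /= leqNgt => /negP[].
  apply: (@leq_trans (1 + 1)) => //; apply: leq_add; rewrite muln_gt0 ?Mv ?MFF; apply/prodn_gt0 => l.
    have [v0|v0] := eqVneq (v l) 0; first by rewrite v0 (dn0 pr pw isT).
    suff -> : v l = st by rewrite (dn_st pr pw isT stE).
    have := in_set0 l; rewrite -(cards0_eq s0) inE v0 /= => /negbFE/eqP //.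
  by rewrite ffunE dF.
have nostar v : (0 < mult f v)%N -> #|stars st v| = 0%N.
  move=> Mv; have [//|sv] := posnP #|stars st v|.
  by have := Mv; rewrite (starFF v Mv sv) M_FF.
have [v [Mv ov]] := no_ones pr pw isT Nf f1 f0 isT.
have := card_word st0 v; rewrite nostar // ov cards0 addn0 add0n card_ord => s2.
have s1 : (1 < #|stds st v|)%N by rewrite s2.
have [v' Mv' [lt _]] := two_std_step (two_std_five stE Nf) Mv s1.
by move: lt; rewrite (nostar v' Mv').
Qed.

End FiveFinal.

(** * Reductions to fewer points *)

(** Vanishing is required on all nontrivial p-elements instead of one Sylow subgroup, so that it
    survives the averagings without choosing compatible Sylow subgroups. *)
Definition alt_regular (p : nat) (T : finType) (f : {perm T} -> algC) : Prop :=
  [/\ charon (altS setT) f, f 1%g = (p ^ logn p #|T|`!)%:R &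
      forall u, u \in altS setT -> p.-elt u -> u != 1%g -> f u = 0].

Lemma logn_altS p (T : finType) (S : {set T}) : prime p -> odd p ->
  logn p #|altS S| = logn p #|S|`!.
Proof.
move=> pr p2; have [S1|S2] := leqP #|S| 1.
  have -> : #|altS S| = 1%N.
    apply/eqP; rewrite -trivg_card1; apply/eqP/trivgP/subsetP=> g; rewrite altSE inE => /andP[Sg _].
    apply/eqP/permP=> x; rewrite perm1; have [Sx|nSx] := boolP (x \in S); last exact: out_perm Sg nSx.
    have Sgx : g x \in S by rewrite perm_closed.
    by have /card_le1_eqP := S1; apply.
  by case: #|S| S1 => [|[|]].
have := card_altS S2 => <-; rewrite lognM ?cardG_gt0 // (_ : logn p 2 = 0%N) //.
by rewrite lognE pr /=; case: ifP => // /dvdn_leq => /(_ isT); case: (p) pr p2 => [|[|[|]]].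
Qed.

Lemma pext_p_elt p (X Y : finType) (e : X -> Y) (eI : injective e) g :
  p.-elt g -> p.-elt (pext eI g).
Proof.
apply: pnat_dvd; rewrite order_dvdn -(pext1 eI) -(expg_order g).
have -> : forall n, (pext eI g ^+ n = pext eI (g ^+ n))%g; last by rewrite eqxx.
by elim=> [|n IH]; rewrite ?pext1 // !expgS IH pextM.
Qed.

(** Averaging over a Sylow subgroup Q of the alternating group of the other points divides the
    degree by the order of Q. The hypothesis on exponents says that exactly the degree required on
    [X] remains. *)
Lemma alt_regular_drop p (X T : finType) (e : X -> T) (f : {perm T} -> algC) : injective e -> prime p -> odd p ->
  alt_regular p f -> logn p #|T|`! = (logn p #|X|`! + logn p (#|T| - #|X|)`!)%N ->
  exists f' : {perm X} -> algC, alt_regular p f'.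
Proof.
move=> eI pr p2 [Nf f1 f0] cE.
pose V := e @: [set: X]; pose Y := ~: V.
have dVY : [disjoint V & Y] by rewrite -setI_eq0 setICr.
have [Q sylQ] := Sylow_exists p (altS Y); have /and3P[sQ pQ _] := sylQ.
have Ap u : u \in altS setT -> pext eI u \in altS V by apply: pext_alt.
have Npair := charon_pair_slice (A := altS [set: X]) (B := Q) (h1 := pext eI) (h2 := id)
  (fun x y _ _ => pextM eI x y) (fun x y _ _ => erefl) _ _ _ Nf (charon_1 Q).
exists (fun x => dotf Q (fun y => f (pext eI x * y)%g) (fun=> 1)).
have Y1 y : y \in Q -> y \in altS setT by move/(subsetP sQ); apply: (subsetP (altSS (subsetT _))).
have V1 u : u \in altS setT -> pext eI u \in altS setT.
  by move/Ap; apply: (subsetP (altSS (subsetT _))).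
have cVY x y : x \in altS setT -> y \in Q -> commute (pext eI x) y.
  by move=> Ax Qy; apply: (altS_commute dVY); [apply: Ap | apply: (subsetP sQ)].
split.
- by apply: Npair => // x y Ax Qy; apply: cVY.
- rewrite /dotf (bigD1 1%g) //= pext1 mul1g conjC1 mulr1 big1 ?addr0 => [|y /andP[Qy y1]].
    rewrite f1 cE expnD natrM mulrC.
    have -> : #|Q| = (p ^ logn p (#|T| - #|X|)`!)%N.
      rewrite (card_Hall sylQ) p_part (logn_altS _ pr p2); congr (p ^ logn p _`!)%N.
      by rewrite cardsCs setCK card_imset // cardsT.
    by rewrite mulfK // pnatr_eq0 -lt0n expn_gt0 prime_gt0.
  by rewrite mul1g f0 ?mul0r // ?Y1 // (mem_p_elt pQ).
move=> u Au pu u1; rewrite /dotf big1 ?mulr0 // => y Qy.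
rewrite f0 ?mul0r //; [by apply: groupM; [apply: V1 | apply: Y1] | |].
  by apply: p_eltM; [apply: cVY | apply: pext_p_elt | exact: (mem_p_elt pQ Qy)].
apply: contra u1 => /eqP uy; apply/eqP/permP=> x; rewrite perm1; apply: (eI).
rewrite -(pextE eI u x); apply: (@perm_inj _ y).
rewrite -permM uy perm1; apply/esym/(altS_fix (subsetP sQ _ Qy)).
by rewrite inE negbK imset_f.
Qed.

Lemma logn_fact_ext p n N : prime p -> (n < N)%N -> logn p n`! = (\sum_(1 <= i < N) n %/ p ^ i)%N.
Proof.
move=> pr nN; rewrite logn_fact // [RHS](big_cat_nat (n := n.+1)) //= [X in (_ + X)%N]big1_seq ?addn0 // => i.
rewrite mem_index_iota => /andP[_ /andP[ni _]]; apply: divn_small.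
exact: leq_trans ni (ltnW (ltn_expl i (prime_gt1 pr))).
Qed.

Lemma logn_fact_mulp p k : prime p -> logn p (k * p)`! = (k + logn p k`!)%N.
Proof.
move=> pr; have p0 := prime_gt0 pr; case: k => [|k]; first by rewrite mul0n fact0 logn1.
have lt : (k.+1 < (k.+1 * p).+1)%N by rewrite ltnS leq_pmulr.
rewrite (@logn_fact_ext p (k.+1 * p) (k.+1 * p).+2) // (logn_fact_ext pr lt).
rewrite big_nat_recl // expn1 mulnK //; congr (_ + _)%N.
by apply: eq_bigr => i _; rewrite expnSr divnMr.
Qed.

(** Legendre's formula term by term: the condition excludes carries in the sum of a and b. *)
Lemma logn_fact_add p a b : prime p ->
  (forall i, (0 < i)%N -> (p ^ i %| a) || (a + b < p ^ i))%N ->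
  logn p (a + b)`! = (logn p a`! + logn p b`!)%N.
Proof.
move=> pr ab; rewrite !(@logn_fact_ext p _ (a + b).+1) // ?ltnS ?leq_addr ?leq_addl //.
rewrite -big_split /=; apply: eq_big_nat => i /andP[i0 _].
have /orP[dv|lt] := ab i i0; first by rewrite divnDl.
by rewrite !divn_small // (leq_ltn_trans _ lt) ?leq_addr ?leq_addl.
Qed.

Section Wreath.

Variables (p : nat) (I : finType) (f : {perm I * 'F_p} -> algC).
Hypotheses (pr : prime p) (p2 : odd p) (reg : alt_regular p f).

Let trs (x : {ffun I -> 'F_p}) : {perm I * 'F_p} := blk [ffun l => tr (x l)].

Lemma trsE x l a : trs x (l, a) = (l, x l + a).
Proof. by rewrite /trs blkE ffunE trE. Qed.

Lemma trsM x y : (trs x * trs y)%g = trs [ffun l => x l + y l].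
Proof. by apply/permP=> -[l a]; rewrite permM !trsE ffunE addrCA addrA. Qed.

Lemma trs_inj : injective trs.
Proof.
move=> x y E; apply/ffunP=> l; have := congr1 (fun g : {perm _} => (g (l, 0)).2) E.
by rewrite /= !trsE !addr0.
Qed.

Lemma trs_group : group_set (trs @: [set: {ffun I -> 'F_p}]).
Proof.
apply/group_setP; split=> [|_ _ /imsetP[x _ ->] /imsetP[y _ ->]].
  apply/imsetP; exists [ffun=> 0]; rewrite ?inE //; apply/permP=> -[l a].
  by rewrite perm1 trsE ffunE add0r.
by rewrite trsM imset_f ?inE.
Qed.

Definition base : {group {perm I * 'F_p}} := Group trs_group.

Lemma card_base : #|base| = (p ^ #|I|)%N.
Proof. by rewrite /= card_imset ?cardsT ?card_ffun ?card_Fp //; exact: trs_inj. Qed.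

Lemma trs_alt x : trs x \in altS setT.
Proof. by apply: blk_alt; apply/KP=> l; rewrite ffunE tr_alt. Qed.

Lemma trsJ x (s : {perm I}) : (trs x ^ permute 'F_p s = trs [ffun l => x ((s^-1)%g l)])%g.
Proof.
apply: (mulgI (permute 'F_p s)); rewrite -conjgC; apply/permP=> -[l a].
by rewrite !permM permuteE !trsE permuteE ffunE permK.
Qed.

Lemma permute_norm s : permute 'F_p s \in 'N(base).
Proof.
rewrite inE; apply/subsetP=> _ /imsetP[_ /imsetP[x _ ->] ->].
by rewrite trsJ; apply/imsetP; eexists; first exact: in_setT.
Qed.

Lemma permuteM : {morph permute (I := I) 'F_p : s t / (s * t)%g}.
Proof. by move=> s t; apply/permP=> -[l a]; rewrite permM !permuteE permM. Qed.

Lemma trs_p_elt x : p.-elt (trs x).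
Proof.
have /pnat_dvd : (#[trs x] %| p)%N.
  rewrite order_dvdn; have E n : (trs x ^+ n = trs [ffun l => x l *+ n])%g.
    elim: n => [|n IH].
      by apply/permP=> -[l a]; rewrite perm1 trsE ffunE mulr0n add0r.
    by rewrite expgS IH trsM; congr trs; apply/ffunP=> l; rewrite !ffunE mulrS.
  rewrite E; apply/eqP/permP=> -[l a]; rewrite perm1 trsE ffunE -mulr_natr.
  by rewrite pchar_Fp_0 // mulr0 add0r.
by apply; rewrite pnat_id.
Qed.

(** Averaging over the base group divides the degree by p to the number of blocks, which is the
    difference of the exponents of p in (kp)! and k!. Permuting blocks preserves parity because p is
    odd. *)
Lemma alt_regular_wreath : exists f' : {perm I} -> algC, alt_regular p f'.
Proof.
have [Nf f1 f0] := reg; have oF : odd #|'F_p| by rewrite card_Fp.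
have sQ : base \subset altS setT by apply/subsetP=> _ /imsetP[x _ ->]; apply: trs_alt.
pose M := 'N_(altS setT)(base)%G.
have Navg := charon_avg sQ (subsetIl _ _ : M \subset altS setT) (subsetIr _ _) Nf.
have Ms s : s \in altS [set: I] -> permute 'F_p s \in M.
  by move=> As; rewrite inE permute_norm andbT in_altT odd_permute // -in_altT.
exists (fun s => #|base|%:R^-1 * \sum_(q in base) f (permute 'F_p s * q)%g).
have permute1 : permute 'F_p (1%g : {perm I}) = 1%g.
  by apply/permP=> -[l a]; rewrite permuteE !perm1.
split.
- apply: (charon_morph (G := M) (h := permute 'F_p)) Navg => //.
  by move=> s t _ _; apply: permuteM.
- rewrite permute1 (bigD1 1%g) // mul1g big1 => [|q /andP[Qq q1]]; last first.
    rewrite mul1g; apply: f0 => //; first exact: (subsetP sQ).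
    by case/imsetP: Qq => x _ ->; apply: trs_p_elt.
  rewrite /= addr0 f1 card_prod card_Fp // logn_fact_mulp // expnD natrM card_base mulKf //.
  by rewrite pnatr_eq0 -lt0n expn_gt0 prime_gt0.
move=> s As ps s1; rewrite big1 ?mulr0 // => q Qq; apply: f0.
- by rewrite groupM ?(subsetP sQ _ Qq) //; have := Ms s As; rewrite inE => /andP[].
- have pXE n : (permute 'F_p s ^+ n = permute 'F_p (s ^+ n))%g.
    by elim: n => [|n IH]; rewrite ?permute1 // !expgS IH permuteM.
  have Nq : q \in 'N(base) by apply: (subsetP (normG _)).
  have Ns := permute_norm s.
  have Ny : (permute 'F_p s * q)%g \in 'N(base) by rewrite groupM.
  (* Modulo the base group the element is the block permutation s, so its order divides the order of
     s times that of an element of the base group, and is a power of p. *)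
  have yb : ((permute 'F_p s * q) ^+ #[s] \in base)%g.
    apply: coset_idr; first by rewrite groupX.
    rewrite morphX // morphM //= (coset_id Qq) mulg1 -morphX // pXE expg_order permute1 morph1 //.
  have py : p.-elt ((permute 'F_p s * q) ^+ #[s])%g by case/imsetP: yb => x _ ->; apply: trs_p_elt.
  apply: (@pnat_dvd _ (#[s] * #[(permute 'F_p s * q) ^+ #[s]])%N).
    by rewrite order_dvdn expgM expg_order.
  by rewrite pnatM; apply/andP; split.
apply: contra s1 => /eqP E; apply/eqP/permP=> l; rewrite perm1.
case/imsetP: Qq E => x _ -> E; have := congr1 (fun g : {perm _} => (g (l, 0)).1) E.
by rewrite /= permM permuteE trsE perm1.
Qed.

End Wreath.

Lemma logn3_factS n : logn 3 n.+1`! = (logn 3 n.+1 + logn 3 n`!)%N.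
Proof. by rewrite factS lognM // fact_gt0. Qed.

Lemma logn_fact_small p b : prime p -> (b < p)%N -> logn p b`! = 0%N.
Proof.
move=> pr bp; rewrite logn_fact // big1_seq // => i; rewrite mem_index_iota => /andP[_ /andP[i0 _]].
by apply: divn_small; apply: leq_trans bp _; rewrite -{1}(expn1 p) leq_exp2l // prime_gt1.
Qed.

Lemma alt_regular_card p (X T : finType) (f : {perm T} -> algC) : prime p -> odd p ->
  alt_regular p f -> (#|X| <= #|T|)%N ->
  logn p #|T|`! = (logn p #|X|`! + logn p (#|T| - #|X|)`!)%N ->
  exists f' : {perm X} -> algC, alt_regular p f'.
Proof.
move=> pr p2 reg le lE.
apply: (alt_regular_drop (e := fun x => enum_val (widen_ord le (enum_rank x))) _ pr p2 reg lE).
by move=> x y /enum_val_inj /(congr1 val) /= /val_inj /enum_rank_inj.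
Qed.

Lemma alt_regular_bij p (X T : finType) (f : {perm T} -> algC) : prime p -> odd p ->
  alt_regular p f -> #|X| = #|T| -> exists f' : {perm X} -> algC, alt_regular p f'.
Proof.
move=> pr p2 reg E; apply: (alt_regular_card pr p2 reg); rewrite E // subnn.
by rewrite (logn_fact_small pr (prime_gt0 pr)) addn0.
Qed.

(** A 3-cycle in the kernel would make f constant, but f vanishes at an element of order p, which
    exists by Cauchy's theorem. *)
Lemma alt_regular_nontrivial p (T : finType) (f : {perm T} -> algC) (a b c : T) : prime p -> odd p ->
  alt_regular p f -> (0 < logn p #|T|`!)%N -> uniq [:: a; b; c] -> f (cyc3 a b c) != f 1%g.
Proof.
move=> pr p2 [Nf f1 f0] l0 u; apply/eqP => E.
have sT : {subset [:: a; b; c] <= [set: T]} by move=> x _; rewrite inE.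
have [x Ax ox] : {x | x \in altS [set: T] & #[x] = p}.
  by apply: Cauchy => //; move: l0; rewrite -cardsT -(logn_altS _ pr p2) logn_gt0 mem_primes => /and3P[].
have : f x = 0.
  by apply: f0; rewrite // /p_elt ?ox ?pnat_id // -order_eq1 ox neq_ltn prime_gt1 ?orbT.
rewrite (cyc3_trivial Nf u sT E Ax) f1 => /eqP.
by rewrite pnatr_eq0 expn_eq0 eqn0Ngt prime_gt0.
Qed.

Lemma logn_fact_interval p n : prime p -> odd p -> (p <= n < 2 * p)%N -> logn p n`! = 1%N.
Proof.
move=> pr p2 /andP[pn n2]; have p3 := odd_prime_gt2 p2 pr; have [b bE] : exists b, n = (p + b)%N by exists (n - p)%N; lia.
rewrite bE logn_fact_add // => [|i i0].
  rewrite (logn_fact_small pr (_ : b < p)%N); last by lia.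
  by rewrite -[p in p`!]mul1n logn_fact_mulp // (logn_fact_small pr (prime_gt1 pr)).
case: i i0 => [|[|i]] // _; first by rewrite expn1 dvdnn.
apply/orP; right; rewrite -bE; apply: leq_trans n2 _; apply: leq_trans (_ : p ^ 2 <= _)%N.
  by rewrite leq_mul2r ltnW ?orbT.
by rewrite leq_exp2l // prime_gt1.
Qed.

(** The degree is p, while a nontrivial character has degree at least |T| - 1 > p. *)
Lemma no_alt_regular_interval p (T : finType) (f : {perm T} -> algC) : prime p -> odd p -> (4 < p)%N ->
  (p.+1 < #|T| < 2 * p)%N -> alt_regular p f -> False.
Proof.
move=> pr p2 p5 /andP[lt1 lt2] reg; have [Nf f1 f0] := reg.
have T6 : (6 <= #|[set: T]|)%N by rewrite cardsT; lia.
have [a [b [c [d [e [k [u6 s6]]]]]]] := sextuple T6.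
have [u3 _ s3 _ _] := sext_facts u6 s6.
have l1 : logn p #|T|`! = 1%N by rewrite logn_fact_interval // lt2 andbT ltnW // ltnW.
have := alt_min_degree T6 Nf u3 s3 (alt_regular_nontrivial pr p2 reg _ u3).
by rewrite l1 f1 l1 expn1 ler_nat cardsT => /(_ isT); lia.
Qed.

Lemma alt_regular_translations p (I : finType) (f : {perm I * 'F_p} -> algC) : prime p -> odd p ->
  alt_regular p f -> forall x : {ffun I -> 'F_p}, x != [ffun=> 0] -> f (blk [ffun l => tr (x l)]) = 0.
Proof.
move=> pr p2 [_ _ f0] x x0; apply: f0; [exact: trs_alt | exact: trs_p_elt |].
apply: contra x0 => /eqP x1; apply/eqP/(@trs_inj p I); rewrite x1.
by apply/permP=> -[l y]; rewrite perm1 trsE ffunE add0r.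
Qed.

Lemma no_alt_regular_pair p (f : {perm 'I_2 * 'F_p} -> algC) : prime p -> odd p -> (4 < p)%N ->
  alt_regular p f -> False.
Proof.
move=> pr p2 p5 reg; have [w pw] := C_prim_root_exists (prime_gt0 pr).
have [st [st0 stE _]] := @sfix_irr _ [set: 'F_p] ltac:(by rewrite cardsT card_Fp // ltnW).
have f0 := alt_regular_translations pr p2 reg; have [Nf f1 _] := reg.
have {}f1 : f 1%g = (1 * p ^ #|'I_2|)%:R.
  have p3 : (2 < p)%N by lia.
  by rewrite f1 card_prod card_Fp // card_ord logn_fact_mulp // (logn_fact_small pr p3) addn0 mul1n.
have [p7|p7] := leqP 7 p; first exact: (large_pair pr pw p2 p7 st0 stE Nf f1 f0 (card_ord 2) erefl).
have pE : p = 5%N by move: p5 p7 p2; clear; case: p => [|[|[|[|[|[|[|p]]]]]]].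
subst p; have [F [a [b L]]] := letters_exist pw stE.
exact: (five_pair pw st0 stE L Nf f1 f0).
Qed.

Lemma no_alt_regular_square p (f : {perm 'I_p * 'F_p} -> algC) : prime p -> odd p -> (4 < p)%N ->
  alt_regular p f -> False.
Proof.
move=> pr p2 p5 reg; have [w pw] := C_prim_root_exists (prime_gt0 pr).
have [st [st0 stE _]] := @sfix_irr _ [set: 'F_p] ltac:(by rewrite cardsT card_Fp // ltnW).
have f0 := alt_regular_translations pr p2 reg; have [Nf f1 _] := reg.
have {}f1 : f 1%g = (p * p ^ #|'I_p|)%:R.
  rewrite f1 card_prod card_Fp // card_ord logn_fact_mulp // logn_fact_interval //.
    by rewrite addn1 expnS.
  by rewrite leqnn -{1}[p]mul1n ltn_pmul2r ?prime_gt0.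
have [p7|p7] := leqP 7 p; first exact: (large_square pr pw p2 p7 st0 stE Nf f1 f0 (card_ord p) erefl).
have pE : p = 5%N by move: p5 p7 p2; clear; case: p => [|[|[|[|[|[|[|p]]]]]]].
subst p; have [F [a [b L]]] := letters_exist pw stE.
exact: (five_square pw st0 stE L Nf f1 f0).
Qed.

(** Viewing p^(j+3) points as p^(j+2) blocks of p points, the wreath reduction removes one factor p
    at a time. *)
Lemma alt_regular_descend p j (T : finType) (f : {perm T} -> algC) : prime p -> odd p ->
  alt_regular p f -> #|T| = (p ^ j.+2)%N -> exists f' : {perm 'I_(p ^ 2)} -> algC, alt_regular p f'.
Proof.
move=> pr p2; elim: j T f => [|j IH] T f reg cT.
  by apply: (alt_regular_bij pr p2 reg); rewrite card_ord cT.
have [f' reg'] : exists f' : {perm 'I_(p ^ j.+2) * 'F_p} -> algC, alt_regular p f'.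
  by apply: (alt_regular_bij pr p2 reg); rewrite card_prod card_ord card_Fp // cT [RHS]expnSr.
have [f'' reg''] := alt_regular_wreath pr p2 reg'.
by apply: (IH _ _ reg''); rewrite card_ord.
Qed.

Lemma alt_regular_cyc3 (T : finType) (f : {perm T} -> algC) a b c : alt_regular 3 f ->
  uniq [:: a; b; c] -> f (cyc3 a b c) = 0.
Proof.
move=> [_ _ f0] u; apply: f0; last exact: cyc3_neq1.
  by apply: cyc3_alt => // x _; apply: in_setT.
by apply: (@pnat_dvd _ 3) => //; rewrite order_dvdn cyc3_exp3.
Qed.

Lemma alt_regular_cyc33 (T : finType) (f : {perm T} -> algC) a b c d e k : alt_regular 3 f ->
  uniq [:: a; b; c; d; e; k] -> f (cyc3 a b c * cyc3 d e k)%g = 0.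
Proof.
move=> [_ _ f0] u6; have [u1 u2 _ s2 _] := sext_facts u6 (fun x _ => in_setT x).
have Ac (x y z : T) : uniq [:: x; y; z] -> cyc3 x y z \in altS setT.
  by move=> u; apply: cyc3_alt => // t _; apply: in_setT.
have C : commute (cyc3 a b c) (cyc3 d e k).
  apply: (altS_commute (A := [set x in [:: a; b; c]]) (B := [set: T] :\: [set x in [:: a; b; c]])).
  - by rewrite disjoints_subset; apply/subsetP=> x; rewrite !inE => ->.
  - by apply: cyc3_alt => // x; rewrite !inE.
  - exact: cyc3_alt.
apply: f0; first by apply: groupM; apply: Ac.
  by apply: (@pnat_dvd _ 3) => //; rewrite order_dvdn expgMn // !cyc3_exp3 // mulg1.
have nb : b \notin [:: d; e; k].
  by apply/negP => /s2; rewrite !inE eqxx orbT.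
apply/eqP => /permP/(_ a); rewrite permM cyc3_1 // cyc3_D // perm1 => ba.
by move: u1; rewrite ba /= inE eqxx.
Qed.

(** Below p^2 points the reduction goes to 2p, or to 7 when p = 3. From p^2 points on, it goes to
    the largest power of p not above |T| and then down to p^2. *)
Lemma no_alt_regular p (T : finType) (f : {perm T} -> algC) : prime p -> odd p ->
  (maxn 6 p.+1 < #|T|)%N -> alt_regular p f -> False.
Proof.
move=> pr p2; rewrite gtn_max => /andP[T6 Tp] reg; have p3 := odd_prime_gt2 p2 pr.
have p0 := prime_gt0 pr; have p1 := prime_gt1 pr.
have [lt|ge] := ltnP #|T| (p ^ 2).
  have [p5|p5] := leqP 5 p; last first.
    have pE : p = 3 by move: p5 p3 p2; clear; case: p => [|[|[|[|[|p]]]]].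
    subst p; have l7 : logn 3 7`! = 2 by rewrite !logn3_factS.
    have l8 : logn 3 8`! = 2 by rewrite !logn3_factS.
    have [f' [Nf f1 f0]] : exists f' : {perm 'I_7} -> algC, alt_regular 3 f'.
      apply: (alt_regular_card pr p2 reg); rewrite card_ord; first exact: T6.
      have /orP[/eqP->|/eqP->] : (#|T| == 7) || (#|T| == 8).
        by have lt9 : (#|T| < 9)%N := lt; move: T6 lt9; clear; lia.
        by rewrite l7 subnn fact0 logn1.
      by rewrite l8 l7 subSnn factS fact0 muln1 logn1.
    apply: (no_alt7 Nf); first by rewrite f1 card_ord l7.
    by move=> a b c; apply: alt_regular_cyc3 (And3 Nf f1 f0).
  have [lt2|ge2] := ltnP #|T| (2 * p).
    by apply: (no_alt_regular_interval pr p2 p5 _ reg); rewrite Tp.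
  have [f' reg'] : exists f' : {perm 'I_2 * 'F_p} -> algC, alt_regular p f'.
    apply: (alt_regular_card pr p2 reg); rewrite card_prod card_ord card_Fp //.
    have {1}-> : #|T| = (2 * p + (#|T| - 2 * p))%N by rewrite subnKC.
    apply: logn_fact_add => // -[|[|i]] // _; first by rewrite expn1 dvdn_mull.
    by rewrite subnKC // (leq_trans lt) ?orbT // leq_exp2l.
  exact: no_alt_regular_pair reg'.
have jP := trunc_log_bounds p1 (leq_trans (ltn0Sn 6) T6).
set j := trunc_log p #|T| in jP; case/andP: jP => j1 j2.
have j0 : (1 < j)%N by rewrite -ltnS -(ltn_exp2l _ _ p1) (leq_ltn_trans ge).
have [f' reg'] : exists f' : {perm 'I_(p ^ j)} -> algC, alt_regular p f'.
  apply: (alt_regular_card pr p2 reg); rewrite card_ord //.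
  have {1}-> : #|T| = (p ^ j + (#|T| - p ^ j))%N by rewrite subnKC.
  apply: logn_fact_add => // i _; rewrite subnKC //.
  have [ij|ji] := leqP i j; first by rewrite dvdn_exp2l.
  by rewrite (leq_trans j2) ?orbT // leq_exp2l.
have [f2 reg2] : exists f' : {perm 'I_(p ^ 2)} -> algC, alt_regular p f'.
  by apply: (alt_regular_descend (j := j.-2) pr p2 reg'); rewrite card_ord -{1}(subnK j0) addn2 subn2.
have [p5|p5] := leqP 5 p.
  have [f3 reg3] : exists f' : {perm 'I_p * 'F_p} -> algC, alt_regular p f'.
    by apply: (alt_regular_bij pr p2 reg2); rewrite card_prod card_Fp // !card_ord.
  exact: no_alt_regular_square reg3.
have pE : p = 3 by move: p5 p3 p2; clear; case: p => [|[|[|[|[|p]]]]].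
subst p; have l9 : logn 3 9`! = 4 by rewrite !logn3_factS.
have [Nf f1 f0] := reg2.
apply: (no_alt9 Nf); first by rewrite f1 card_ord l9.
  by move=> a b c; apply: alt_regular_cyc3 reg2.
by move=> a b c d e k; apply: alt_regular_cyc33 reg2.
Qed.

Lemma altT_group (T : finType) : altS [set: T] = [group of 'Alt_T].
Proof. by apply/val_inj/altST. Qed.

(** Every p-element is conjugate into [S] by Sylow's theorem, and chi is a class function. *)
Lemma syl_regular_alt p n (S : {group {perm 'I_n}}) (chi : 'CF('Alt_('I_n))) : prime p -> odd p ->
  p.-Sylow('Alt_('I_n)) S -> syl_regular S chi -> alt_regular p chi.
Proof.
move=> pr p2 sylS [Nchi chi1 chi0]; split.
- by rewrite altT_group; apply: charon_char.
- rewrite chi1 (card_Hall sylS) p_part -[#|'I_n|]cardsT -(logn_altS _ pr p2); congr (p ^ logn p _)%:R.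
  by apply: eq_card => g; have /setP/(_ g) := altST 'I_n.
move=> u; rewrite altT_group => Au pu u1.
have uA : <[u]> \subset 'Alt_('I_n) by rewrite cycle_subG.
have [x Ax] := Sylow_Jsub sylS uA pu.
rewrite -cycleJ cycle_subG => Sux; rewrite -(cfunJ chi u Ax).
by apply: chi0; rewrite ?conjg_eq1.
Qed.

(** Here p >= 5 and n >= 6. Some constituent is nontrivial, so its degree is at least n - 1 = p, the
    degree of chi itself; nothing is left for other constituents. *)
Lemma alt_regular_irr p n (chi : 'CF('Alt_('I_n))) : prime p -> odd p -> (n = p.+1) -> (4 < n)%N ->
  chi \is a character -> alt_regular p chi -> chi \in irr 'Alt_('I_n).
Proof.
move=> pr p2 nE n4 Nchi reg; have p3 := odd_prime_gt2 p2 pr.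
have p5 : (4 < p)%N by move: nE n4 p2 p3; clear; case: p => [|[|[|[|[|p]]]]] //; lia.
have T6 : (6 <= #|[set: 'I_n]|)%N by rewrite cardsT card_ord nE.
have [a [b [c [d [e [k [u6 s6]]]]]]] := sextuple T6.
have [u3 _ s3 _ _] := sext_facts u6 s6.
have l1 : logn p #|'I_n|`! = 1%N.
  by rewrite card_ord logn_fact_interval // nE leqnSn /=; lia.
have [_ f1 _] := reg; rewrite l1 expn1 in f1.
have nt := alt_regular_nontrivial pr p2 reg (_ : 0 < _)%N u3; rewrite l1 in nt.
have Ac : cyc3 a b c \in 'Alt_('I_n) by rewrite -altST cyc3_alt.
have [i] : exists i, (i \in irr_constt chi) && ('chi_i (cyc3 a b c) != 'chi_i 1%g).
  apply/existsP; apply: contraT => /existsPn no; case/eqP: (nt isT).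
  rewrite [chi]cfun_sum_constt !sum_cfunE; apply: eq_bigr => i ci; rewrite !cfunE; congr (_ * _).
  by have := no i; rewrite ci negbK => /eqP.
case/andP=> ci nti; have /(constt_charP _ Nchi)[phi Nphi chiE] := ci.
have Ni : charon (altS setT) 'chi_i by rewrite altT_group; apply: charon_irr.
have := alt_min_degree T6 Ni u3 s3 nti; rewrite cardsT card_ord (_ : n.-1 = p) ?nE // -f1 chiE cfunE gerDl => le0.
have phi0 : phi = 0 by apply/eqP; rewrite -(char1_eq0 Nphi) eq_le le0 char1_ge0.
by rewrite phi0 addr0 mem_irr.
Qed.
Theorem theorem6p4 (p n : nat) :
  prime p -> odd p ->
  ((maxn 6 p.+1 < n)%N ->
     forall (S : {group {perm 'I_n}}), (S \in 'Syl_p('Alt_('I_n)))%g ->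
     forall chi : 'CF('Alt_('I_n)), ~ syl_regular S chi)
  /\
  (n = p.+1 -> (4 < n)%N -> (n, p) <> (6%N, 3%N) ->
     forall (S : {group {perm 'I_n}}), (S \in 'Syl_p('Alt_('I_n)))%g ->
     forall chi : 'CF('Alt_('I_n)), syl_regular S chi -> chi \in irr 'Alt_('I_n)).
Proof.
move=> pr p2; split=> [n6 S|nE n4 _ S]; rewrite inE => sylS chi reg.
  apply: (no_alt_regular pr p2 _ (syl_regular_alt pr p2 sylS reg)).
  by rewrite card_ord.
have [Nchi _ _] := reg.
exact: alt_regular_irr (syl_regular_alt pr p2 sylS reg).
Qed.
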